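(* Let $M\in M_2(\mathbb{Z})$ be an expansive integer matrix and let $$D=\left\{\begin{pmatrix}0\\0\end{pmatrix},\begin{pmatrix}\alpha_1\\ \alpha_2\end{pmatrix},\begin{pmatrix}\beta_1\\ \beta_2\end{pmatrix},\begin{pmatrix}-\alpha_1-\beta_1\\ -\alpha_2-\beta_2\end{pmatrix}\right\}\subset\mathbb{Z}^2,\qquad \alpha_1\beta_2-\alpha_2\beta_1\neq 0.$$ Let $\mu_{M,D}$ be the associated self-affine measure. If $\alpha_1\beta_2-\alpha_2\beta_1\notin 2\mathbb{Z}$, then the following statements are equivalent: (i) $\mu_{M,D}$ is a spectral measure; (ii) $M\in M_2(2\mathbb{Z})$; (iii) $M\mathring{\mathcal{F}}_2^2\subset\mathbb{Z}^2$; (iv) $(M,D)$ is admissible.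
   Context: A real square matrix is expansive if all its eigenvalues have modulus strictly greater than one. For an expansive $M\in M_n(\mathbb{R})$ and a finite $D\subset\mathbb{R}^n$, the self-affine measure $\mu_{M,D}$ is the unique Borel probability measure satisfying $\mu_{M,D}=\frac{1}{\#D}\sum_{d\in D}\mu_{M,D}\circ\phi_d^{-1}$, where $\phi_d(x)=M^{-1}(x+d)$. A compactly supported Borel probability measure $\mu$ on $\mathbb{R}^n$ is a spectral measure if there is a countable set $\Lambda\subset\mathbb{R}^n$ such that $\{e^{2\pi i\langle\lambda,x\rangle}:\lambda\in\Lambda\}$ is an orthonormal basis of $L^2(\mu)$. Admissible: for an expansive integer matrix $M\in M_n(\mathbb{Z})$ and a finite set $D\subset\mathbb{Z}^n$ with $\#D=N$, the pair $(M,D)$ is admissible if there is $S\subset\mathbb{Z}^n$ with $\#S=N$ such that the matrix $H=\frac{1}{\sqrt N}\left(e^{2\pi i\langle M^{-1}d,s\rangle}\right)_{d\in D,s\in S}$ is unitary. $M_2(2\mathbb{Z})$ is the set of $2\times2$ matrices with even integer entries. $\mathring{\mathcal{F}}_2^2=\left\{\frac12(l_1,l_2)^t: l_1,l_2\in\{0,1\}\right\}\setminus\{(0,0)^t\}$. *)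

(* Defs.v *)
From HB Require Import structures.
From mathcomp Require Import all_boot all_order all_algebra finmap.
From mathcomp Require Import all_classical all_reals all_analysis.
From mathcomp Require Import spectral.
From mathcomp.real_closed Require Import complex.

Set Implicit Arguments.
Unset Strict Implicit.
Unset Printing Implicit Defensive.

Import Order.TTheory GRing.Theory Num.Theory.
Import numFieldNormedType.Exports.

Local Open Scope fset_scope.
Local Open Scope classical_set_scope.
Local Open Scope complex_scope.
Local Open Scope ring_scope.

(* R^n, as column vectors, with its Borel sigma-algebra. *)
Definition borelRn (R : realType) (n : nat) :=
  g_sigma_algebraType (@open 'cV[R]_n).

Definition col2 (T : Type) (a b : T) : 'cV[T]_2 :=
  \col_(i < 2) if i == ord0 then a else b.

Definition int_mx (R : realType) (m n : nat) (A : 'M[int]_(m, n)) :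
  'M[R]_(m, n) := map_mx intr A.
Arguments int_mx R {m n} A.

Definition dot (R : realType) (n : nat) (x y : 'cV[R]_n) : R :=
  \sum_(i < n) x i ord0 * y i ord0.

(* [expi2pi t] is e^{2 pi i t}. *)
Definition expi2pi (R : realType) (t : R) : R[i] :=
  cos (2 * pi * t) +i* sin (2 * pi * t).

(* The eigenvalues are the complex ones. *)
Definition expansive (R : realType) (n : nat) (M : 'M[R]_n) : Prop :=
  forall a : R[i], eigenvalue (map_mx (real_complex R) M) a -> 1 < `|a|.

Definition digit_map (R : realType) (n : nat) (M : 'M[R]_n) (d : 'cV[R]_n) :
  borelRn R n -> borelRn R n := fun x => invmx M *m (x + d).

(* [mu] is the self-affine measure of (M, D): for M expansive and D nonempty
   exactly one Borel probability measure satisfies this equation. *)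
Definition self_affine_measure (R : realType) (n : nat) (M : 'M[R]_n)
    (D : {fset 'cV[R]_n}) (mu : probability (borelRn R n) R) : Prop :=
  forall A : set (borelRn R n), measurable A ->
    mu A = ((#|` D|%:R^-1)%:E *
            \sum_(d <- D) pushforward mu (digit_map M d) A)%E.

Definition compactly_supported (R : realType) (n : nat)
    (mu : probability (borelRn R n) R) : Prop :=
  exists2 K : set 'cV[R]_n, compact K & mu (~` K) = 0%E.

Section ComplexL2.
Variables (R : realType) (n : nat) (mu : probability (borelRn R n) R).
Implicit Types f g : borelRn R n -> R[i].

Definition cintegral f : R[i] :=
  (\int[mu]_x complex.Re (f x)) +i* (\int[mu]_x complex.Im (f x)).

Definition L2norm f : \bar R :=
  'N[mu]_2%:E[EFin \o @ComplexField.Normc.normc R \o f]%E.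

Definition inL2 f : Prop :=
  [/\ measurable_fun setT (fun x => complex.Re (f x)),
      measurable_fun setT (fun x => complex.Im (f x))
    & (L2norm f < +oo)%E].

Definition L2inner f g : R[i] := cintegral (fun x => f x * (g x)^*).

(* [e] is injective modulo mu-a.e. equality as soon as it is orthonormal, so
   it may be treated as a family indexed by [L]; completeness is the density
   of its linear span. *)
Definition orthonormal_basis (I : choiceType) (L : set I)
    (e : I -> borelRn R n -> R[i]) : Prop :=
  [/\ forall i, L i -> inL2 (e i),
      forall i j, L i -> L j -> L2inner (e i) (e j) = (i == j)%:R
    & forall f, inL2 f -> forall eps : R, 0 < eps ->
        exists (F : {fset I}) (c : I -> R[i]),
          [set` F] `<=` L /\
          (L2norm (fun x => f x - \sum_(i <- F) c i * e i x)%R < eps%:E)%E].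

Definition exponential (l : 'cV[R]_n) : borelRn R n -> R[i] :=
  fun x => expi2pi (dot l x).

Definition spectral_measure : Prop :=
  compactly_supported mu /\
  exists L : set 'cV[R]_n, countable L /\ orthonormal_basis L exponential.

End ComplexL2.

(* The rows and columns of the matrix are indexed by the positions in the
   duplicate-free enumerations of D and S. *)
Definition admissible_mx (R : realType) (n : nat) (M : 'M[int]_n)
    (D S : {fset 'cV[int]_n}) : 'M[R[i]]_(#|` D|) :=
  ((Num.sqrt (#|` D|%:R : R))^-1)%:C *:
  \matrix_(i, j) expi2pi (dot (invmx (int_mx R M) *m int_mx R D`_i)
                              (int_mx R S`_j)).

Definition admissible (R : realType) (n : nat) (M : 'M[int]_n)
    (D : {fset 'cV[int]_n}) : Prop :=
  exists S : {fset 'cV[int]_n},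
    #|` S| = #|` D| /\ admissible_mx R M D S \is unitarymx.

(* Half the nonzero 0-1 vectors of R^2. *)
Definition F22 (R : realType) : set 'cV[R]_2 :=
  [set 2^-1 *: col2 l1 l2 | l1 in [set 0; 1] & l2 in [set 0; 1]] `\ 0.
Arguments F22 R : clear implicits.

(* Main.v *)
Require Import Defs.
From HB Require Import structures.
From mathcomp Require Import all_boot all_order all_algebra finmap.
From mathcomp Require Import all_classical all_reals all_analysis.
From mathcomp Require Import measurable_realfun spectral ring lra.
From mathcomp.real_closed Require Import complex.

Set Implicit Arguments.
Unset Strict Implicit.
Unset Printing Implicit Defensive.

Import Order.TTheory GRing.Theory Num.Theory.
Import numFieldNormedType.Exports.

Local Open Scope fset_scope.
Local Open Scope classical_set_scope.
Local Open Scope ring_scope.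

(** Why the theorem holds. Put A = M^T, let B have the rows alpha and beta, p =
det B (odd), and let mask x be the average of exp (2 pi i <d, x>) over the
digits d. The Fourier transform ft of the measure satisfies
ft (A x) = mask x * ft x (ft_mask). The four unimodular terms of the mask cancel
only if they are signs (tetra_mask_eq0), so mask x = 0 exactly when 2 B x is an
integer vector that is not even, and the zeros of ft are the points A^k y with
k >= 1 and mask y = 0 (ft_eq0_mask). Moreover the squared masks at x + v / 2,
with v in {0, 1}^2, add up to 1 (weight_half_sum, coset_weight_sum).

A set L of frequencies gives an orthonormal basis if and only if the differences
of its points are zeros of ft and Parseval's identity holds for every
exponential, that is, the squares |ft (xi + l)|^2 add up to 1 for every xi
(orthonormal_basis_saturated, saturated_orthonormal_basis). For the converse
the span of all exponentials has to be dense in L^2; this is obtained by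
passing from exponentials to half-spaces, boxes and all Borel sets
(in_L2_closure_full).

Spectral implies even (spectrum_evenmx). For l in a spectrum containing 0 the
vector 2 p B A^-1 l is integral. Sorting l by the parity of this vector splits
A^-1 L into four sets, each of which is orthogonal, and each of which satisfies
Parseval at every point theta with 2 p B theta not integral
(class_set_saturated). Applying this twice produces points of every parity class
whose image under A is in the even class, and this says that A adj(B) is even.

Even implies spectral (exists_spectrum). Write A = 2 H. Call period a vector x
such that B H^i x is integral for all i. By a 2-adic argument ft cannot vanish
on a whole translate of the group of periods (ft_nonvanishing), and compactness
gives a uniform lower bound. The four vectors H v, v in {0, 1}^2, yield finite
sets on which products of n squared masks form a partition of unity; moving the
new points by periods keeps ft bounded below on the scaled sets, and this passes
Parseval's identity to the union.

Finally, half the vectors (1, 0) and (0, 1) detect the columns of M, which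
relates (ii) and (iii). Admissibility says that the mask vanishes at
A^-1 (s - s') for distinct s and s' in S. This holds for S = H {0, 1}^2, and
conversely it makes the vectors 2 B A^-1 (s - s_0) run through the four parity
classes, so that A adj(B) is even again. *)

(** * The tetrahedral mask *)

Section Exponential.
Variable R : realType.
Local Notation normc := ComplexField.Normc.normc.
Implicit Types (t u a b : R).

Lemma expi2piD t u : expi2pi (t + u) = expi2pi t * expi2pi u :> R[i].
Proof.
rewrite /expi2pi mulrDr cosD sinD; apply/eqP; rewrite eq_complex /=.
by rewrite eqxx /= [X in _ == X]addrC eqxx.
Qed.

Lemma expi2pi0 : expi2pi 0 = 1 :> R[i].
Proof. by rewrite /expi2pi mulr0 cos0 sin0. Qed.

Lemma expi2piN t : expi2pi (- t) = (expi2pi t)^*%C.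
Proof. by rewrite /expi2pi mulrN cosN sinN. Qed.

Lemma expi2pi_mulJ t : expi2pi t * (expi2pi t)^*%C = 1 :> R[i].
Proof. by rewrite -expi2piN -expi2piD subrr expi2pi0. Qed.

Lemma expi2pi_neq0 t : expi2pi t != 0.
Proof.
by apply/eqP => h; have := expi2pi_mulJ t; rewrite h mul0r => /esym/eqP; rewrite oner_eq0.
Qed.

Lemma expi2piV t : (expi2pi t)^-1 = (expi2pi t)^*%C.
Proof.
by apply: (mulfI (expi2pi_neq0 t)); rewrite mulfV ?expi2pi_neq0// expi2pi_mulJ.
Qed.

Lemma normc_expi2pi t : normc (expi2pi t) = 1.
Proof. by rewrite /normc /= cos2Dsin2 sqrtr1. Qed.

Lemma expi2pi_nat n : expi2pi n%:R = 1 :> R[i].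
Proof.
elim: n => [|n IH]; first by rewrite expi2pi0.
rewrite -natr1 expi2piD IH mul1r /expi2pi mulr1 mulr_natl cos2pi sin2pi.
by [].
Qed.

Lemma expi2pi_int (m : int) : expi2pi m%:~R = 1 :> R[i].
Proof.
case: m => n; first by rewrite expi2pi_nat.
by rewrite NegzE mulrNz expi2piN expi2pi_nat conjc1.
Qed.

(** With the fractional part r of t in [0, 1), cos (2 pi r) = 1 forces
sin (pi r) = 0, whereas sin is positive on (0, pi). *)
Lemma expi2pi_eq1 t : expi2pi t = 1 -> exists m : int, t = m%:~R.
Proof.
set m := Num.floor t; set r := t - m%:~R => h.
have r0 : 0 <= r by rewrite subr_ge0 floor_le_tmp.
have r1 : r < 1 by rewrite ltrBlDl -[X in _ < _ + X]/(1%:~R) -intrD lt_succ_floor.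
have hr : expi2pi r = 1 :> R[i].
  by rewrite /r expi2piD h mul1r -mulrNz expi2pi_int.
exists m; apply/eqP; rewrite -subr_eq0 -/r; apply/eqP.
apply/eqP; rewrite eq_le r0 andbT leNgt; apply/negP => rp.
have : sin (pi * r) = 0.
  have /(congr1 (@complex.Re R)) /= := hr.
  rewrite -mulrA mulr_natl cos_mulr2n => hc.
  apply: cos1sin0; apply/eqP; rewrite -sqr_norm_eq1; apply/eqP.
  by lra.
apply/eqP; rewrite gt_eqF// sin_gt0_pi// mulr_gt0 ?pi_gt0//=.
by rewrite gtr_pMr ?pi_gt0.
Qed.


(** The squared modulus is kept as a real polynomial in the real and imaginary
parts, so that identities about it are settled by ring. *)
Definition sqmod (z : R[i]) : R := complex.Re z ^+ 2 + complex.Im z ^+ 2.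

Lemma sqmodE z : (sqmod z)%:C%C = z * z^*%C.
Proof.
case: z => x y; rewrite /sqmod; apply/eqP; rewrite eq_complex /=.
by apply/andP; split; apply/eqP; ring.
Qed.

Lemma sqmod_normc z : sqmod z = normc z ^+ 2.
Proof. by case: z => x y; rewrite /sqmod /normc sqr_sqrtr // addr_ge0 // sqr_ge0. Qed.

Lemma sqmod_ge0 z : 0 <= sqmod z.
Proof. by rewrite addr_ge0 // sqr_ge0. Qed.

Lemma sqmodM : {morph sqmod : z w / z * w}.
Proof. by case=> x y [z w]; rewrite /sqmod /=; ring. Qed.

Lemma sqmodJ z : sqmod z^*%C = sqmod z.
Proof. by case: z => x y; rewrite /sqmod /= sqrrN. Qed.

Lemma sqmod0 : sqmod 0 = 0.
Proof. by rewrite /sqmod /= expr0n addr0. Qed.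

Lemma sqmod1 : sqmod 1 = 1.
Proof. by rewrite /sqmod /= expr1n expr0n addr0. Qed.

Lemma sqmod_eq0 z : (sqmod z == 0) = (z == 0).
Proof.
case: z => x y.
by rewrite /sqmod paddr_eq0 ?sqr_ge0 // !sqrf_eq0 eq_complex.
Qed.

Lemma sqmod_expi2pi t : sqmod (expi2pi t) = 1.
Proof. by rewrite sqmod_normc normc_expi2pi expr1n. Qed.

(** The normalised exponential sum of the digits 0, alpha, beta, -alpha-beta
at x, as a function of a = <alpha, x> and b = <beta, x>. *)
Definition tetra_mask a b : R[i] :=
  4^-1 * (1 + expi2pi a + expi2pi b + expi2pi (- a - b)).

Lemma tetra_mask_int a b (m n : int) :
  tetra_mask (a + m%:~R) (b + n%:~R) = tetra_mask a b.
Proof.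
rewrite /tetra_mask !opprD addrACA !expi2piD -!mulrNz !expi2pi_int.
by rewrite !mulr1.
Qed.

Lemma tetra_mask0 : tetra_mask 0 0 = 1.
Proof.
rewrite /tetra_mask oppr0 addr0 expi2pi0.
by rewrite -(natrD _ 1 1) -!natr1 add0r; field.
Qed.

(** The second equation is the complex conjugate of the first when x and y are
unimodular. With q = x y, combining them gives (q + 1)^2 (q - 1) = 0, and in
either case x and y are signs. *)
Lemma sum4_unimodular_eq0 (K : fieldType) (x y : K) : x != 0 -> y != 0 ->
  1 + x + y + (x * y)^-1 = 0 -> 1 + x^-1 + y^-1 + x * y = 0 ->
  x ^+ 2 = 1 /\ y ^+ 2 = 1.
Proof.
move=> x0 y0 h1 h2.
have e1 : (x * y) * (1 + x + y) + 1 = 0.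
  have -> : (x * y) * (1 + x + y) + 1 = (x * y) * (1 + x + y + (x * y)^-1).
    by field; rewrite x0 y0.
  by rewrite h1 mulr0.
have e2 : x * y + x + y + (x * y) ^+ 2 = 0.
  have -> : x * y + x + y + (x * y) ^+ 2 =
    (x * y) * (1 + x^-1 + y^-1 + x * y) by field; rewrite x0 y0.
  by rewrite h2 mulr0.
have /eqP : (x * y + 1) * (x * y + 1) * (x * y - 1) = 0.
  have -> : (x * y + 1) * (x * y + 1) * (x * y - 1) =
    (x * y) * (x * y + x + y + (x * y) ^+ 2)
    - ((x * y) * (1 + x + y) + 1) by ring.
  by rewrite e1 e2 mulr0 subr0.
rewrite !mulf_eq0 orbb subr_eq0 addr_eq0 => /orP[]/eqP q.
  have s0 : y = - x.
    by apply/eqP; rewrite -addr_eq0 -e2 q; apply/eqP; ring.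
  by rewrite s0 sqrrN; move: q; rewrite s0 mulrN -expr2 => /oppr_inj.
have s2 : y = - 2 - x.
  by apply/eqP; rewrite -subr_eq0 -e2 q; apply/eqP; ring.
have /eqP : (x + 1) ^+ 2 = 0.
  have -> : (x + 1) ^+ 2 = 1 - x * y by rewrite s2; ring.
  by rewrite q subrr.
rewrite expf_eq0 /= addr_eq0 => /eqP x1.
by rewrite s2 x1 sqrrN expr1n; split => //; ring.
Qed.

Lemma expi2pi_double t : expi2pi t ^+ 2 = expi2pi (2 * t) :> R[i].
Proof. by rewrite expr2 -expi2piD mulr_natl. Qed.

(** Conjugation supplies the second equation of sum4_unimodular_eq0, and the two
signs are not both 1 since the sum would be 4. The shape of the digit set, four
vectors of sum 0, enters here. *)
Lemma tetra_mask_eq0 a b : tetra_mask a b = 0 ->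
  exists m n : int, [/\ 2 * a = m%:~R, 2 * b = n%:~R &
     ~ ((2 %| m)%Z /\ (2 %| n)%Z)].
Proof.
move=> /[dup] h0; rewrite /tetra_mask => /eqP.
rewrite mulf_eq0 invr_eq0 pnatr_eq0 /= => /eqP h.
have e3 : expi2pi (- a - b) = (expi2pi a * expi2pi b)^-1.
  by rewrite invfM !expi2piV expi2piD !expi2piN.
rewrite e3 in h.
have [xa xb] : expi2pi a ^+ 2 = 1 /\ expi2pi b ^+ 2 = 1 :> R[i].
  apply: sum4_unimodular_eq0 => //; rewrite ?expi2pi_neq0 //.
  rewrite !expi2piV; have /(congr1 (@conjc R)) := h.
  rewrite invfM !expi2piV rmorph0 => h'; rewrite -[RHS]h'.
  by rewrite !rmorphD !rmorphM rmorph1 /= !opprK.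
rewrite !expi2pi_double in xa xb.
have [m am] := expi2pi_eq1 xa; have [n bn] := expi2pi_eq1 xb.
exists m, n; split=> // -[/dvdzP[m' em] /dvdzP[n' en]].
have ea : a = 0 + m'%:~R.
  by move: am; rewrite em intrM add0r mulrC => /mulIf; apply; rewrite pnatr_eq0.
have eb : b = 0 + n'%:~R.
  by move: bn; rewrite en intrM add0r mulrC => /mulIf; apply; rewrite pnatr_eq0.
by move: h0; rewrite ea eb tetra_mask_int tetra_mask0 => /eqP; rewrite oner_eq0.
Qed.

Lemma expi2pi_half : expi2pi 2^-1 = -1 :> R[i].
Proof.
rewrite /expi2pi mulrAC divff ?pnatr_eq0 // mul1r cospi sinpi.
by apply/eqP; rewrite eq_complex /= oppr0 !eqxx.
Qed.

Lemma expi2piDhalf t : expi2pi (t + 2^-1) = - expi2pi t.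
Proof. by rewrite expi2piD expi2pi_half mulrN1. Qed.

Lemma expi2piBhalf t : expi2pi (t - 2^-1) = - expi2pi t.
Proof.
by rewrite -[in RHS](subrK 2^-1 t) expi2piDhalf opprK.
Qed.

(** Parallelogram identity for the four sign characters of (Z/2)^2. *)
Lemma sqmod_sum_signs (c x y z : R[i]) :
  sqmod (c * (1 + x + y + z)) + sqmod (c * (1 - x + y - z)) +
  (sqmod (c * (1 + x - y - z)) + sqmod (c * (1 - x - y + z))) =
  4 * sqmod c * (1 + sqmod x + sqmod y + sqmod z).
Proof.
case: c x y z => [c1 c2] [x1 x2] [y1 y2] [z1 z2].
by rewrite /sqmod /=; ring.
Qed.

(** Half-integer shifts of (a, b) change signs of the terms of the mask
according to the characters of (Z/2)^2. This partition of unity governs both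
directions of the proof. *)
Lemma sum_tetra_mask a b :
  sqmod (tetra_mask a b) + sqmod (tetra_mask (a + 2^-1) b) +
  (sqmod (tetra_mask a (b + 2^-1)) + sqmod (tetra_mask (a + 2^-1) (b + 2^-1)))
  = 1.
Proof.
rewrite /tetra_mask.
have -> : - (a + 2^-1) - b = - a - b - 2^-1 by ring.
have -> : - a - (b + 2^-1) = - a - b - 2^-1 by ring.
have -> : - (a + 2^-1) - (b + 2^-1) = - a - b - 2^-1 - 2^-1 by ring.
rewrite !(expi2piDhalf, expi2piBhalf) opprK sqmod_sum_signs !sqmod_expi2pi.
have -> : (4^-1 : R[i]) = (4^-1)%:C%C.
  by rewrite fmorphV /= rmorph_nat.
by rewrite /sqmod /= expr0n addr0; field.
Qed.

Lemma tetra_mask_le1 a b : sqmod (tetra_mask a b) <= 1.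
Proof.
have := sum_tetra_mask a b.
have := sqmod_ge0 (tetra_mask (a + 2^-1) b).
have := sqmod_ge0 (tetra_mask a (b + 2^-1)).
have := sqmod_ge0 (tetra_mask (a + 2^-1) (b + 2^-1)).
lra.
Qed.

End Exponential.

(** * Complex integrals of bounded functions *)

Section BoundedFunctions.
Context d (T : measurableType d) (R : realType).
Variable mu : probability T R.
Local Notation Re := (@complex.Re R).
Local Notation Im := (@complex.Im R).
Implicit Types (f g : T -> R) (u v : T -> R[i]).

(** Bounded measurable functions: closed under all the operations below and
integrable for a probability, so that no integrability condition remains. *)
Definition bmf f := measurable_fun setT f /\ exists C : R, forall x, `|f x| <= C.

Lemma bmf_cst (c : R) : bmf (fun=> c).
Proof. by split; [exact: measurable_cst | exists `|c|]. Qed.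

Lemma bmfD f g : bmf f -> bmf g -> bmf (fun x => f x + g x).
Proof.
move=> [mf [C hC]] [mg [C' hC']]; split; first exact: measurable_funD.
by exists (C + C') => x; rewrite (le_trans (ler_normD _ _)) // lerD.
Qed.

Lemma bmfM f g : bmf f -> bmf g -> bmf (fun x => f x * g x).
Proof.
move=> [mf [C hC]] [mg [C' hC']]; split; first exact: measurable_funM.
by exists (C * C') => x; rewrite normrM ler_pM.
Qed.

Lemma bmfN f : bmf f -> bmf (fun x => - f x).
Proof.
move=> [mf [C hC]]; split; first exact: measurableT_comp.
by exists C => x; rewrite normrN.
Qed.

Lemma bmfB f g : bmf f -> bmf g -> bmf (fun x => f x - g x).
Proof. by move=> bf bg; apply: bmfD => //; apply: bmfN. Qed.

Lemma bmf_integrable f : bmf f -> mu.-integrable setT (EFin \o f).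
Proof.
move=> [mf [C hC]]; apply: measurable_bounded_integrable => //.
  by have h : (mu setT < +oo)%E; [rewrite probability_setT ltry | exact: h].
exists C; split; first exact: num_real.
by move=> M CM x _ /=; rewrite (le_trans (hC x)) // ltW.
Qed.

Definition bmfc u := bmf (Re \o u) /\ bmf (Im \o u).

Lemma bmfc_cst (c : R[i]) : bmfc (fun=> c).
Proof. by split; exact: bmf_cst. Qed.

Lemma bmfcD u v : bmfc u -> bmfc v -> bmfc (fun x => u x + v x).
Proof.
move=> [ur ui] [vr vi]; split.
- rewrite (_ : _ \o _ = fun x => Re (u x) + Re (v x)); first exact: bmfD.
  by apply/funext => x /=; case: (u x) (v x) => ? ? [].
- rewrite (_ : _ \o _ = fun x => Im (u x) + Im (v x)); first exact: bmfD.
  by apply/funext => x /=; case: (u x) (v x) => ? ? [].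
Qed.

Lemma bmfcM u v : bmfc u -> bmfc v -> bmfc (fun x => u x * v x).
Proof.
move=> [ur ui] [vr vi]; split.
- rewrite (_ : _ \o _ = fun x => Re (u x) * Re (v x) - Im (u x) * Im (v x)).
    by apply: bmfB; apply: bmfM.
  by apply/funext => x /=; case: (u x) (v x) => ? ? [].
- rewrite (_ : _ \o _ = fun x => Re (u x) * Im (v x) + Im (u x) * Re (v x)).
    by apply: bmfD; apply: bmfM.
  by apply/funext => x /=; case: (u x) (v x) => ? ? [].
Qed.

Lemma bmfcJ u : bmfc u -> bmfc (fun x => (u x)^*%C).
Proof.
move=> [ur ui]; split.
- rewrite (_ : _ \o _ = Re \o u) //.
  by apply/funext => x /=; case: (u x).
- rewrite (_ : _ \o _ = fun x => - Im (u x)); first exact: bmfN.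
  by apply/funext => x /=; case: (u x).
Qed.

Lemma bmfc_sum (I : Type) (s : seq I) (F : I -> T -> R[i]) :
  (forall i, bmfc (F i)) -> bmfc (fun x => \sum_(i <- s) F i x).
Proof.
move=> hF; elim: s => [|i s IH].
  by under eq_fun do rewrite big_nil; exact: bmfc_cst.
by under eq_fun do rewrite big_cons; exact: bmfcD.
Qed.

Lemma bmf_sqmod u : bmfc u -> bmf (fun x => sqmod (u x)).
Proof.
move=> [ur ui]; rewrite /sqmod; apply: bmfD.
- by under eq_fun do rewrite expr2; exact: bmfM.
- by under eq_fun do rewrite expr2; exact: bmfM.
Qed.

Lemma bmfc_real f : bmf f -> bmfc (fun x => (f x)%:C%C).
Proof. by move=> bf; split => //; exact: bmf_cst. Qed.

Definition cint u : R[i] := ((\int[mu]_x Re (u x)) +i* (\int[mu]_x Im (u x)))%C.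

Lemma bRintegralD f g : bmf f -> bmf g ->
  \int[mu]_x (f x + g x) = \int[mu]_x f x + \int[mu]_x g x.
Proof. by move=> bf bg; rewrite RintegralD //; exact: bmf_integrable. Qed.

Lemma bRintegralB f g : bmf f -> bmf g ->
  \int[mu]_x (f x - g x) = \int[mu]_x f x - \int[mu]_x g x.
Proof. by move=> bf bg; rewrite RintegralB //; exact: bmf_integrable. Qed.

Lemma bRintegral_cst (c : R) : \int[mu]_x c = c.
Proof. by rewrite Rintegral_cst //= probability_setT /= mulr1. Qed.

Lemma bRintegralZ (c : R) f : bmf f ->
  \int[mu]_x (c * f x) = c * \int[mu]_x f x.
Proof. by move=> bf; rewrite RintegralZl //; exact: bmf_integrable. Qed.

Lemma cintD u v : bmfc u -> bmfc v ->
  cint (fun x => u x + v x) = cint u + cint v.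
Proof.
move=> [ur ui] [vr vi]; rewrite /cint; apply/eqP; rewrite eq_complex /=.
rewrite -!bRintegralD //.
by apply/andP; split; apply/eqP; apply: eq_Rintegral => x _;
  case: (u x) (v x) => ? ? [].
Qed.

Lemma cintZ (c : R[i]) u : bmfc u -> cint (fun x => c * u x) = c * cint u.
Proof.
move=> [ur ui]; case: c => a b; rewrite /cint; apply/eqP; rewrite eq_complex /=.
rewrite -!bRintegralZ // -bRintegralB -?bRintegralD //;
  try by apply: bmfM => //; exact: bmf_cst.
by apply/andP; split; apply/eqP; apply: eq_Rintegral => x _; case: (u x).
Qed.

Lemma cint_sum (I : Type) (s : seq I) (F : I -> T -> R[i]) :
  (forall i, bmfc (F i)) ->
  cint (fun x => \sum_(i <- s) F i x) = \sum_(i <- s) cint (F i).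
Proof.
move=> hF; elim: s => [|i s IH].
  rewrite big_nil /cint; under eq_Rintegral do rewrite big_nil.
  under [X in (_ +i* X)%C]eq_Rintegral do rewrite big_nil.
  by rewrite !bRintegral_cst.
rewrite big_cons -IH -cintD //; last exact: bmfc_sum.
by congr cint; apply/funext => x; rewrite big_cons.
Qed.

Lemma cint_cst (c : R[i]) : cint (fun=> c) = c.
Proof.
by rewrite /cint !bRintegral_cst; case: c.
Qed.

Lemma cint_real f : cint (fun x => (f x)%:C%C) = (\int[mu]_x f x)%:C%C.
Proof. by rewrite /cint /= bRintegral_cst. Qed.

Lemma cintJ u : bmfc u -> cint (fun x => (u x)^*%C) = (cint u)^*%C.
Proof.
move=> [ur ui]; rewrite /cint /=; congr (_ +i* _)%C.
  by apply: eq_Rintegral => x _; case: (u x).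
rewrite -[RHS]mulN1r -bRintegralZ //.
by apply: eq_Rintegral => x _; case: (u x) => a b /=; rewrite mulN1r.
Qed.

(** Expand the nonnegative integral of |u - c|^2 at the mean c of u. *)
Lemma sqmod_cint_le u : bmfc u -> sqmod (cint u) <= \int[mu]_x sqmod (u x).
Proof.
move=> bu; pose c := cint u.
have b2 : bmf (fun x => sqmod (u x)) by exact: bmf_sqmod.
have bc : bmfc (fun x => u x - c) by apply: bmfcD => //; exact: bmfc_cst.
have : 0 <= \int[mu]_x sqmod (u x - c).
  by apply: Rintegral_ge0 => x _; exact: sqmod_ge0.
suff -> : \int[mu]_x sqmod (u x - c) = \int[mu]_x sqmod (u x) - sqmod c.
  by rewrite subr_ge0.
case: (bu) => ur ui.
transitivity (\int[mu]_x (sqmod (u x) + (sqmod c - 2 * Re c * Re (u x) - 2 * Im c * Im (u x)))).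
  by apply: eq_Rintegral => x _; rewrite /sqmod; case: (u x) (c) => ? ? [? ?] /=; ring.
have b1 (k : R) f : bmf f -> bmf (fun x => k * f x).
  by move=> bf; apply: bmfM => //; exact: bmf_cst.
have bR := b1 (2 * Re c) _ ur; have bI := b1 (2 * Im c) _ ui.
have b0 := bmf_cst (sqmod c).
rewrite bRintegralD ?bRintegralB ?bRintegralZ //; try by do ?[apply: bmfB].
rewrite bRintegral_cst.
by rewrite /sqmod /c /cint /=; ring.
Qed.

End BoundedFunctions.

(** * Norms of matrices and Borel maps *)

Section MatrixNorm.
Variable R : realType.

Lemma mx_entry_le m n (A : 'M[R]_(m, n)) i j : `|A i j| <= `|A|.
Proof.
rewrite [leRHS]/Num.Def.normr /= mx_normrE.
exact: (le_bigmax _ (fun ij => `|A ij.1 ij.2|) (i, j)).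
Qed.

Lemma mx_norm_le m n (A : 'M[R]_(m, n)) (c : R) : 0 <= c ->
  (forall i j, `|A i j| <= c) -> `|A| <= c.
Proof.
move=> c0 h; rewrite [leLHS]/Num.Def.normr /= mx_normrE.
by apply: bigmax_le => // -[i j] _; exact: h.
Qed.

Lemma mx_norm_mulmx m n p (A : 'M[R]_(m, n)) (B : 'M[R]_(n, p)) :
  `|A *m B| <= n%:R * `|A| * `|B|.
Proof.
apply: mx_norm_le => [|i j]; first by rewrite !mulr_ge0.
rewrite mxE (le_trans (ler_norm_sum _ _ _)) //.
rewrite (le_trans (ler_sum _ (G := fun=> `|A| * `|B|) _)) //.
  by move=> k _; rewrite normrM ler_pM // mx_entry_le.
by rewrite sumr_const card_ord -mulrA mulr_natl.
Qed.

Lemma lipschitz_continuous (V W : normedModType R) (f : V -> W) (C : R) :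
  (forall x y, `|f x - f y| <= C * `|x - y|) -> continuous f.
Proof.
move=> hf x; apply/cvgrPdist_le => /= e e0.
have C0 : 0 < `|C| + 1 by rewrite ltr_wpDl.
near=> y; rewrite (le_trans (hf _ _)) //.
rewrite (@le_trans _ _ ((`|C| + 1) * `|x - y|)) //.
  by rewrite ler_wpM2r // (le_trans (ler_norm C)) // lerDl.
rewrite -ler_pdivlMl // mulrC.
near: y; apply: cvgr_dist_le => //; exact: divr_gt0.
Unshelve. all: by end_near. Qed.

End MatrixNorm.

Section BorelMeasurability.
Variables (R : realType) (n : nat).

Lemma open_borelRn (A : set 'cV[R]_n) : open A ->
  measurable (A : set (borelRn R n)).
Proof. exact: sub_sigma_algebra. Qed.

Lemma continuous_borelRn (f : 'cV[R]_n -> R) : continuous f ->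
  measurable_fun setT (f : borelRn R n -> R).
Proof.
move=> cf; apply: (measurability _ (RGenOpens.measurableE R)).
move=> _ [_ [a [b ->]] <-]; rewrite setTI.
apply: open_borelRn; apply: open_comp => //; exact: interval_open.
Qed.

Lemma continuous_borelRn_map (g : 'cV[R]_n -> 'cV[R]_n) : continuous g ->
  measurable_fun setT (g : borelRn R n -> borelRn R n).
Proof.
move=> cg; apply: (@measurability _ _ (borelRn R n) (borelRn R n) setT g (@open 'cV[R]_n)) => //.
move=> _ [B oB <-]; rewrite setTI; apply: open_borelRn.
by apply: open_comp.
Qed.


End BorelMeasurability.

(** * The Fourier transform of a self-affine measure *)

Section FourierTransform.
Variables (R : realType) (n : nat) (mu : probability (borelRn R n) R).
Implicit Types (x y l : 'cV[R]_n).

Lemma dotDl x y l : dot (x + y) l = dot x l + dot y l.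
Proof.
by rewrite /dot -big_split /=; apply: eq_bigr => i _; rewrite mxE mulrDl.
Qed.

Lemma dotNl x l : dot (- x) l = - dot x l.
Proof.
by rewrite /dot -sumrN; apply: eq_bigr => i _; rewrite mxE mulNr.
Qed.

Lemma dotZl (c : R) x l : dot (c *: x) l = c * dot x l.
Proof.
by rewrite /dot mulr_sumr; apply: eq_bigr => i _; rewrite mxE mulrA.
Qed.

Lemma dotC x y : dot x y = dot y x.
Proof. by rewrite /dot; apply: eq_bigr => i _; rewrite mulrC. Qed.

Lemma dot0l l : dot 0 l = 0.
Proof. by rewrite /dot big1 // => i _; rewrite mxE mul0r. Qed.

Lemma dotE x y : dot x y = (x^T *m y) ord0 ord0.
Proof. by rewrite /dot mxE; apply: eq_bigr => i _; rewrite mxE. Qed.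

Lemma dot_mulmxr x (M : 'M[R]_n) y : dot x (M *m y) = dot (M^T *m x) y.
Proof. by rewrite !dotE trmx_mul trmxK mulmxA. Qed.

Lemma dot_le x y : `|dot x y| <= n%:R * `|x| * `|y|.
Proof.
rewrite dotE; apply: le_trans (mx_entry_le _ _ _) _.
apply: le_trans (mx_norm_mulmx _ _) _.
rewrite ler_wpM2r // ler_wpM2l //.
by apply: mx_norm_le => // i j; rewrite mxE mx_entry_le.
Qed.

Lemma continuous_dot l : continuous (dot l).
Proof.
apply: (@lipschitz_continuous _ _ _ _ (n%:R * `|l|)) => x y.
by rewrite !(dotC l) -dotNl -dotDl dotC; exact: dot_le.
Qed.

Lemma exponentialD x y : exponential (x + y) =
  (fun z => exponential x z * exponential y z) :> (borelRn R n -> R[i]).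
Proof. by apply/funext => z; rewrite /exponential dotDl expi2piD. Qed.

Lemma exponentialJ x z : exponential (- x) z = (exponential x z)^*%C.
Proof. by rewrite /exponential dotNl expi2piN. Qed.

Lemma bmfc_exponential l : bmfc (@exponential R n l).
Proof.
split; split.
- rewrite (_ : _ \o _ = cos \o dot ((2 * pi) *: l)); last first.
    by apply/funext => x; rewrite /= dotZl.
  apply: (@continuous_borelRn _ _ (cos \o dot ((2 * pi) *: l))) => x.
  by apply: continuous_comp; [exact: continuous_dot | exact: continuous_cos].
- by exists 1 => x /=; exact: cos_max.
- rewrite (_ : _ \o _ = sin \o dot ((2 * pi) *: l)); last first.
    by apply/funext => x; rewrite /= dotZl.
  apply: (@continuous_borelRn _ _ (sin \o dot ((2 * pi) *: l))) => x.
  by apply: continuous_comp; [exact: continuous_dot | exact: continuous_sin].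
- by exists 1 => x /=; exact: sin_max.
Qed.

Definition ft l : R[i] := cint mu (exponential l).

Lemma ft0 : ft 0 = 1.
Proof.
rewrite /ft (_ : exponential 0 = fun=> 1) ?cint_cst //.
by apply/funext => x; rewrite /exponential dot0l expi2pi0.
Qed.

Lemma ftN l : ft (- l) = (ft l)^*%C.
Proof.
rewrite /ft -cintJ; last exact: bmfc_exponential.
by congr cint; apply/funext => x; exact: exponentialJ.
Qed.

Lemma L2inner_exponential x y :
  L2inner mu (exponential x) (exponential y) = ft (x - y).
Proof.
rewrite /L2inner /ft exponentialD; congr cint.
by apply/funext => z; rewrite exponentialJ.
Qed.

Lemma sqmod_ft_le1 l : sqmod (ft l) <= 1.
Proof.
apply: le_trans (sqmod_cint_le _ (bmfc_exponential l)) _.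
by rewrite (@eq_Rintegral _ _ _ _ _ (fun=> 1)) ?bRintegral_cst // => x _; rewrite sqmod_expi2pi.
Qed.

Lemma measurable_digit_map (M : 'M[R]_n) (d : 'cV[R]_n) :
  measurable_fun setT (digit_map M d).
Proof.
apply: (@continuous_borelRn_map _ _ (digit_map M d)).
apply: (@lipschitz_continuous _ _ _ _ (n%:R * `|invmx M|)) => x y.
by rewrite /digit_map -mulmxBr opprD addrACA subrr addr0 mx_norm_mulmx.
Qed.

(** The measure is the average of its images under the digit maps; written
as a scaled finite sum of measures, it lets the integral distribute. *)
Lemma ge0_integral_self_affine (M : 'M[R]_n) (D : {fset 'cV[R]_n})
    (f : borelRn R n -> \bar R) :
  self_affine_measure M D mu ->
  measurable_fun setT f -> (forall x, (0 <= f x)%E) ->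
  (\int[mu]_x f x =
   (#|` D|%:R^-1)%:E * \sum_(d <- D) \int[mu]_x f (digit_map M d x))%E.
Proof.
move=> h mf f0.
pose N := #|` D|.
have N0 : 0 <= (N%:R^-1 : R) by [].
pose m_of (i : nat) : {measure set (borelRn R n) -> \bar R} :=
  pushforward mu (digit_map M (nth 0 D i)).
pose m_ := m_of (fun i => measurable_digit_map M (nth 0 D i)).
transitivity (\int[mscale (NngNum N0) (msum m_ N)]_x f x)%E.
  apply: eq_measure_integral => A mA _.
  apply: (etrans (h A mA)); rewrite /mscale /= /msum.
  by rewrite (big_nth 0) big_mkord.
rewrite ge0_integral_mscale //= ge0_integral_measure_sum //.
rewrite (big_nth 0) big_mkord; congr (_ * _)%E.
apply: eq_bigr => i _.
by rewrite (ge0_integral_pushforward (measurable_digit_map M (nth 0 D i))) // preimage_setT.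
Qed.

(** A bounded function becomes nonnegative after adding its bound. *)
Lemma Rintegral_self_affine (M : 'M[R]_n) (D : {fset 'cV[R]_n})
    (f : borelRn R n -> R) : D != fset0 ->
  self_affine_measure M D mu -> bmf f ->
  \int[mu]_x f x = #|` D|%:R^-1 * \sum_(d <- D) \int[mu]_x f (digit_map M d x).
Proof.
move=> D0 h [mf [C hC]]; pose g (x : borelRn R n) := f x + C.
have g0 x : 0 <= g x.
  by rewrite /g -lerBlDr sub0r; move: (hC x); rewrite ler_norml => /andP[].
have bg : bmf g by apply: bmfD; [split => //; exists C | exact: bmf_cst].
have bfd d : bmf (fun x : borelRn R n => f (digit_map M d x)).
  split; last by exists C => x; exact: hC.
  by apply: measurableT_comp => //; exact: measurable_digit_map.
have gE (u : borelRn R n -> R) : bmf u ->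
    (\int[mu]_x (u x)%:E = (\int[mu]_x u x)%:E)%E.
  by move=> bu; rewrite fineK //; apply: integrable_fin_num => //; exact: bmf_integrable.
have := ge0_integral_self_affine (f := EFin \o g) h _ _.
rewrite /= gE // => /(_ _ _)/wrap[].
- by apply/measurable_EFinP; case: bg.
- by move=> x; rewrite lee_fin.
rewrite (eq_bigr (fun d => (\int[mu]_x f (digit_map M d x) + C)%:E)); last first.
  move=> d _; rewrite gE; last by apply: bmfD => //; exact: bmf_cst.
  by rewrite bRintegralD ?bRintegral_cst //; exact: bmf_cst.
rewrite sumEFin -EFinM => -[].
rewrite bRintegralD ?bRintegral_cst //; [|by split => //; exists C|exact: bmf_cst].
rewrite big_split /= big_const_seq count_predT iter_addr_0 mulrDr => e.
apply: (addIr C); rewrite e; congr (_ + _).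
rewrite -[C *+ _]mulr_natl mulrA mulVf ?mul1r //.
by rewrite pnatr_eq0 cardfs_eq0.
Qed.

Lemma complex_sum (I : Type) (s : seq I) (a b : I -> R) :
  \sum_(i <- s) (a i +i* b i)%C = ((\sum_(i <- s) a i) +i* (\sum_(i <- s) b i))%C.
Proof.
elim: s => [|i s IH]; first by rewrite !big_nil.
by rewrite !big_cons IH; apply/eqP; rewrite eq_complex /= !eqxx.
Qed.

Lemma cint_self_affine (M : 'M[R]_n) (D : {fset 'cV[R]_n})
    (f : borelRn R n -> R[i]) : D != fset0 ->
  self_affine_measure M D mu -> bmfc f ->
  cint mu f = #|` D|%:R^-1 * \sum_(d <- D) cint mu (fun x => f (digit_map M d x)).
Proof.
move=> D0 h [fr fi].
rewrite /cint (Rintegral_self_affine D0 h fr) (Rintegral_self_affine D0 h fi).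
have -> : (#|` D|%:R^-1 : R[i]) = (#|` D|%:R^-1)%:C%C.
  by rewrite fmorphV /= rmorph_nat.
rewrite complex_sum; apply/eqP; rewrite eq_complex /=.
by rewrite !mul0r subr0 addr0 !eqxx.
Qed.

(** Integrate exp (2 pi i <l, x>) against the self-affine equation and move
the inverse matrix to the other side of the inner product. *)
Lemma ft_self_affine (M : 'M[R]_n) (D : {fset 'cV[R]_n}) l :
  D != fset0 -> self_affine_measure M D mu ->
  let l' := (invmx M)^T *m l in
  ft l = (#|` D|%:R^-1 * \sum_(d <- D) expi2pi (dot d l')) * ft l'.
Proof.
move=> D0 h l'; rewrite /ft (cint_self_affine D0 h (bmfc_exponential l)) -mulrA.
congr (_ * _); rewrite mulr_suml; apply: eq_bigr => d _.
rewrite -cintZ; last exact: bmfc_exponential.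
congr cint; apply/funext => x.
rewrite /exponential /digit_map dot_mulmxr -/l' dotC dotDl dotC expi2piD mulrC.
by rewrite (dotC d).
Qed.

End FourierTransform.

(** * Powers of the inverse of an expansive matrix *)

Section PowerDecay.
Variable R : realType.
Local Notation normc := ComplexField.Normc.normc.

Lemma normc_ge0 (z : R[i]) : 0 <= normc z.
Proof. by case: z => a b; exact: sqrtr_ge0. Qed.

Lemma normc_realE (x : R) : normc x%:C%C = `|x|.
Proof. by rewrite /= expr0n addr0 sqrtr_sqr. Qed.

(** The margin rho - a absorbs the inhomogeneous term into one constant. *)
Lemma perturbed_geometric_decay (s : nat -> R) (a rho C : R) :
  0 <= a < rho -> 0 <= C -> (forall k, s k.+1 <= a * s k + C * rho ^+ k) ->
  exists C' : R, 0 <= C' /\ forall k, s k <= C' * rho ^+ k.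
Proof.
move=> /andP[a0 ar] C0 hs; have rho0 := le_lt_trans a0 ar.
have d0 : 0 < rho - a by rewrite subr_gt0.
exists (`|s 0%N| + C / (rho - a)); split.
  by rewrite addr_ge0 // divr_ge0 // ltW.
elim=> [|k IH]; first by rewrite expr0 mulr1 (le_trans (ler_norm _)) // lerDl divr_ge0 // ltW.
apply: le_trans (hs k) _; set K := `|s 0%N| + _ in IH *.
rewrite (@le_trans _ _ (a * (K * rho ^+ k) + C * rho ^+ k)) //.
  by rewrite lerD2r ler_wpM2l.
rewrite mulrA -mulrDl exprS mulrA ler_wpM2r ?exprn_ge0 ?(ltW rho0) //.
rewrite -lerBrDl mulrC -mulrBl -ler_pdivrMl // mulrC /K.
by rewrite lerDr.
Qed.

Definition cnorm n (v : 'cV[R[i]]_n) : R := \sum_i normc (v i ord0).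

Lemma cnorm0 n : cnorm (0 : 'cV_n) = 0.
Proof. by rewrite /cnorm big1 // => i _; rewrite mxE ComplexField.Normc.normc0. Qed.

Lemma cnormD n (u v : 'cV_n) : cnorm (u + v) <= cnorm u + cnorm v.
Proof.
by rewrite /cnorm -big_split ler_sum // => i _; rewrite mxE le_normcD.
Qed.

Lemma cnormZ n (a : R[i]) (v : 'cV_n) : cnorm (a *: v) = normc a * cnorm v.
Proof.
rewrite /cnorm mulr_sumr; apply: eq_bigr => i _.
by rewrite mxE ComplexField.Normc.normcM.
Qed.

(** Induction on the roots: u = (N - a) v is annihilated by the remaining
factors, and N^(k+1) v = a N^k v + N^k u turns decay for u into decay for v.
This replaces the Jordan normal form. *)
Lemma iterates_decay n (N : 'M[R[i]]_n.+1) (rho : R) (s : seq R[i]) :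
  0 < rho -> (forall a, a \in s -> normc a < rho) ->
  forall v : 'cV_n.+1, horner_mx N (\prod_(a <- s) ('X - a%:P)) *m v = 0 ->
  exists C : R, 0 <= C /\ forall k, cnorm (N ^+ k *m v) <= C * rho ^+ k.
Proof.
move=> rho0; elim: s => [|a s IH] hs v.
  rewrite big_nil rmorph1 mul1mx => ->; exists 0; split=> // k.
  by rewrite mulmx0 cnorm0 mul0r.
rewrite big_cons mulrC rmorphM /= -mulmxE -mulmxA rmorphB /= horner_mx_X horner_mx_C.
set u := (N - _) *m v => hu.
have [|C [C0 hC]] := IH _ u hu.
  by move=> b bs; apply: hs; rewrite inE bs orbT.
apply: (@perturbed_geometric_decay _ (normc a) rho C) => // [|k].
  by rewrite normc_ge0 hs // mem_head.
have -> : N ^+ k.+1 *m v = a *: (N ^+ k *m v) + N ^+ k *m u.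
  rewrite /u mulmxBl mulmxBr mul_scalar_mx -scalemxAr addrC subrK.
  by rewrite exprSr -mulmxE mulmxA.
by apply: le_trans (cnormD _ _) _; rewrite cnormZ lerD2l.
Qed.

(** Cayley-Hamilton, with the characteristic polynomial split over the complex
numbers, puts every basis vector under the preceding lemma. *)
Lemma matrix_powers_decay n (N : 'M[R]_n.+1) :
  (forall a : R[i], eigenvalue (map_mx (real_complex R) N) a -> normc a < 1) ->
  exists (C rho : R), [/\ 0 <= C, 0 < rho < 1 & forall k, `|N ^+ k| <= C * rho ^+ k].
Proof.
move=> hN; set NC := map_mx _ N in hN.
have [s hs] := closed_field_poly_normal (char_poly NC).
rewrite (monicP (char_poly_monic NC)) scale1r in hs.
have s1 a : a \in s -> normc a < 1.
  move=> as_; apply: hN; rewrite eigenvalue_root_char hs.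
  by rewrite root_prod_XsubC.
have [rho /andP[rho0 rho1] hrho] : exists2 rho : R, 0 < rho < 1 &
    forall a, a \in s -> normc a < rho.
  elim: s s1 {hs} => [|a s IH] s1.
    by exists 2^-1 => //; rewrite invr_gt0 invf_lt1 ?ltr1n ltr0n.
  have [b bs|rho /andP[r0 r1] hr] := IH.
    by apply: s1; rewrite inE bs orbT.
  have a1 := s1 a (mem_head _ _).
  exists (Num.max rho ((normc a + 1) / 2)).
    by rewrite lt_max r0 /= gt_max r1 /=; lra.
  move=> b; rewrite inE lt_max => /orP[/eqP->|/hr->//].
  by apply/orP; right; lra.
have hv (v : 'cV_n.+1) : exists C : R, 0 <= C /\
    forall k, cnorm (NC ^+ k *m v) <= C * rho ^+ k.
  apply: (iterates_decay rho0 hrho).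
  by rewrite -hs (Cayley_Hamilton NC) mul0mx.
have [C hC] := boolp.choice (fun j => hv (delta_mx j ord0)).
exists (\sum_j C j), rho; split; rewrite ?rho0 //.
  by apply: sumr_ge0 => j _; case: (hC j).
move=> k; apply: mx_norm_le => [|i j].
  by rewrite mulr_ge0 ?exprn_ge0 ?(ltW rho0) // sumr_ge0 // => j _; case: (hC j).
have [Cj0 /(_ k) h] := hC j.
apply: (@le_trans _ _ (C j * rho ^+ k)); last first.
  rewrite ler_wpM2r ?exprn_ge0 ?(ltW rho0) // (bigD1 j) //= lerDl.
  by apply: sumr_ge0 => j' _; case: (hC j').
apply: le_trans h; rewrite /cnorm (bigD1 i) //=.
have -> : (NC ^+ k *m (delta_mx j ord0 : 'cV_n.+1)) i ord0 = ((N ^+ k) i j)%:C%C.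
  by rewrite -colE mxE -rmorphXn /= mxE.
by rewrite normc_realE lerDl sumr_ge0 // => i' _; exact: normc_ge0.
Qed.

Lemma expansive_unitmx n (M : 'M[R]_n) : expansive M -> M \in unitmx.
Proof.
move=> hM; rewrite -(map_unitmx (real_complex R)).
apply: contraT => nu; have /hM : eigenvalue (map_mx (real_complex R) M) 0.
  rewrite /eigenvalue /eigenspace raddf0 subr0 kermx_eq0 row_free_unit.
  exact: nu.
by rewrite normr0 ltr10.
Qed.

(** An eigenvalue a of the inverse gives the eigenvalue a^-1 of the matrix. *)
Lemma expansive_inv_powers n (M : 'M[R]_n.+1) : expansive M ->
  exists (C rho : R),
    [/\ 0 <= C, 0 < rho < 1 & forall k, `|invmx M ^+ k| <= C * rho ^+ k].
Proof.
move=> hM; have uM := expansive_unitmx hM.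
apply: matrix_powers_decay => a; rewrite map_invmx => /eigenvalueP[v va v0].
set MC := map_mx _ M in va.
have uMC : MC \in unitmx by rewrite map_unitmx.
have va' : v = a *: (v *m MC).
  by rewrite scalemxAl -va mulmxKV.
have a0 : a != 0.
  by apply: contraNneq v0 => a0; rewrite va' a0 scale0r.
have /hM : eigenvalue MC a^-1.
  by apply/eigenvalueP; exists v => //; rewrite {2}va' scalerA mulVf // scale1r.
rewrite normc_def -(rmorph1 (real_complex R)) ltcR => h.
have : 1 < normc a^-1 by case: (a^-1) h.
rewrite ComplexField.Normc.normcV // invf_gt1 // lt_neqAle eq_sym normc_ge0 andbT.
by apply: contraNneq a0 => /ComplexField.Normc.eq0_normc ->.
Qed.

End PowerDecay.

(** * Compact support and Lipschitz bound *)

Lemma measurable_norm_ball (R : realType) n (r : R) :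
  measurable ([set x | `|x| <= r] : set (borelRn R n)).
Proof.
have := continuous_borelRn (@norm_continuous _ 'cV[R]_n) measurableT
  (measurable_itv `]-oo, r]).
by rewrite setTI.
Qed.

Section CompactSupport.
Variables (R : realType) (n : nat) (mu : probability (borelRn R n.+1) R).
Variables (M : 'M[R]_n.+1) (D : {fset 'cV[R]_n.+1}).
Hypotheses (D0 : D != fset0) (hmu : self_affine_measure M D mu).
Variables (C rho : R).
Hypotheses (C0 : 0 <= C) (rho01 : 0 < rho < 1).
Hypothesis (decay : forall k, `|invmx M ^+ k| <= C * rho ^+ k).

Let rho0 : 0 < rho. Proof. by case/andP: rho01. Qed.
Let rho1 : rho < 1. Proof. by case/andP: rho01. Qed.

(** Each of the image measures in the average gives A at least the mass of B. *)
Lemma self_affine_le (A B : set (borelRn R n.+1)) :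
  measurable A -> measurable B ->
  (forall d, d \in D -> B `<=` digit_map M d @^-1` A) -> (mu B <= mu A)%E.
Proof.
move=> mA mB BA; rewrite [leRHS](hmu mA).
have fB : mu B = (fine (mu B))%:E by rewrite fineK // fin_num_measure.
apply: (@le_trans _ _ ((#|` D|%:R^-1)%:E * \sum_(d <- D) mu B)%E); last first.
  apply: lee_wpmul2l; first by rewrite lee_fin.
  rewrite big_seq [leRHS]big_seq; apply: lee_sum => d dD.
  apply: le_measure; rewrite ?inE //; last exact: BA.
  by rewrite -[_ @^-1` _]setTI; exact: measurable_digit_map.
rewrite fB sumEFin -EFinM lee_fin big_const_seq count_predT iter_addr_0.
rewrite -[fine _ *+ _]mulr_natl mulrA mulVf ?mul1r //.
by rewrite pnatr_eq0 cardfs_eq0.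
Qed.

(** Balls for a norm adapted to the contraction: unlike the ambient norm, they
are mapped by the inverse matrix into a ball that is smaller by the factor
rho. *)
Definition geometric_ball (r : R) : set (borelRn R n.+1) :=
  [set x | forall k, `|invmx M ^+ k *m x| <= r * rho ^+ k].

Lemma measurable_geometric_ball r : measurable (geometric_ball r).
Proof.
have -> : geometric_ball r =
    \bigcap_k [set x : borelRn R n.+1 | `|invmx M ^+ k *m x| <= r * rho ^+ k].
  by apply/seteqP; split => x; [move=> h k _; exact: h | move=> h k; exact: h].
apply: bigcapT_measurable => k.
have cf : continuous (fun x : 'cV[R]_n.+1 => `|invmx M ^+ k *m x|).
  apply: (@lipschitz_continuous _ _ R^o _ (n.+1%:R * `|invmx M ^+ k|)) => x y.
  by rewrite (le_trans (ler_dist_dist _ _)) // -mulmxBr mx_norm_mulmx.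
have := continuous_borelRn cf measurableT (measurable_itv `]-oo, r * rho ^+ k]).
by rewrite setTI.
Qed.

Lemma geometric_ball_le r s : r <= s -> geometric_ball r `<=` geometric_ball s.
Proof.
move=> rs x h k; rewrite (le_trans (h k)) // ler_wpM2r // exprn_ge0 // ltW //.
Qed.

Lemma mem_geometric_ball x : geometric_ball (n.+1%:R * C * `|x|) x.
Proof.
move=> k; apply: le_trans (mx_norm_mulmx _ _) _.
have -> : n.+1%:R * C * `|x| * rho ^+ k = n.+1%:R * (C * rho ^+ k) * `|x| by ring.
by rewrite ler_wpM2r // ler_wpM2l.
Qed.

Lemma digit_map_geometric_ball r s d : geometric_ball s d ->
  geometric_ball r `<=` digit_map M d @^-1` geometric_ball (rho * (r + s)).
Proof.
move=> ds x rx k; rewrite /digit_map mulmxA mulmxE -exprSr mulmxDr.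
apply: le_trans (ler_normD _ _) _.
have -> : rho * (r + s) * rho ^+ k = r * rho ^+ k.+1 + s * rho ^+ k.+1.
  by rewrite exprS; ring.
by rewrite lerD.
Qed.

(** The map r |-> rho (r + s) moves every radius towards the fixed point K, and
the mass of a ball does not decrease along it. Hence the ball of radius K + 1
already carries the mass of arbitrarily large balls. *)
Lemma self_affine_bounded_support :
  exists2 K : R, 0 <= K & mu (~` [set x | `|x| <= K]) = 0%E.
Proof.
pose s := n.+1%:R * C * \sum_(d <- D) `|d|.
have s0 : 0 <= s by rewrite !mulr_ge0 // sumr_ge0.
have ds d : d \in D -> geometric_ball s d.
  move=> dD; apply: geometric_ball_le (@mem_geometric_ball d).
  rewrite ler_wpM2l ?mulr_ge0 // (big_fsetD1 d) //= lerDl.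
  by rewrite sumr_ge0.
have step r : (mu (geometric_ball r) <= mu (geometric_ball (rho * (r + s))))%E.
  apply: self_affine_le; try exact: measurable_geometric_ball.
  by move=> d dD; apply: digit_map_geometric_ball; exact: ds.
have d0 : 0 < 1 - rho by rewrite subr_gt0.
(* the fixed point of r |-> rho (r + s) *)
pose K := rho * s / (1 - rho).
have K0 : 0 <= K by rewrite divr_ge0 ?(ltW d0) // mulr_ge0 // ltW.
have iter r j : 0 <= r ->
    (mu (geometric_ball r) <= mu (geometric_ball (rho ^+ j * r + K)))%E.
  move=> r0; elim: j => [|j IH].
    rewrite expr0 mul1r; apply: le_measure; rewrite ?inE //;
      try exact: measurable_geometric_ball.
    by apply: geometric_ball_le; rewrite lerDl.
  apply: le_trans IH _; apply: le_trans (step _) _.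
  rewrite (_ : rho * _ = rho ^+ j.+1 * r + K) // exprS /K.
  by field; rewrite gt_eqF.
have big r : 0 <= r -> (mu (geometric_ball r) <= mu (geometric_ball (K + 1)))%E.
  move=> r0; have [j hj] : exists j, rho ^+ j * r <= 1.
    have := @cvg_expr R rho; rewrite gtr0_norm // => /(_ rho1).
    move/cvgrPdist_le => /(_ (r + 1)^-1); rewrite invr_gt0 ltr_wpDl //.
    move=> /(_ isT) [j _ /(_ j (leqnn j))] /=.
    rewrite sub0r normrN ger0_norm ?exprn_ge0 ?(ltW rho0) // => hj.
    exists j; rewrite (le_trans (ler_wpM2r r0 hj)) //.
    by rewrite ler_pdivrMl ?ltr_wpDl // mulr1 lerDl.
  apply: le_trans (iter r j r0) _; apply: le_measure; rewrite ?inE //;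
    try exact: measurable_geometric_ball.
  by apply: geometric_ball_le; rewrite addrC lerD2l.
pose T m := geometric_ball m%:R.
have mT m : measurable (T m) by exact: measurable_geometric_ball.
have cT : \bigcup_m T m = setT.
  apply/seteqP; split => // x _.
  have [m hm] : exists m, n.+1%:R * C * `|x| <= m%:R.
    exists (Num.bound (n.+1%:R * C * `|x|)).
    by rewrite ltW // archi_boundP // !mulr_ge0.
  by exists m => //; apply: geometric_ball_le hm _ (@mem_geometric_ball x).
have ndT : nondecreasing_seq T.
  by move=> a b ab; apply/subsetPset; apply: geometric_ball_le; rewrite ler_nat.
have mU : measurable (\bigcup_m T m) by rewrite cT.
have cv := nondecreasing_cvg_mu (mu := mu) mT mU ndT.
have ge1 : (1 <= mu (geometric_ball (K + 1)))%E.
  have -> : 1%E = limn (mu \o T).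
    by rewrite (cvg_lim _ cv) // cT; exact: esym (probability_setT mu).
  apply: lime_le; first by apply/cvg_ex; eexists; exact: cv.
  by apply: nearW => m; exact: big.
exists (K + 1); first by rewrite addr_ge0.
have m1 := measurable_geometric_ball (K + 1).
have e1 : mu (geometric_ball (K + 1)) = 1%E.
  by apply/eqP; rewrite eq_le ge1 andbT probability_le1.
apply: (@subset_measure0 _ _ _ mu _ (~` geometric_ball (K + 1))).
- by apply: measurableC; exact: measurable_norm_ball.
- exact: measurableC.
- move=> x /= hx h; apply: hx; have := h 0%N.
  by rewrite expr0 mul1mx expr0 mulr1.
- apply: (etrans (probability_setC mu m1)).
  by rewrite [X in (_ - X)%E]e1 subee.
Qed.

End CompactSupport.

Section Lipschitz.
Variables (R : realType) (n : nat) (mu : probability (borelRn R n) R).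
Variable K : R.
Hypotheses (K0 : 0 <= K) (supp : mu (~` [set x | `|x| <= K]) = 0%E).
Local Notation normc := ComplexField.Normc.normc.

Lemma compact_norm_ball : compact [set x : 'cV[R]_n | `|x| <= K].
Proof.
have -> : [set x : 'cV[R]_n | `|x| <= K] =
    (fun y : 'rV[R]_n => y^T) @` [set y : 'rV[R]_n | `|y| <= K].
  have nT m p (A : 'M[R]_(m, p)) : `|A^T| <= `|A|.
    by apply: mx_norm_le => // i j; rewrite mxE mx_entry_le.
  apply/seteqP; split => x /=.
    by move=> h; exists x^T; rewrite ?trmxK // (le_trans (nT _ _ _)).
  by move=> [y hy <-]; rewrite (le_trans (nT _ _ _)).
apply: continuous_compact.
  apply: continuous_subspaceT; apply: (@lipschitz_continuous _ _ _ _ 1) => x y.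
  rewrite mul1r; apply: mx_norm_le => // i j.
  have -> : (x^T - y^T) i j = (x - y) j i by rewrite !mxE.
  exact: mx_entry_le.
apply: bounded_closed_compact.
  by exists K; split => [|M KM y /= hy]; [exact: num_real | rewrite (le_trans hy) // ltW].
rewrite (_ : mkset _ = Num.norm @^-1` [set r : R | r <= K]) //.
by apply: closed_comp; [move=> y _; exact: norm_continuous | exact: closed_le].
Qed.

Lemma bounded_compactly_supported : compactly_supported mu.
Proof. by exists [set x : 'cV[R]_n | `|x| <= K]; [exact: compact_norm_ball | exact: supp]. Qed.

Lemma bRintegral_le_supp (f : borelRn R n -> R) (c : R) : bmf f ->
  (forall x, 0 <= f x) -> (forall x, `|x| <= K -> f x <= c) ->
  \int[mu]_x f x <= c.
Proof.
move=> bf f0 fc.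
have [c0|c0] := leP 0 c; last first.
  have := measurable_norm_ball (n := n) K => mK.
  have : mu (~` [set x | `|x| <= K]) = 1%E.
    rewrite (_ : ~` _ = setT); first exact: probability_setT.
    apply/seteqP; split => // x _ /= /fc; apply/negP.
    by rewrite -ltNge (lt_le_trans c0).
  by rewrite supp => /eqP; rewrite eq_sym onee_eq0.
rewrite -[leRHS](bRintegral_cst mu) -lee_fin.
have gE (u : borelRn R n -> R) : bmf u ->
    ((\int[mu]_x u x)%:E = \int[mu]_x (u x)%:E)%E.
  by move=> bu; rewrite fineK //; apply: integrable_fin_num => //; exact: bmf_integrable.
rewrite !gE //; last exact: bmf_cst.
apply: ae_ge0_le_integral => //.
- by move=> x _; rewrite lee_fin.
- by apply/measurable_EFinP; case: bf.
- exists (~` [set x | `|x| <= K]); split => //.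
    by apply: measurableC; exact: measurable_norm_ball.
  by move=> x /= h hx; apply: h => _; rewrite lee_fin; exact: fc.
Qed.

Lemma sin_le_norm (t : R) : `|sin t| <= `|t|.
Proof.
have sin_le (u : R) : 0 <= u -> `|sin u| <= u.
  move=> u0.
  have dsin x : x \in `]0, u[%R -> is_derive x 1 sin (cos x).
    by move=> _; exact: is_derive_sin.
  have csin : {within `[0, u], continuous sin}.
    by apply: continuous_subspaceT => x; exact: continuous_sin.
  have [c _] := MVT_segment u0 dsin csin.
  rewrite sin0 !subr0 => ->; rewrite normrM (ger0_norm u0).
  by rewrite ler_piMl // cos_max.
have [t0|t0] := leP 0 t; first by rewrite (ger0_norm t0) sin_le.
by rewrite (ltr0_norm t0) -normrN -sinN sin_le // oppr_ge0 ltW.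
Qed.

Lemma sqmod_expi2pi_sub1 (t : R) : sqmod (expi2pi t - 1) <= (2 * pi * t) ^+ 2.
Proof.
have -> : sqmod (expi2pi t - 1) = 4 * sin (pi * t) ^+ 2.
  rewrite /sqmod /expi2pi (_ : 2 * pi * t = (pi * t) *+ 2); last first.
    by rewrite -mulrA mulr_natl.
  move: (pi * t) => a /=; rewrite oppr0 addr0 cos_mulr2n sin_mulr2n.
  have := cos2Dsin2 a; move: (cos a) (sin a) => c s h.
  rewrite -[(c * s *+ 2)]mulr_natl -[(c ^+ 2 *+ 2)]mulr_natl !exprMn.
  have -> : c ^+ 2 = 1 - s ^+ 2 by rewrite -h addrK.
  by ring.
have -> : (2 * pi * t) ^+ 2 = 4 * (pi * t) ^+ 2 by ring.
rewrite ler_wpM2l // -(real_normK (num_real (sin _))) -(real_normK (num_real (pi * t))).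
by rewrite lerXn2r ?nnegrE // sin_le_norm.
Qed.

(** On the support, |e(<x, z>) - e(<y, z>)| is at most 2 pi |<x - y, z>|. *)
Lemma ft_lipschitz : exists2 C : R, 0 <= C &
  forall x y, normc (ft mu x - ft mu y) <= C * `|x - y|.
Proof.
pose C := 2 * pi * (n%:R * K).
have C0 : 0 <= C by rewrite !mulr_ge0 // pi_ge0.
exists C => // x y.
have h : sqmod (ft mu x - ft mu y) <= (C * `|x - y|) ^+ 2.
  pose u z := exponential x z + (-1) * exponential y z.
  have b1 := bmfc_exponential x; have b2 := bmfc_exponential y.
  have b3 : bmfc (fun z : borelRn R n => -1 * exponential y z).
    by apply: bmfcM => //; exact: bmfc_cst.
  have bu : bmfc u by exact: bmfcD.
  have -> : ft mu x - ft mu y = cint mu u.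
    by rewrite /u cintD // cintZ // mulN1r.
  apply: le_trans (sqmod_cint_le mu bu) _.
  apply: bRintegral_le_supp; first exact: bmf_sqmod.
    by move=> z; exact: sqmod_ge0.
  move=> z zK.
  have -> : u z = exponential y z * (expi2pi (dot (x - y) z) - 1).
    rewrite mulrBr mulr1 /u mulN1r; congr (_ - _).
    by rewrite /exponential -expi2piD -dotDl addrC subrK.
  rewrite sqmodM sqmod_expi2pi mul1r.
  apply: le_trans (sqmod_expi2pi_sub1 _) _.
  rewrite -(real_normK (num_real (2 * _ * _))) lerXn2r ?nnegrE //.
    by rewrite mulr_ge0.
  rewrite normrM (ger0_norm (mulr_ge0 _ (pi_ge0 R))) // /C -!mulrA.
  do 2 (rewrite ler_wpM2l ?pi_ge0 //).
  apply: le_trans (dot_le _ _) _.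
  by rewrite -mulrA ler_wpM2l // mulrC ler_wpM2r.
rewrite -(@ler_pXn2r _ 2) // ?nnegrE ?normc_ge0 ?mulr_ge0 ?pi_ge0 //.
by rewrite -sqmod_normc.
Qed.

End Lipschitz.

(** * Mean-square estimates *)

Section MeanSquare.
Context d (T : measurableType d) (R : realType).
Variable mu : probability T R.
Local Notation Re := (@complex.Re R).
Local Notation Im := (@complex.Im R).
Implicit Types (f g : T -> R[i]).

Definition cmeas f := measurable_fun setT (Re \o f) /\ measurable_fun setT (Im \o f).

Definition msq f : \bar R := (\int[mu]_x (sqmod (f x))%:E)%E.

Lemma bmfc_cmeas f : bmfc f -> cmeas f.
Proof. by move=> [[? _] [? _]]. Qed.

Lemma cmeasD f g : cmeas f -> cmeas g -> cmeas (fun x => f x + g x).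
Proof.
move=> [fr fi] [gr gi]; split.
- rewrite (_ : _ \o _ = (Re \o f) \+ (Re \o g)); first exact: measurable_funD.
  by apply/funext => x /=; case: (f x) (g x) => ? ? [].
- rewrite (_ : _ \o _ = (Im \o f) \+ (Im \o g)); first exact: measurable_funD.
  by apply/funext => x /=; case: (f x) (g x) => ? ? [].
Qed.

Lemma cmeasM f g : cmeas f -> cmeas g -> cmeas (fun x => f x * g x).
Proof.
move=> [fr fi] [gr gi]; split.
- rewrite (_ : _ \o _ = fun x => (Re \o f) x * (Re \o g) x - (Im \o f) x * (Im \o g) x).
    by apply: measurable_funB; apply: measurable_funM.
  by apply/funext => x /=; case: (f x) (g x) => ? ? [].
- rewrite (_ : _ \o _ = fun x => (Re \o f) x * (Im \o g) x + (Im \o f) x * (Re \o g) x).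
    by apply: measurable_funD; apply: measurable_funM.
  by apply/funext => x /=; case: (f x) (g x) => ? ? [].
Qed.

Lemma cmeas_cst (c : R[i]) : cmeas (fun=> c).
Proof. by split; exact: measurable_cst. Qed.

Lemma cmeasN f : cmeas f -> cmeas (fun x => - f x).
Proof.
move=> mf; have := cmeasM (cmeas_cst (-1)) mf.
by under eq_fun do rewrite mulN1r.
Qed.

Lemma cmeas_real (f : T -> R) : measurable_fun setT f -> cmeas (fun x => (f x)%:C%C).
Proof. by move=> mf; split => //; exact: measurable_cst. Qed.

Lemma measurable_sqmod f : cmeas f -> measurable_fun setT (fun x => sqmod (f x)).
Proof. by move=> [fr fi]; apply: measurable_funD; apply: measurable_funX. Qed.

Lemma sqmodD_le (z w : R[i]) : sqmod (z + w) <= 2 * sqmod z + 2 * sqmod w.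
Proof.
case: z w => a b [c e]; rewrite /sqmod /= -subr_ge0.
have -> : 2 * (a ^+ 2 + b ^+ 2) + 2 * (c ^+ 2 + e ^+ 2) - ((a + c) ^+ 2 + (b + e) ^+ 2)
   = (a - c) ^+ 2 + (b - e) ^+ 2 by ring.
by rewrite addr_ge0 // sqr_ge0.
Qed.

Lemma msqD_le f g : cmeas f -> cmeas g ->
  (msq (fun x => (f x + g x)%R) <= 2%:E * msq f + 2%:E * msq g)%E.
Proof.
move=> mf mg; have mf2 := measurable_sqmod mf; have mg2 := measurable_sqmod mg.
rewrite /msq -!ge0_integralZl //; try (by apply/measurable_EFinP);
  try (by move=> x _; rewrite lee_fin sqmod_ge0); try by rewrite lee_fin.
rewrite -ge0_integralD //; try by move=> x _; rewrite -EFinM lee_fin mulr_ge0 // sqmod_ge0.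
- apply: ge0_le_integral => //.
  + by move=> x _; rewrite lee_fin sqmod_ge0.
  + by apply/measurable_EFinP; apply: measurable_sqmod; exact: cmeasD.
  + by apply: emeasurable_funD; apply: measurable_funeM; apply/measurable_EFinP.
  + by move=> x _; rewrite -!EFinM -EFinD lee_fin sqmodD_le.
- by apply: measurable_funeM; apply/measurable_EFinP.
- by apply: measurable_funeM; apply/measurable_EFinP.
Qed.

Lemma msqM_le f g (C : R) : cmeas f -> cmeas g -> 0 <= C ->
  (forall x, sqmod (f x) <= C) -> (msq (fun x => (f x * g x)%R) <= C%:E * msq g)%E.
Proof.
move=> mf mg C0 hC; have mg2 := measurable_sqmod mg.
rewrite /msq -ge0_integralZl //; try (by apply/measurable_EFinP);
  try (by move=> x _; rewrite lee_fin sqmod_ge0); try by rewrite lee_fin.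
apply: ge0_le_integral => //.
- by move=> x _; rewrite lee_fin sqmod_ge0.
- by apply/measurable_EFinP; apply: measurable_sqmod; exact: cmeasM.
- by apply: measurable_funeM; apply/measurable_EFinP.
- by move=> x _; rewrite -EFinM lee_fin sqmodM ler_wpM2r // sqmod_ge0.
Qed.

(** Dominated convergence applied to the squared differences. *)
Lemma msq_dominated_cvg (f_ : nat -> T -> R) (f : T -> R) (g : T -> R) :
  (forall n, measurable_fun setT (f_ n)) -> measurable_fun setT f ->
  mu.-integrable setT (EFin \o g) ->
  (forall n x, (f x - f_ n x) ^+ 2 <= g x) ->
  (forall x, f_ n x @[n --> \oo] --> f x) ->
  forall eps : R, 0 < eps -> exists n,
    (msq (fun x => ((f x)%:C%C - (f_ n x)%:C%C)%R) < eps%:E)%E.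
Proof.
move=> mf_ mf ig dom cv eps e0.
have m0 n : measurable_fun setT (fun x => ((f x - f_ n x) ^+ 2)%:E).
  by apply/measurable_EFinP; apply: measurable_funX; exact: measurable_funB.
have c0 : {ae mu, forall x, setT x ->
    ((f x - f_ n x) ^+ 2)%:E @[n --> \oo] --> (cst 0 x : \bar R)}.
  apply: aeW => x _; apply: cvg_EFin; first by apply: nearW.
  have z : (f x - f_ n x) @[n --> \oo] --> (0 : R).
    by rewrite -(subrr (f x)); apply: cvgB => //; exact: cvg_cst.
  rewrite (_ : fine \o _ = (fun n => f x - f_ n x) \* (fun n => f x - f_ n x)).
    by rewrite -(mulr0 (0 : R)); exact: cvgM.
  by apply/funext => n /=; rewrite expr2.
have d0 : {ae mu, forall x n, setT x -> (`|((f x - f_ n x) ^+ 2)%:E| <= (EFin \o g) x)%E}.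
  by apply: aeW => x n _; rewrite gee0_abs lee_fin // sqr_ge0.
have mc : measurable_fun setT (cst 0%E : T -> \bar R) by exact: measurable_cst.
have [_ _] := @dominated_convergence _ T R mu setT measurableT
  (fun n x => ((f x - f_ n x) ^+ 2)%:E) (cst 0%E) (EFin \o g) m0 mc c0 ig d0.
rewrite integral0 => /fine_cvgP[fn /cvgrPdist_lt /(_ eps e0)] h.
have [n _ /(_ n (leqnn n)) /= [fin hn]] := filterI fn h.
exists n; rewrite /msq.
under eq_integral => x _.
  rewrite (_ : sqmod _ = (f x - f_ n x) ^+ 2); last first.
    by rewrite /sqmod /= subr0 expr0n addr0.
  over.
rewrite -(fineK fin) lte_fin; move: hn; rewrite sub0r normrN; apply: le_lt_trans.
exact: ler_norm.
Qed.

End MeanSquare.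

(** * Density of exponentials in L^2 *)

Section SignIteration.
Variable R : realType.
Implicit Types s t : R.

(** The iterates of this odd polynomial map of [-1, 1] converge to the sign; the
fixed points are -1, 0 and 1, and it stands in for a polynomial approximation
theorem. *)
Definition sgn_step s : R := (3 * s - s ^+ 3) / 2.

Lemma sgn_stepN s : sgn_step (- s) = - sgn_step s.
Proof. by rewrite /sgn_step; field. Qed.

Lemma sgn_step_bound s : `|s| <= 1 -> `|sgn_step s| <= 1.
Proof.
rewrite !ler_norml => /andP[s1 s2]; rewrite -subr_ge0 -[X in _ && X]subr_ge0.
have -> : sgn_step s - -1 = (1 + s) ^+ 2 * (2 - s) / 2 by rewrite /sgn_step; field.
have -> : 1 - sgn_step s = (1 - s) ^+ 2 * (2 + s) / 2 by rewrite /sgn_step; field.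
by rewrite !divr_ge0 // mulr_ge0 ?sqr_ge0 //; lra.
Qed.

Lemma iter_sgn_step_bound s k : `|s| <= 1 -> `|iter k sgn_step s| <= 1.
Proof. by move=> hs; elim: k => [|k IH] //=; exact: sgn_step_bound. Qed.

Lemma iter_sgn_stepN s k : iter k sgn_step (- s) = - iter k sgn_step s.
Proof. by elim: k => [|k IH] //=; rewrite IH sgn_stepN. Qed.

(** Along a positive orbit the values increase, so at each step the distance
to 1 shrinks at least by the factor 1 - s / 2. *)
Lemma iter_sgn_step_gt0 s k : 0 < s <= 1 ->
  s <= iter k sgn_step s /\ 0 <= 1 - iter k sgn_step s <= (1 - s / 2) ^+ k.
Proof.
move=> /andP[s0 s1]; elim: k => [|k [IH1 /andP[IH2 IH3]]] /=.
  by rewrite expr0; split => //; apply/andP; split; lra.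
set t := iter k _ _ in IH1 IH2 IH3 *.
have t0 : 0 < t by exact: lt_le_trans IH1.
have t1 : t <= 1 by rewrite -subr_ge0.
split.
  apply: le_trans IH1 _; rewrite -subr_ge0.
  have -> : sgn_step t - t = t * (1 - t) * (1 + t) / 2 by rewrite /sgn_step; field.
  by rewrite divr_ge0 // mulr_ge0 ?mulr_ge0 //; lra.
have e : 1 - sgn_step t = (1 - t) * ((1 - t) * (2 + t) / 2).
  by rewrite /sgn_step; field.
have h0 : 0 <= (1 - t) * (2 + t) / 2 by rewrite divr_ge0 // mulr_ge0 //; lra.
rewrite e mulr_ge0 //= exprSr ler_pM //.
by rewrite -subr_ge0; nra.
Qed.

Lemma cvg_iter_sgn_step s : `|s| <= 1 ->
  iter k sgn_step s @[k --> \oo] --> Num.sg s.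
Proof.
have pos (u : R) : 0 < u <= 1 -> iter k sgn_step u @[k --> \oo] --> (1 : R).
  move=> /[dup] hu /andP[u0 u1]; apply/cvgrPdist_le => e e0.
  have q0 : 0 <= 1 - u / 2 by lra.
  have q1 : `|1 - u / 2| < 1 by rewrite ger0_norm //; lra.
  have /cvgrPdist_le/(_ e e0) := cvg_expr q1; apply: filterS => k /=.
  rewrite sub0r normrN (ger0_norm (exprn_ge0 _ q0)) => hk.
  have [_ /andP[a0 a1]] := iter_sgn_step_gt0 k hu.
  by rewrite ger0_norm // (le_trans a1).
have [s0|s0|->] := ltrgt0P s.
- by move=> s1; rewrite gtr0_sg //; apply: pos; rewrite s0.
- move=> s1; rewrite ltr0_sg // -(opprK s).
  under eq_fun do rewrite iter_sgn_stepN.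
  by apply: cvgN; apply: pos; rewrite oppr_gt0 s0.
- move=> _; rewrite sgr0; apply: cvg_near_cst; apply: nearW => k.
  by elim: k => [|k] //= ->; rewrite /sgn_step mulr0 expr0n subr0 mul0r.
Qed.

End SignIteration.

Section Density.
Variables (R : realType) (n : nat) (mu : probability (borelRn R n) R).
Variable L : set 'cV[R]_n.
Local Notation T := (borelRn R n).
Implicit Types (f g : T -> R[i]).

Definition trig_poly (s : seq (R[i] * 'cV[R]_n)) : T -> R[i] :=
  fun x => \sum_(p <- s) p.1 * exponential p.2 x.

Definition in_L2_closure f : Prop := forall eps : R, 0 < eps ->
  exists s, (forall p, p \in s -> L p.2) /\
    (msq mu (fun x => (f x - trig_poly s x)%R) < eps%:E)%E.
Local Notation V := in_L2_closure.

Lemma bmfc_trig_poly s : bmfc (trig_poly s).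
Proof.
apply: bmfc_sum => p; apply: bmfcM; first exact: bmfc_cst.
exact: bmfc_exponential.
Qed.

Lemma cmeas_trig_poly s : cmeas (trig_poly s).
Proof. exact/bmfc_cmeas/bmfc_trig_poly. Qed.

Lemma cmeasB_trig f s : cmeas f -> cmeas (fun x => f x - trig_poly s x).
Proof. by move=> mf; apply: cmeasD => //; apply: cmeasN; exact: cmeas_trig_poly. Qed.

Lemma in_L2_closure_limit f : cmeas f ->
  (forall eps : R, 0 < eps -> exists g, [/\ cmeas g, V g &
     (msq mu (fun x => (f x - g x)%R) < eps%:E)%E]) -> V f.
Proof.
move=> mf h eps e0; have e4 : 0 < eps / 4 by rewrite divr_gt0.
have [g [mg Vg fg]] := h _ e4; have [s [sL gs]] := Vg _ e4.
exists s; split => //.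
have -> : (fun x => f x - trig_poly s x) =
    (fun x => (f x - g x) + (g x - trig_poly s x)).
  by apply/funext => x; rewrite addrA subrK.
apply: le_lt_trans (msqD_le mu _ _) _.
- by apply: cmeasD => //; exact: cmeasN.
- exact: cmeasB_trig.
have -> : eps%:E = (2%:E * (eps / 4)%:E + 2%:E * (eps / 4)%:E)%E.
  by rewrite -!EFinM -EFinD; congr EFin; field.
by apply: lteD; rewrite lte_pmul2l.
Qed.

Lemma in_L2_closureD f g : cmeas f -> cmeas g -> V f -> V g ->
  V (fun x => f x + g x).
Proof.
move=> mf mg Vf Vg eps e0; have e4 : 0 < eps / 4 by rewrite divr_gt0.
have [s [sL hs]] := Vf _ e4; have [t [tL ht]] := Vg _ e4.
exists (s ++ t); split.
  by move=> p; rewrite mem_cat => /orP[/sL|/tL].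
have -> : (fun x => f x + g x - trig_poly (s ++ t) x) =
    (fun x => (f x - trig_poly s x) + (g x - trig_poly t x)).
  by apply/funext => x; rewrite /trig_poly big_cat /= opprD addrACA.
apply: le_lt_trans (msqD_le mu (cmeasB_trig _ mf) (cmeasB_trig _ mg)) _.
have -> : eps%:E = (2%:E * (eps / 4)%:E + 2%:E * (eps / 4)%:E)%E.
  by rewrite -!EFinM -EFinD; congr EFin; field.
by apply: lteD; rewrite lte_pmul2l.
Qed.

Lemma in_L2_closureZ (c : R[i]) f : cmeas f -> V f -> V (fun x => c * f x).
Proof.
move=> mf Vf eps e0; have k0 : 0 < sqmod c + 1 by rewrite ltr_wpDl // sqmod_ge0.
have e4 : 0 < eps / (sqmod c + 1) by rewrite divr_gt0.
have [s [sL hs]] := Vf _ e4.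
exists [seq (c * p.1, p.2) | p <- s]; split.
  by move=> p /mapP[q qs ->] /=; exact: sL.
have -> : (fun x => c * f x - trig_poly [seq (c * p.1, p.2) | p <- s] x) =
    (fun x => c * (f x - trig_poly s x)).
  apply/funext => x; rewrite /trig_poly big_map /= mulrBr mulr_sumr.
  by under [in RHS]eq_bigr do rewrite mulrA.
have mc : cmeas (fun _ : T => c) by exact: cmeas_cst.
apply: (@le_lt_trans _ _ ((sqmod c + 1)%:E *
    msq mu (fun x => (f x - trig_poly s x)%R))%E).
  apply: (msqM_le mu mc (cmeasB_trig s mf) (ltW k0)).
  by move=> _; rewrite lerDl.
have -> : eps%:E = ((sqmod c + 1)%:E * (eps / (sqmod c + 1))%:E)%E.
  by rewrite -EFinM mulrC divfK // gt_eqF.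
by rewrite lte_pmul2l.
Qed.

(** Density is proved through the functions that send every exponential into the
closure of the span. They form an algebra, closed under bounded pointwise
limits, that contains the exponentials; a monotone class argument then shows
that it contains all indicators of Borel sets. *)
Definition L2_multiplier f : Prop :=
  bmfc f /\ forall xi, V (fun x => f x * exponential xi x).
Local Notation W := L2_multiplier.

Hypothesis HV : forall xi, V (exponential xi).

Lemma L2_multiplier_exponential xi : W (exponential xi).
Proof.
split; first exact: bmfc_exponential.
by move=> y; rewrite -exponentialD; exact: HV.
Qed.

Lemma L2_multiplier_cst c : W (fun=> c).
Proof.
split; first exact: bmfc_cst.
move=> xi; apply: in_L2_closureZ => //.
by apply/bmfc_cmeas; exact: bmfc_exponential.
Qed.

Lemma cmeas_exponential xi : cmeas (exponential xi : T -> R[i]).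
Proof. exact/bmfc_cmeas/bmfc_exponential. Qed.

Lemma L2_multiplierD f g : W f -> W g -> W (fun x => f x + g x).
Proof.
move=> [bf Vf] [bg Vg]; split; first exact: bmfcD.
move=> xi; under eq_fun do rewrite mulrDl.
apply: in_L2_closureD => //.
- by apply: cmeasM; [exact/bmfc_cmeas | exact: cmeas_exponential].
- by apply: cmeasM; [exact/bmfc_cmeas | exact: cmeas_exponential].
Qed.

Lemma L2_multiplier_trig f s : W f -> V (fun x => f x * trig_poly s x).
Proof.
move=> [bf Vf]; elim: s => [|p s IH].
  have -> : (fun x => f x * trig_poly [::] x) = (fun x => 0 * exponential 0 x).
    by apply/funext => x; rewrite /trig_poly big_nil mulr0 mul0r.
  by apply: in_L2_closureZ => //; exact: cmeas_exponential.
have -> : (fun x => f x * trig_poly (p :: s) x) =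
    (fun x => p.1 * (f x * exponential p.2 x) + f x * trig_poly s x).
  by apply/funext => x; rewrite /trig_poly big_cons mulrDr mulrCA.
have mfe : cmeas (fun x => f x * exponential p.2 x).
  by apply: cmeasM; [exact/bmfc_cmeas | exact: cmeas_exponential].
apply: in_L2_closureD => //.
- by apply: cmeasM => //; exact: cmeas_cst.
- by apply: cmeasM; [exact/bmfc_cmeas | exact: cmeas_trig_poly].
- exact: in_L2_closureZ.
Qed.

Lemma bmfc_sqmod_bound f : bmfc f -> exists2 C : R, 0 < C & forall x, sqmod (f x) <= C.
Proof.
move=> /bmf_sqmod[_ [C hC]]; exists (`|C| + 1); first by rewrite ltr_wpDl.
move=> x; apply: le_trans (ler_norm _) _; apply: le_trans (hC x) _.
by rewrite (le_trans (ler_norm C)) // lerDl.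
Qed.

(** Approximate g e_xi by a trigonometric polynomial and use that f multiplies
each of its terms into the closure. *)
Lemma L2_multiplierM f g : W f -> W g -> W (fun x => f x * g x).
Proof.
move=> Wf [bg Vg]; have bf := Wf.1; split; first exact: bmfcM.
have mf := bmfc_cmeas bf; have mg := bmfc_cmeas bg.
have [C C0 hC] := bmfc_sqmod_bound bf.
move=> xi; apply: in_L2_closure_limit.
  by apply: cmeasM; [exact: cmeasM | exact: cmeas_exponential].
move=> eps e0; have e1 : 0 < eps / C by rewrite divr_gt0.
have [s [sL hs]] := Vg xi _ e1.
exists (fun x => f x * trig_poly s x); split.
- by apply: cmeasM => //; exact: cmeas_trig_poly.
- exact: L2_multiplier_trig.
have -> : (fun x => f x * g x * exponential xi x - f x * trig_poly s x) =
    (fun x => f x * (g x * exponential xi x - trig_poly s x)).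
  by apply/funext => x; rewrite mulrBr mulrA.
apply: le_lt_trans (msqM_le mu mf _ (ltW C0) hC) _.
  by apply: cmeasB_trig; apply: cmeasM => //; exact: cmeas_exponential.
have -> : eps%:E = (C%:E * (eps / C)%:E)%E.
  by rewrite -EFinM mulrC divfK // gt_eqF.
by rewrite lte_pmul2l.
Qed.

Definition real_multiplier (f : T -> R) := W (fun x => (f x)%:C%C).
Local Notation Wr := real_multiplier.

Lemma real_multiplier_limit (f_ : nat -> T -> R) (f : T -> R) (C : R) :
  (forall k, Wr (f_ k)) -> (forall k x, `|f_ k x| <= C) ->
  (forall x, f_ k x @[k --> \oo] --> f x) -> Wr f.
Proof.
move=> Wf hC cv.
have mf_ k : measurable_fun setT (f_ k) by case: (Wf k) => [[[]]].
have mf : measurable_fun setT f.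
  by apply: (measurable_fun_cvg mf_) => x _; exact: cv.
have fC x : `|f x| <= C.
  have cn : `|f_ k x| @[k --> \oo] --> `|f x| by apply: cvg_norm; exact: cv.
  rewrite -(cvg_lim _ cn) //; apply: limr_le.
    by apply/cvg_ex; exists `|f x|; exact: cn.
  by apply: nearW => k; exact: hC.
have bf : bmf f by split => //; exists C.
split; first exact: bmfc_real.
move=> xi; have me := cmeas_exponential xi.
apply: in_L2_closure_limit; first by apply: cmeasM => //; exact: cmeas_real.
move=> eps e0.
have C0 : 0 <= C by exact: le_trans (normr_ge0 _) (hC 0%N 0).
have ig : mu.-integrable setT (EFin \o (fun _ : T => (2 * C) ^+ 2)).
  by apply: bmf_integrable; exact: bmf_cst.
have dom k x : (f x - f_ k x) ^+ 2 <= (2 * C) ^+ 2.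
  rewrite -(real_normK (num_real (_ - _))) lerXn2r ?nnegrE ?mulr_ge0 //.
  by rewrite (le_trans (ler_normB _ _)) // mulr_natl mulr2n lerD.
have [k hk] := msq_dominated_cvg mf_ mf ig dom cv e0.
exists (fun x => (f_ k x)%:C%C * exponential xi x); split.
- by apply: cmeasM => //; exact: cmeas_real.
- exact: (Wf k).2.
have -> : (fun x => (f x)%:C%C * exponential xi x - (f_ k x)%:C%C * exponential xi x) =
    (fun x => exponential xi x * ((f x)%:C%C - (f_ k x)%:C%C)).
  by apply/funext => x; rewrite mulrBr mulrC [X in _ - X]mulrC.
apply: le_lt_trans (msqM_le mu me _ ler01 _) _.
- by apply: cmeasD; [exact: cmeas_real | apply: cmeasN; exact: cmeas_real].
- by move=> x; rewrite /exponential sqmod_expi2pi.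
by rewrite mul1e.
Qed.

Lemma real_multiplierD (f g : T -> R) : Wr f -> Wr g -> Wr (fun x => f x + g x).
Proof.
move=> hf hg; have := L2_multiplierD hf hg; rewrite /Wr.
by under [X in _ -> W X]eq_fun do rewrite rmorphD.
Qed.

Lemma real_multiplierM (f g : T -> R) : Wr f -> Wr g -> Wr (fun x => f x * g x).
Proof.
move=> hf hg; have := L2_multiplierM hf hg; rewrite /Wr.
by under [X in _ -> W X]eq_fun do rewrite rmorphM.
Qed.

Lemma real_multiplier_cst (c : R) : Wr (fun=> c).
Proof. exact: L2_multiplier_cst. Qed.

Lemma real_multiplierZ (c : R) (f : T -> R) : Wr f -> Wr (fun x => c * f x).
Proof. by move=> hf; apply: real_multiplierM => //; exact: real_multiplier_cst. Qed.

Lemma real_multiplierB (f g : T -> R) : Wr f -> Wr g -> Wr (fun x => f x - g x).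
Proof.
move=> hf hg; apply: real_multiplierD => //.
by have := real_multiplierZ (-1) hg; under eq_fun do rewrite mulN1r.
Qed.

(** The sine is a combination of two exponentials. *)
Lemma real_multiplier_sin l (t a : R) :
  Wr (fun x => sin (2 * pi * t * (dot l x - a))).
Proof.
have := L2_multiplierD
  (L2_multiplierM (L2_multiplier_cst ((2^-1)%:C%C * - 'i%C * expi2pi (- t * a)))
     (L2_multiplier_exponential (t *: l)))
  (L2_multiplierM (L2_multiplier_cst ((2^-1)%:C%C * 'i%C * expi2pi (t * a)))
     (L2_multiplier_exponential (- (t *: l)))).
rewrite /Wr; congr W; apply/funext => x.
rewrite -!mulrA /exponential -!expi2piD dotNl dotZl.
have -> : - t * a + t * dot l x = t * (dot l x - a) by ring.
have -> : t * a - t * dot l x = - (t * (dot l x - a)) by ring.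
rewrite expi2piN /expi2pi !mulrA; move: (2 * pi * t * _) => u.
by apply/eqP; rewrite eq_complex /=; apply/andP; split; apply/eqP; field.
Qed.

Lemma real_multiplier_sgn (f : T -> R) : Wr f -> (forall x, `|f x| <= 1) ->
  Wr (fun x => Num.sg (f x)).
Proof.
move=> Wf f1.
apply: (@real_multiplier_limit (fun k x => iter k (@sgn_step R) (f x)) _ 1).
- elim=> [|k IH] //=.
  have W3 := real_multiplierM IH (real_multiplierM IH IH).
  have := real_multiplierZ 2^-1 (real_multiplierB (real_multiplierZ 3 IH) W3).
  rewrite /Wr; congr W; apply/funext => x; congr (_%:C%C).
  by rewrite /sgn_step mulrC !exprS expr0 mulr1.
- by move=> k x; exact: iter_sgn_step_bound.
- by move=> x; exact: cvg_iter_sgn_step.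
Qed.

Lemma sg_sin_small (y : R) : `|y| < pi -> Num.sg (sin y) = Num.sg y.
Proof.
have [y0|y0|->] := ltrgt0P y; rewrite ?sin0 //.
- by move=> yp; rewrite !gtr0_sg // sin_gt0_pi // y0.
- move=> yp; rewrite -{1}(opprK y) sinN sgrN gtr0_sg ?ltr0_sg //.
  by rewrite sin_gt0_pi // oppr_gt0 y0.
Qed.

(** For a small frequency t the sign of sin (2 pi t y) is the sign of y, so the
sign of an affine form is a pointwise limit of signs of sines. *)
Lemma real_multiplier_sg_dot l (a : R) : Wr (fun x => Num.sg (dot l x - a)).
Proof.
apply: (@real_multiplier_limit
  (fun k x => Num.sg (sin (2 * pi * k.+1%:R^-1 * (dot l x - a)))) _ 1).
- move=> k; apply: real_multiplier_sgn; first exact: real_multiplier_sin.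
  by move=> x; exact: sin_max.
- by move=> k x; rewrite normr_sg lern1 leq_b1.
- move=> x; set y := _ - a; apply: cvg_near_cst.
  near=> k; have k1 : 2 * `|y| < k.+1%:R.
    near: k; exists (Num.bound (2 * `|y|)) => // k /= hk.
    apply: (lt_trans (archi_boundP _)) => //; rewrite ?ltr_nat //.
  have k0 : 0 < 2 * pi * k.+1%:R^-1 :> R.
    by rewrite mulr_gt0 ?mulr_gt0 ?pi_gt0 // invr_gt0.
  rewrite sg_sin_small; first by rewrite sgrM gtr0_sg // mul1r.
  rewrite normrM (gtr0_norm k0).
  have -> : 2 * pi * k.+1%:R^-1 * `|y| = pi * ((2 * `|y|) / k.+1%:R) by ring.
  by rewrite gtr_pMr ?pi_gt0 // ltr_pdivrMr // mul1r.
Unshelve. all: by end_near. Qed.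

Definition multiplier_set (A : set T) : Prop := Wr (fun x => \1_A x).
Local Notation WS := multiplier_set.

(** The indicator of (0, oo) is (sg^2 + sg) / 2. *)
Lemma multiplier_set_halfspace l (a : R) : WS [set x | a < dot l x].
Proof.
have h := real_multiplier_sg_dot l a.
have := real_multiplierZ 2^-1 (real_multiplierD (real_multiplierM h h) h).
rewrite /WS /Wr; congr W; apply/funext => x; congr (_%:C%C).
rewrite indicE; have -> : (x \in [set x | a < dot l x]) = (0 < dot l x - a).
  by rewrite subr_gt0; apply/idP/idP; rewrite inE.
case: (ltrgt0P (dot l x - a)) => hx.
- by rewrite gtr0_sg // mulr1 -(natrD _ 1 1) mulVf.
- by rewrite ltr0_sg // mulrNN mulr1 subrr mulr0.
- by rewrite hx sgr0 mulr0 addr0 mulr0.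
Qed.

Lemma multiplier_setC A : WS A -> WS (~` A).
Proof.
move=> hA; have := real_multiplierB (real_multiplier_cst 1) hA.
rewrite /WS /Wr; congr W; apply/funext => x; congr (_%:C%C).
by rewrite !indicE in_setC; case: (x \in A); rewrite ?subrr ?subr0.
Qed.

Lemma multiplier_setI A B : WS A -> WS B -> WS (A `&` B).
Proof.
move=> hA hB; have := real_multiplierM hA hB.
rewrite /WS /Wr; congr W; apply/funext => x; congr (_%:C%C).
by rewrite indicI.
Qed.

Lemma multiplier_setT : WS setT.
Proof.
have := real_multiplier_cst 1.
by rewrite /WS /Wr; congr W; apply/funext => x; rewrite indicT.
Qed.

Lemma multiplier_setU A B : WS A -> WS B -> WS (A `|` B).
Proof.
move=> hA hB; rewrite -(setCK (A `|` B)) setCU.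
by apply: multiplier_setC; apply: multiplier_setI; exact: multiplier_setC.
Qed.

Lemma multiplier_set_bigcup (A : nat -> set T) : (forall k, WS (A k)) ->
  WS (\bigcup_k A k).
Proof.
move=> hA; apply: (@real_multiplier_limit
  (fun m x => \1_(\big[setU/set0]_(k < m) A k) x) _ 1).
- elim=> [|m IH].
    by rewrite big_ord0 -setCT; apply: multiplier_setC; exact: multiplier_setT.
  by rewrite big_ord_recr; exact: multiplier_setU.
- by move=> k x; rewrite indicE ger0_norm // lern1 leq_b1.
- move=> x; apply: cvg_near_cst.
  case: (pselect ((\bigcup_k A k) x)) => [[k _ Ak]|nA].
    exists k.+1 => // m /= km; rewrite !indicE !mem_set //.
      by exists k.
    by rewrite -bigcup_mkord; exists k.
  apply: nearW => m; rewrite !indicE !memNset //.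
  by rewrite -bigcup_mkord => -[k _ Ak]; apply: nA; exists k.
Qed.

Lemma multiplier_set_bigcap_ord m (A : 'I_m -> set T) :
  (forall i, WS (A i)) -> WS [set x | forall i, A i x].
Proof.
move=> hA; have -> : [set x | forall i, A i x] = \big[setI/setT]_(i < m) A i.
  apply/seteqP; split => x.
    by move=> h; elim/big_ind: _ => // i _; exact: h.
  move=> + i; rewrite (bigD1 i) //=; by case.
elim/big_ind: _ => //; first exact: multiplier_setT.
exact: multiplier_setI.
Qed.

Lemma multiplier_set_box (q : 'cV[R]_n) (r : R) : WS [set x | `|x - q| < r].
Proof.
have [r0|r0] := ltP 0 r; last first.
  rewrite (_ : mkset _ = set0).
    by rewrite -setCT; apply: multiplier_setC; exact: multiplier_setT.
  apply/seteqP; split => x //=.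
  by rewrite ltNge (le_trans r0).
pose e i : 'cV[R]_n := delta_mx i ord0.
have de i x : dot (e i) x = x i ord0.
  rewrite /dot (bigD1 i) //= big1 ?addr0 ?mxE ?eqxx ?mul1r // => j ji.
  by rewrite mxE (negbTE ji) mul0r.
have -> : [set x : T | `|x - q| < r] = [set x | forall i,
   ([set x | q i ord0 - r < dot (e i) x] `&`
    [set x | - (q i ord0 + r) < dot (- e i) x]) x].
  apply/seteqP; split => x /= h.
    move=> i; rewrite dotNl !de.
    have := le_lt_trans (mx_entry_le (x - q) i ord0) h.
    by rewrite !mxE ltr_norml => /andP[? ?]; split; lra.
  rewrite [X in X < _]/Num.Def.normr /= mx_normrE; apply: bigmax_lt => // -[i j] _ /=.
  have := h i; rewrite dotNl !de !mxE (ord1 j) => -[? ?].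
  by rewrite ltr_norml; apply/andP; split; lra.
apply: multiplier_set_bigcap_ord => i.
by apply: multiplier_setI; exact: multiplier_set_halfspace.
Qed.

(** An open set is a countable union of boxes with rational centre and
inverse-integer radius. *)
Lemma multiplier_set_open (U : set 'cV[R]_n) : open U -> WS U.
Proof.
move=> oU; pose box (k : 'cV[rat]_n * nat) :=
  [set x : 'cV[R]_n | `|x - map_mx ratr k.1| < k.2.+1%:R^-1].
pose B k := if (choice.unpickle k : option ('cV[rat]_n * nat)) is Some p then
  (if `[< box p `<=` U >] then box p else set0) else set0.
have -> : U = \bigcup_k B k.
  apply/seteqP; split => x; last first.
    move=> [k _]; rewrite /B; case: (choice.unpickle k) => [p|//].
    by case: asboolP => // h /h.
  move=> Ux; have /nbhs_ballP[eps /= e0 hb] : nbhs x U by exact: open_nbhs_nbhs.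
  have [m hm] : exists m, m.+1%:R^-1 < eps / 2 :> R.
    exists (Num.bound (eps / 2)^-1).
    rewrite -[ltRHS]invrK ltf_pV2 ?posrE ?invr_gt0 ?divr_gt0 //.
    apply: lt_trans (archi_boundP _) _; last by rewrite ltr_nat.
    by rewrite invr_ge0 ltW // divr_gt0.
  have m0 : 0 < m.+1%:R^-1 :> R by rewrite invr_gt0.
  pose r : R := m.+1%:R^-1; rewrite -/r in hm m0.
  have hq i : exists q : rat, `|x i ord0 - ratr q| < r.
    have h : x i ord0 - r < x i ord0 + r by lra.
    have [q] := rat_in_itvoo h; rewrite in_itv /= => /andP[q1 q2].
    by exists q; rewrite ltr_norml; apply/andP; split; lra.
  have [q hq'] := boolp.choice hq.
  pose Q : 'cV[rat]_n := \col_i q i.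
  have xQ : box (Q, m) x.
    rewrite /box /= [X in X < _]/Num.Def.normr /= mx_normrE.
    by apply: bigmax_lt => // -[i j] _ /=; rewrite !mxE (ord1 j).
  exists (choice.pickle (Q, m)) => //; rewrite /B choice.pickleK; case: asboolP => // h.
  exfalso; apply: h => y yQ; apply: hb; rewrite -ball_normE /=.
  rewrite -(subrK (map_mx ratr Q) x) -addrA.
  apply: le_lt_trans (ler_normD _ _) _; rewrite [X in _ + X]distrC.
  by apply: lt_trans (ltrD xQ yQ) _; rewrite /= -/r; lra.
apply: multiplier_set_bigcup => k; rewrite /B.
have W0 : WS set0 by rewrite -setCT; apply: multiplier_setC; exact: multiplier_setT.
case: (choice.unpickle k) => // p; case: asboolP => // _; exact: multiplier_set_box.
Qed.

(** The sets whose indicator is a multiplier form a sigma-algebra that contains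
the open sets. *)
Lemma multiplier_set_measurable (A : set T) : measurable A -> WS A.
Proof.
apply: (@smallest_sub _ (sigma_algebra setT) (@open 'cV[R]_n) [set A | WS A]).
- split=> /=.
  + by rewrite -setCT; apply: multiplier_setC; exact: multiplier_setT.
  + by move=> B hB; rewrite setTD; exact: multiplier_setC.
  + by move=> F hF; exact: multiplier_set_bigcup.
- exact: multiplier_set_open.
Qed.

Lemma real_multiplier_sum (I : Type) (s : seq I) (F : I -> T -> R) :
  (forall i, Wr (F i)) -> Wr (fun x => \sum_(i <- s) F i x).
Proof.
move=> hF; elim: s => [|i s IH].
  by under eq_fun do rewrite big_nil; exact: real_multiplier_cst.
by under eq_fun do rewrite big_cons; exact: real_multiplierD.
Qed.

Import HBNNSimple.

Lemma real_multiplier_nnsfun (f : {nnsfun T >-> R}) : Wr f.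
Proof.
have -> : (f : T -> R) = fun x => \sum_(y <- fset_set (range f)) y * \1_(f @^-1` [set y]) x.
  by apply/funext => x; rewrite fimfunE fsbig_finite //=.
apply: real_multiplier_sum => y; apply: real_multiplierZ.
by apply: multiplier_set_measurable; exact: measurable_funPTI.
Qed.

Lemma in_L2_closure_multiplier f : W f -> V f.
Proof.
move=> [_ /(_ 0)]; congr V; apply/funext => x.
by rewrite /exponential dot0l expi2pi0 mulr1.
Qed.

(** Monotone approximation by simple functions, dominated by f^2. *)
Lemma in_L2_closure_ge0 (f : T -> R) : measurable_fun setT f ->
  (forall x, 0 <= f x) -> (\int[mu]_x (f x ^+ 2)%:E < +oo)%E ->
  V (fun x => (f x)%:C%C).
Proof.
move=> mf f0 fi; apply: in_L2_closure_limit; first exact: cmeas_real.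
move=> eps e0; have mE : measurable_fun setT (EFin \o f) by exact/measurable_EFinP.
pose g := nnsfun_approx measurableT mE.
have fE0 x : setT x -> (0 <= (EFin \o f) x)%E by rewrite lee_fin.
have gf k x : g k x <= f x.
  by rewrite -lee_fin /g nnsfun_approxE; exact: (le_approx _ fE0).
have cv x : g k x @[k --> \oo] --> f x.
  have := @cvg_nnsfun_approx _ T R setT measurableT (EFin \o f) mE fE0 x I.
  by move=> /fine_cvgP[_].
have ig : mu.-integrable setT (EFin \o (fun x => f x ^+ 2)).
  apply/integrableP; split.
    by apply/measurable_EFinP; exact: measurable_funX.
  by under eq_integral do rewrite gee0_abs ?lee_fin ?sqr_ge0 //.
have dom k x : (f x - g k x) ^+ 2 <= f x ^+ 2.
  have gk0 : 0 <= g k x by [].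
  by rewrite lerXn2r ?nnegrE ?subr_ge0 // lerBlDr lerDl.
have mg k : measurable_fun setT (g k) by [].
have [k hk] := msq_dominated_cvg mg mf ig dom cv e0.
exists (fun x => (g k x)%:C%C); split => //; first exact: cmeas_real.
exact: in_L2_closure_multiplier (real_multiplier_nnsfun (g k)).
Qed.

Lemma in_L2_closure_real (f : T -> R) : measurable_fun setT f ->
  (\int[mu]_x (f x ^+ 2)%:E < +oo)%E -> V (fun x => (f x)%:C%C).
Proof.
move=> mf fi.
have part (g : T -> R) : measurable_fun setT g -> (forall x, 0 <= g x) ->
    (forall x, g x ^+ 2 <= f x ^+ 2) -> V (fun x => (g x)%:C%C).
  move=> mg g0 gf; apply: in_L2_closure_ge0 => //; apply: le_lt_trans fi.
  apply: ge0_le_integral => //.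
  - by move=> x _; rewrite lee_fin sqr_ge0.
  - by apply/measurable_EFinP; exact: measurable_funX.
  - by apply/measurable_EFinP; exact: measurable_funX.
  - by move=> x _; rewrite lee_fin.
have Vp : V (fun x => (Num.max (f x) 0)%:C%C).
  apply: part => [|x|x].
  - by apply: measurable_maxr => //; exact: measurable_cst.
  - by rewrite le_max lexx orbT.
  - by case: (leP (f x) 0) => h; rewrite ?expr0n ?sqr_ge0.
have Vn : V (fun x => (Num.max (- f x) 0)%:C%C).
  apply: part => [|x|x].
  - by apply: measurable_maxr => //; exact: measurable_funN.
  - by rewrite le_max lexx orbT.
  - by case: (leP (- f x) 0) => h; rewrite ?expr0n ?sqr_ge0 ?sqrrN.
have mp : measurable_fun setT (fun x => Num.max (f x) 0).
  by apply: measurable_maxr => //; exact: measurable_cst.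
have mn : measurable_fun setT (fun x => Num.max (- f x) 0).
  by apply: measurable_maxr => //; exact: measurable_funN.
have mpC := cmeas_real mp; have mnC := cmeas_real mn.
have -> : (fun x => (f x)%:C%C) =
    (fun x => (Num.max (f x) 0)%:C%C + (-1) * (Num.max (- f x) 0)%:C%C).
  apply/funext => x; rewrite mulN1r -rmorphB; congr (_%:C%C).
  have [h|h] := leP 0 (f x).
    by rewrite max_r ?subr0 // oppr_le0.
  by rewrite max_l ?oppr_ge0 ?(ltW h) // sub0r opprK.
apply: in_L2_closureD => //.
  by apply: cmeasM => //; exact: cmeas_cst.
exact: in_L2_closureZ.
Qed.

(** Every square integrable function is in the closure as soon as every single
exponential is: this reduces completeness to Parseval for exponentials. *)
Lemma in_L2_closure_full f : cmeas f -> (msq mu f < +oo)%E -> V f.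
Proof.
move=> /[dup] mf [mr mi] fi.
have part (g : T -> R) : measurable_fun setT g ->
    (forall x, g x ^+ 2 <= sqmod (f x)) -> V (fun x => (g x)%:C%C).
  move=> mg gf; apply: in_L2_closure_real => //; apply: le_lt_trans fi.
  apply: ge0_le_integral => //.
  - by move=> x _; rewrite lee_fin sqr_ge0.
  - by apply/measurable_EFinP; exact: measurable_funX.
  - by apply/measurable_EFinP; exact: measurable_sqmod.
  - by move=> x _; rewrite lee_fin.
have -> : f = (fun x => (complex.Re (f x))%:C%C + 'i%C * (complex.Im (f x))%:C%C).
  by apply/funext => x; exact: complexE.
apply: in_L2_closureD.
- exact: cmeas_real.
- by apply: cmeasM; [exact: cmeas_cst | exact: cmeas_real].
- by apply: part => // x; rewrite /sqmod /= lerDl sqr_ge0.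
- apply: in_L2_closureZ; first exact: cmeas_real.
  by apply: part => // x; rewrite /sqmod /= lerDr sqr_ge0.
Qed.

End Density.

(** * Orthonormal bases of exponentials *)

Section OrthonormalExponentials.
Variables (R : realType) (n : nat) (mu : probability (borelRn R n) R).
Local Notation T := (borelRn R n).
Local Notation ft := (ft mu).
Implicit Types (L : set 'cV[R]_n) (x y l xi : 'cV[R]_n) (s : seq 'cV[R]_n).

Lemma L2norm_lt (f : T -> R[i]) (eps : R) : 0 < eps ->
  (L2norm mu f < eps%:E)%E = (msq mu f < (eps ^+ 2)%:E)%E.
Proof.
move=> e0; have h : ((L2norm mu f) `^ 2)%E = msq mu f.
  rewrite /L2norm powR_Lnorm // /msq; apply: eq_integral => x _ /=.
  by rewrite sqmod_normc powR_mulrn ?normr_ge0 // real_normK // num_real.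
rewrite -h; have := @Lnorm_ge0 _ T R mu 2%:E (EFin \o @ComplexField.Normc.normc R \o f)%E.
rewrite -/(L2norm mu f); case: (L2norm mu f) => [r| |] //.
  rewrite lee_fin => r0; rewrite poweR_EFin !lte_fin powR_mulrn //.
  by rewrite ltr_pXn2r // nnegrE ltW.
by rewrite poweRyr.
Qed.

Definition orthogonal_exponentials L : Prop :=
  forall x y, L x -> L y -> x != y -> ft (x - y) = 0.

(** Parseval for the exponential of frequency - xi: Bessel bounds these sums
by 1, so they are asked to come arbitrarily close to 1. *)
Definition saturated L xi : Prop := forall eps : R, 0 < eps -> exists s,
  [/\ uniq s, (forall l, l \in s -> L l) &
      1 - eps <= \sum_(l <- s) sqmod (ft (xi + l))].

Lemma sqmod_ftN x : sqmod (ft (- x)) = sqmod (ft x).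
Proof. by rewrite ftN sqmodJ. Qed.

Lemma exponentialB x y (z : T) :
  exponential (x - y) z = exponential x z * (exponential y z)^*%C.
Proof. by rewrite exponentialD exponentialJ. Qed.

Lemma sqmodB (z w : R[i]) : (sqmod (z - w))%:C%C =
  z * z^*%C - (z^*%C * w + z * w^*%C) + (sqmod w)%:C%C.
Proof.
case: z w => a b [c e]; rewrite /sqmod; apply/eqP; rewrite eq_complex /=.
by apply/andP; split; apply/eqP; ring.
Qed.

(** The distance to a combination of orthonormal functions splits into the
distance to the orthogonal projection and the error in the coefficients. *)
Lemma exponential_distance L s (c : 'cV[R]_n -> R[i]) xi :
  orthogonal_exponentials L -> uniq s -> (forall l, l \in s -> L l) ->
  \int[mu]_x sqmod (exponential xi x - \sum_(l <- s) c l * exponential l x) =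
  1 - \sum_(l <- s) sqmod (ft (xi - l)) + \sum_(l <- s) sqmod (c l - ft (xi - l)).
Proof.
move=> oL us sL.
pose g (x : T) : R[i] := \sum_(l <- s) c l * exponential l x.
have be := @bmfc_exponential R n.
have bce l : bmfc (fun x : T => c l * exponential l x).
  by apply: bmfcM; [exact: bmfc_cst | exact: be].
have bg : bmfc g by apply: bmfc_sum.
have bgJ : bmfc (fun x : T => (g x)^*%C) by exact: bmfcJ.
have bxJ : bmfc (fun x : T => (exponential xi x)^*%C) by exact: bmfcJ.
pose a l := ft (xi - l).
have cgx : cint mu (fun x : T => exponential xi x * (g x)^*%C) =
    \sum_(l <- s) (c l)^*%C * a l.
  transitivity (cint mu (fun x : T => \sum_(l <- s) (c l)^*%C * exponential (xi - l) x)).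
    congr cint; apply/funext => x; rewrite rmorph_sum mulr_sumr.
    apply: eq_bigr => l _; rewrite rmorphM mulrCA; congr (_ * _).
    exact: (esym (exponentialB _ _ _)).
  rewrite cint_sum; last by move=> l; apply: bmfcM => //; exact: bmfc_cst.
  by apply: eq_bigr => l _; rewrite cintZ.
have cxg : cint mu (fun x : T => g x * (exponential xi x)^*%C) =
    \sum_(l <- s) c l * (a l)^*%C.
  have -> : (fun x : T => g x * (exponential xi x)^*%C) =
      (fun x => (exponential xi x * (g x)^*%C)^*%C).
    by apply/funext => x; rewrite rmorphM /= conjcK mulrC.
  rewrite cintJ; last exact: bmfcM.
  rewrite cgx rmorph_sum; apply: eq_bigr => l _.
  by rewrite rmorphM /= conjcK.
have cgg : cint mu (fun x : T => g x * (g x)^*%C) = \sum_(l <- s) c l * (c l)^*%C.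
  transitivity (cint mu (fun x : T => \sum_(l <- s) \sum_(m <- s)
      (c l * (c m)^*%C) * exponential (l - m) x)).
    congr cint; apply/funext => x; rewrite rmorph_sum mulr_suml.
    apply: eq_bigr => l _; rewrite mulr_sumr; apply: eq_bigr => m _.
    rewrite rmorphM mulrACA; congr (_ * _).
    exact: (esym (exponentialB _ _ _)).
  rewrite cint_sum; last first.
    by move=> l; apply: bmfc_sum => m; apply: bmfcM => //; exact: bmfc_cst.
  rewrite big_seq [RHS]big_seq; apply: eq_bigr => l ls.
  rewrite cint_sum; last by move=> m; apply: bmfcM => //; exact: bmfc_cst.
  rewrite (bigD1_seq l) //= cintZ // subrr -/(ft 0) ft0 mulr1.
  rewrite big_seq_cond big1 ?addr0 // => m /andP[ms ml].
  have z : ft (l - m) = 0 by apply: oL; rewrite ?[l == m]eq_sym //; exact: sL.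
  by rewrite cintZ // -/(ft _) z mulr0.
apply: complexI.
rewrite -cint_real.
have -> : (fun x : T => (sqmod (exponential xi x - \sum_(l <- s) c l * exponential l x))%:C%C) =
  (fun x => (1 + g x * (g x)^*%C) + (-1) * (exponential xi x * (g x)^*%C +
    g x * (exponential xi x)^*%C)).
  apply/funext => x; rewrite sqmodE -/(g x) rmorphB mulrBl !mulrBr /exponential expi2pi_mulJ.
  by ring.
have b1 : bmfc (fun x : T => g x * (g x)^*%C) by exact: bmfcM.
have b2 : bmfc (fun x : T => exponential xi x * (g x)^*%C) by exact: bmfcM.
have b3 : bmfc (fun x : T => g x * (exponential xi x)^*%C) by exact: bmfcM.
have bc1 : bmfc (fun _ : T => 1 : R[i]) by exact: bmfc_cst.
rewrite cintD; [|exact: bmfcD|by apply: bmfcM; [exact: bmfc_cst|exact: bmfcD]].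
rewrite cintD // cintZ; last exact: bmfcD.
rewrite cintD // cint_cst cgg cgx cxg.
have e : \sum_(l <- s) (sqmod (c l - a l))%:C%C =
    \sum_(l <- s) c l * (c l)^*%C -
    (\sum_(l <- s) (c l)^*%C * a l + \sum_(l <- s) c l * (a l)^*%C) +
    \sum_(l <- s) (sqmod (a l))%:C%C.
  rewrite -big_split -sumrN -!big_split; apply: eq_bigr => l _.
  exact: sqmodB.
rewrite rmorphD rmorphB rmorph1 !rmorph_sum e mulN1r.
rewrite [X in _ = 1 - X + _](_ : _ = \sum_(l <- s) (sqmod (a l))%:C%C) //.
move: (\sum_(l <- s) (sqmod (a l))%:C%C) (\sum_(l <- s) c l * (c l)^*%C).
by move: (\sum_(l <- s) (c l)^*%C * a l + _) => z1 z2 z3; ring.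
Qed.

Lemma bessel L s xi : orthogonal_exponentials L -> uniq s ->
  (forall l, l \in s -> L l) -> \sum_(l <- s) sqmod (ft (xi + l)) <= 1.
Proof.
move=> oL us sL.
have h := exponential_distance (fun l => ft (- xi - l)) (- xi) oL us sL.
rewrite [X in _ + X]big1 ?addr0 in h; last by move=> l _; rewrite subrr sqmod0.
under eq_bigr do rewrite -sqmod_ftN opprD.
rewrite -subr_ge0 -h; apply: Rintegral_ge0 => x _; exact: sqmod_ge0.
Qed.

Lemma msq_bmfc (f : T -> R[i]) : bmfc f ->
  msq mu f = (\int[mu]_x sqmod (f x))%:E.
Proof.
move=> bf; rewrite fineK //; apply: integrable_fin_num => //.
by apply: bmf_integrable; exact: bmf_sqmod.
Qed.

Lemma bmfc_expB s (c : 'cV[R]_n -> R[i]) xi :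
  bmfc (fun x : T => exponential xi x - \sum_(l <- s) c l * exponential l x).
Proof.
have be := @bmfc_exponential R n.
have -> : (fun x : T => exponential xi x - \sum_(l <- s) c l * exponential l x) =
  (fun x => exponential xi x + -1 * \sum_(l <- s) c l * exponential l x).
  by apply/funext => x; rewrite mulN1r.
apply: bmfcD => //; apply: bmfcM; first exact: bmfc_cst.
by apply: bmfc_sum => l; apply: bmfcM => //; exact: bmfc_cst.
Qed.

Lemma inL2_exponential l : inL2 mu (exponential l).
Proof.
have be := @bmfc_exponential R n l; have [m1 m2] := bmfc_cmeas be.
split => //; apply: lt_trans (ltry 2); rewrite L2norm_lt // msq_bmfc // lte_fin.
under eq_Rintegral do rewrite sqmod_expi2pi.
by rewrite bRintegral_cst -subr_gt0; nra.
Qed.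

(** Approximating one exponential by a finite combination bounds its distance to
the projection, and that distance is the defect in Bessel's inequality. *)
Lemma orthonormal_basis_saturated L :
  orthonormal_basis mu L (@exponential R n) ->
  orthogonal_exponentials L /\ forall xi, saturated L xi.
Proof.
move=> [_ h2 h3]; have oL : orthogonal_exponentials L.
  by move=> x y Lx Ly xy; rewrite -L2inner_exponential h2 // (negbTE xy).
split => // xi eps e0.
have [||F [c [FL hF]]] := h3 (exponential (- xi)) _ (Num.sqrt eps) _.
- exact: inL2_exponential.
- by rewrite sqrtr_gt0.
exists F; split; [exact: fset_uniq|by move=> l lF; exact: FL|].
have se : Num.sqrt eps ^+ 2 = eps by rewrite sqr_sqrtr // ltW.
have s0 : 0 < Num.sqrt eps by rewrite sqrtr_gt0.
move: hF; rewrite (L2norm_lt _ s0) se msq_bmfc; last exact: bmfc_expB.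
rewrite lte_fin (exponential_distance _ _ oL); [|exact: fset_uniq|by move=> l lF; exact: FL].
under [X in _ -> _ <= X]eq_bigr do rewrite -sqmod_ftN opprD.
have : 0 <= \sum_(l <- F) sqmod (c l - ft (- xi - l)).
  by apply: sumr_ge0 => l _; exact: sqmod_ge0.
by lra.
Qed.

(** Saturation puts every exponential in the closure of the span, and the span of
all exponentials is dense. *)
Lemma saturated_orthonormal_basis L :
  orthogonal_exponentials L -> (forall xi, saturated L xi) ->
  orthonormal_basis mu L (@exponential R n).
Proof.
move=> oL sat; split.
- by move=> l _; exact: inL2_exponential.
- move=> x y Lx Ly; rewrite L2inner_exponential.
  by have [->|xy] := eqVneq x y; [rewrite subrr ft0 | rewrite oL].
have HV xi : in_L2_closure mu L (exponential xi).
  move=> eps e0; have e2 : 0 < eps / 2 by rewrite divr_gt0.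
  have [s [us sL hs]] := sat (- xi) _ e2.
  pose c l := ft (xi - l).
  exists [seq (c l, l) | l <- s]; split; first by move=> p /mapP[l ls ->]; exact: sL.
  rewrite (_ : (fun x => _) = (fun x => exponential xi x - \sum_(l <- s) c l * exponential l x)).
    rewrite msq_bmfc; last exact: bmfc_expB.
    rewrite lte_fin (exponential_distance _ _ oL us sL) [X in _ + X]big1 ?addr0.
      move: hs; under eq_bigr do rewrite -sqmod_ftN opprD opprK.
      by lra.
    by move=> l _; rewrite subrr sqmod0.
  by apply/funext => x; rewrite /trig_poly big_map.
move=> f [m1 m2 fi] eps e0.
have mf : cmeas f by [].
have fi2 : (msq mu f < +oo)%E.
  move: fi; rewrite -ge0_fin_numE ?Lnorm_ge0 // => /fineK e.
  have k0 : 0 < fine (L2norm mu f) + 1 by rewrite ltr_wpDl // fine_ge0 // Lnorm_ge0.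
  apply: lt_trans (ltry ((fine (L2norm mu f) + 1) ^+ 2)).
  by rewrite -L2norm_lt // -e lte_fin /= ltrDl.
have e2 : 0 < eps ^+ 2 by rewrite exprn_gt0.
have [s [sL hs]] := in_L2_closure_full HV mf fi2 e2.
exists [fset p.2 | p in s]%fset, (fun l => \sum_(p <- s | p.2 == l) p.1); split.
  by move=> l /= /imfsetP[p ps ->]; exact: sL.
rewrite L2norm_lt //; move: hs; congr (_ < _)%E; congr (msq mu _).
apply/funext => x; congr (_ - _); rewrite /trig_poly.
under [RHS]eq_bigr do rewrite mulr_suml.
rewrite (exchange_big_dep xpredT) //= big_seq [RHS]big_seq.
apply: eq_bigr => p ps; rewrite -big_filter.
rewrite (_ : [seq i <- _ | p.2 == i] = [:: p.2]) ?big_seq1 //.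
rewrite (eq_filter (a2 := pred1 p.2)); last by move=> y; rewrite /= eq_sym.
by rewrite filter_pred1_uniq ?fset_uniq //; apply/imfsetP; exists p.
Qed.

End OrthonormalExponentials.

(** * Selecting one element in each fibre *)

Section Selection.
Variable R : realType.

Lemma big_partition_seq (I K : eqType) (s : seq I) (h : I -> K) (F : I -> R) :
  \sum_(i <- s) F i = \sum_(k <- undup (map h s)) \sum_(i <- s | h i == k) F i.
Proof.
rewrite (exchange_big_dep xpredT) //= big_seq [RHS]big_seq.
apply: eq_bigr => i si; rewrite -big_filter (eq_filter (a2 := pred1 (h i))).
  by rewrite filter_pred1_uniq ?undup_uniq ?mem_undup ?map_f // big_seq1.
by move=> k; rewrite /= eq_sym.
Qed.

(** The sum in the hypothesis is, in each fibre of h, an average of the masses of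
the classes c = x with weights at least delta. Choosing the heaviest class in
each fibre gives total mass at most 1, while the average is at least 1 - eps;
since the class picked by tau has weight at least delta in that average, the
selection tau cannot fall below the heaviest one by more than eps / delta. *)
Lemma selection_mass (I K : eqType) (C : finType) (s : seq I) (h : I -> K)
    (c : I -> C) (phi : I -> R) (g : K -> C -> R) (delta eps : R) :
  (forall i, 0 <= phi i) -> 0 < delta <= 1 ->
  (forall k, \sum_x g k x = 1) ->
  (forall i x, i \in s -> delta <= g (h i) x) ->
  (forall sigma : K -> C, \sum_(i <- s | c i == sigma (h i)) phi i <= 1) ->
  1 - eps <= \sum_(i <- s) g (h i) (c i) * phi i ->
  forall tau : K -> C,
    1 - eps / delta <= \sum_(i <- s | c i == tau (h i)) phi i.
Proof.
move=> phi0 /andP[d0 d1] g1 gd bes tot tau.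
(* the mass of the class c = x in the fibre over k *)
pose q k x := \sum_(i <- s | h i == k) (if c i == x then phi i else 0).
(* sigma picks the heaviest class of each fibre *)
have [sigma hsigma] : exists sigma : K -> C, forall k x, q k x <= q k (sigma k).
  exists (fun k => [arg max_(y > tau k) q k y]%O) => k x.
  by case: arg_maxP => // y _ hy; exact: hy.
pose S (f : K -> C) := \sum_(i <- s | c i == f (h i)) phi i.
have SE f : S f = \sum_(k <- undup (map h s)) q k (f k).
  rewrite /S big_mkcond (big_partition_seq _ h); apply: eq_bigr => k _.
  by apply: eq_bigr => i /eqP->.
have key : \sum_(i <- s) g (h i) (c i) * phi i <= S sigma - delta * (S sigma - S tau).
  rewrite !SE -sumrB mulr_sumr -sumrB (big_partition_seq _ h).
  rewrite big_seq [leRHS]big_seq; apply: ler_sum => k; rewrite mem_undup => /mapP[i si ->].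
  set k0 := h i.
  have -> : \sum_(j <- s | h j == k0) g (h j) (c j) * phi j = \sum_x g k0 x * q k0 x.
    transitivity (\sum_(j <- s | h j == k0) \sum_x g k0 x * (if c j == x then phi j else 0)).
      apply: eq_bigr => j /eqP ->; rewrite (bigD1 (c j)) //= eqxx.
      rewrite big1 ?addr0 // => x xc; by rewrite eq_sym (negbTE xc) mulr0.
    by rewrite exchange_big; apply: eq_bigr => x _; rewrite mulr_sumr.
  rewrite lerBrDl -lerBrDr.
  have -> : q k0 (sigma k0) - \sum_x g k0 x * q k0 x =
      \sum_x g k0 x * (q k0 (sigma k0) - q k0 x).
    under [RHS]eq_bigr do rewrite mulrBr.
    by rewrite sumrB -mulr_suml g1 mul1r.
  have gp x : 0 < g k0 x by apply: lt_le_trans (gd i x si).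
  rewrite (bigD1 (tau k0)) //=; apply: ler_wpDr.
    by apply: sumr_ge0 => x _; rewrite mulr_ge0 ?(ltW (gp x)) // subr_ge0.
  by rewrite ler_wpM2r ?subr_ge0 // gd.
have b := bes sigma; rewrite -/(S sigma) in b; rewrite -/(S tau).
rewrite -(ler_pM2l d0) mulrBr mulrCA divff ?gt_eqF // !mulr1.
by nra.
Qed.

Lemma finite_lower_bound (T : finType) (f : T -> R) : (forall t, 0 < f t) ->
  exists2 d : R, 0 < d & forall t, d <= f t.
Proof.
move=> f0; exists (\big[Num.min/1]_t f t).
  by elim/big_ind: _ => // x y x0 y0; rewrite lt_min x0.
by move=> t; exact: bigmin_le.
Qed.

End Selection.

(** * Integer matrices modulo 2 *)

Section Parity.

Definition oddz (x : int) : bool := ~~ (2 %| x)%Z.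

Lemma modz2E x : (x %% 2)%Z = oddz x :> int.
Proof.
rewrite /oddz; have := ltz_pmod x (isT : 0 < 2 :> int).
have := modz_ge0 x (isT : 2 != 0 :> int).
have -> : (2 %| x)%Z = ((x %% 2)%Z == 0) by apply/dvdz_mod0P/eqP.
by case: (x %% 2)%Z => // -[|[|k]].
Qed.

Lemma oddzD x y : oddz (x + y) = oddz x (+) oddz y.
Proof.
have : ((x + y) %% 2)%Z = ((oddz x + oddz y)%:Z %% 2)%Z.
  by rewrite -modzDm !modz2E -PoszD.
by rewrite modz2E; case: (oddz x) (oddz y) (oddz (x + y)) => [] [] [].
Qed.

Lemma oddzM x y : oddz (x * y) = oddz x && oddz y.
Proof.
have : ((x * y) %% 2)%Z = ((oddz x * oddz y)%:Z %% 2)%Z.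
  by rewrite -modzMm !modz2E -PoszM.
by rewrite modz2E; case: (oddz x) (oddz y) (oddz (x * y)) => [] [] [].
Qed.

Lemma oddzN x : oddz (- x) = oddz x.
Proof. by rewrite -mulN1r oddzM. Qed.

Lemma oddz_neq0 x : oddz x -> x != 0.
Proof. by apply: contraTneq => ->. Qed.

Definition evenmx m n (X : 'M[int]_(m, n)) : Prop := forall i j, ~~ oddz (X i j).

Lemma evenmxD m n (X Y : 'M[int]_(m, n)) : evenmx X -> evenmx Y -> evenmx (X + Y).
Proof. by move=> hX hY i j; rewrite mxE oddzD (negbTE (hX i j)) (negbTE (hY i j)). Qed.

Lemma evenmxZ2 m n (X : 'M[int]_(m, n)) : evenmx (2 *: X).
Proof. by move=> i j; rewrite mxE oddzM. Qed.

Lemma evenmxZ m n c (X : 'M[int]_(m, n)) : evenmx X -> evenmx (c *: X).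
Proof. by move=> hX i j; rewrite mxE oddzM (negbTE (hX i j)) andbF. Qed.

Lemma evenmxB m n (X Y : 'M[int]_(m, n)) : evenmx X -> evenmx Y -> evenmx (X - Y).
Proof. by move=> hX hY; rewrite -scaleN1r; apply/evenmxD/evenmxZ. Qed.

Lemma evenmxP m n (X : 'M[int]_(m, n)) : evenmx X -> exists Y, X = 2 *: Y.
Proof.
move=> hX; exists (\matrix_(i, j) (X i j %/ 2)%Z); apply/matrixP => i j.
by rewrite !mxE mulrC divzK //; have := hX i j; rewrite /oddz negbK.
Qed.

Lemma evenmx_mul m n p (N : 'M[int]_(m, n)) (X : 'M[int]_(n, p)) :
  evenmx X -> evenmx (N *m X).
Proof. by move=> /evenmxP[Y ->]; rewrite -scalemxAr; exact: evenmxZ2. Qed.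

Lemma evenmx_mulr m n p (N : 'M[int]_(m, n)) (X : 'M[int]_(n, p)) :
  evenmx N -> evenmx (N *m X).
Proof. by move=> /evenmxP[Y ->]; rewrite -scalemxAl; exact: evenmxZ2. Qed.

Lemma evenmxZ_odd m n (c : int) (X : 'M[int]_(m, n)) :
  oddz c -> evenmx (c *: X) -> evenmx X.
Proof. by move=> oc hX i j; have := hX i j; rewrite mxE oddzM oc. Qed.

(** Multiply by the adjugate: the determinant is invertible modulo 2. *)
Lemma evenmx_cancel n p (N : 'M[int]_n) (X : 'M[int]_(n, p)) :
  oddz (\det N) -> evenmx (N *m X) -> evenmx X.
Proof.
move=> oN hX; apply: (evenmxZ_odd oN).
by rewrite -mul_scalar_mx -mul_adj_mx -mulmxA; exact: evenmx_mul.
Qed.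

Lemma evenmx_tr m n (X : 'M[int]_(m, n)) : evenmx X -> evenmx X^T.
Proof. by move=> h i j; rewrite mxE. Qed.

Lemma evenmx_vectors m n (X : 'M[int]_(m, n)) :
  (forall v : 'cV[int]_n, evenmx (X *m v)) -> evenmx X.
Proof. by move=> h i j; have := h (delta_mx j ord0) i ord0; rewrite -colE mxE. Qed.

Lemma oddz_det_adj (N : 'M[int]_2) : oddz (\det N) -> oddz (\det (\adj N)).
Proof.
move=> oN; have : \det (N *m \adj N) = \det N ^+ 2 by rewrite mul_mx_adj det_scalar.
rewrite det_mulmx expr2 => /(mulfI (oddz_neq0 oN)) ->.
exact: oN.
Qed.

End Parity.

(** * A spectrum forces an even matrix *)

Section Necessity.
Variables (R : realType) (mu : probability (borelRn R 2) R).
Variables (A B : 'M[int]_2).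
Local Notation ft := (ft mu).
Local Notation AR := (int_mx R A).
Local Notation BR := (int_mx R B).
Local Notation p := (\det B).

Lemma int_mxM m n k (X : 'M[int]_(m, n)) (Y : 'M[int]_(n, k)) :
  int_mx R (X *m Y) = int_mx R X *m int_mx R Y.
Proof. exact: map_mxM. Qed.

Lemma int_mxD m n (X Y : 'M[int]_(m, n)) : int_mx R (X + Y) = int_mx R X + int_mx R Y.
Proof. exact: map_mxD. Qed.

Lemma int_mxB m n (X Y : 'M[int]_(m, n)) : int_mx R (X - Y) = int_mx R X - int_mx R Y.
Proof. exact: map_mxB. Qed.

Lemma int_mxZ m n c (X : 'M[int]_(m, n)) : int_mx R (c *: X) = c%:~R *: int_mx R X.
Proof. exact: map_mxZ. Qed.

Lemma int_mx0 m n : int_mx R (0 : 'M[int]_(m, n)) = 0.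
Proof. exact: map_mx0. Qed.

Lemma int_mx_inj m n : injective (@int_mx R m n).
Proof.
move=> X Y h; apply/matrixP => i j.
have /(congr1 (fun Z : 'M[R]_(m, n) => Z i j)) := h.
by rewrite !mxE => /intr_inj.
Qed.

Lemma int_mx_scalar n (c : int) : int_mx R (c%:M : 'M[int]_n) = (c%:~R)%:M.
Proof.
by apply/matrixP => i j; rewrite !mxE; case: (i == j); rewrite ?mulr1n ?mulr0n.
Qed.

Lemma int_mxX n (X : 'M[int]_n.+1) k : int_mx R (X ^+ k) = int_mx R X ^+ k.
Proof. exact: rmorphXn. Qed.

Definition mask (x : 'cV[R]_2) : R[i] :=
  tetra_mask ((BR *m x) ord0 ord0) ((BR *m x) ord_max ord0).

Definition intv (x : 'cV[R]_2) := exists w, x = int_mx R w.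

Lemma cV2P (T : Type) (x y : 'cV[T]_2) :
  x ord0 ord0 = y ord0 ord0 -> x ord_max ord0 = y ord_max ord0 -> x = y.
Proof.
move=> h0 h1; apply/colP => i; have [->|->] : i = ord0 \/ i = ord_max.
  by case: i => [[|[|k]] hk] //; [left|right]; apply: val_inj.
  by [].
by [].
Qed.

Lemma mask_eq0 x : mask x = 0 ->
  exists2 v : 'cV[int]_2, 2 *: (BR *m x) = int_mx R v & ~ evenmx v.
Proof.
move=> /tetra_mask_eq0[m [k [hm hk nmk]]].
exists (col2 m k).
  apply: cV2P.
    by rewrite [LHS]mxE hm [RHS]mxE mxE.
  by rewrite [LHS]mxE hk [RHS]mxE mxE.
move=> h; apply: nmk; split.
- by have := h ord0 ord0; rewrite mxE /= negbK.
- by have := h ord_max ord0; rewrite mxE /= negbK.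
Qed.

Lemma mask_periodic x y : intv (BR *m y) -> mask (x + y) = mask x.
Proof.
move=> [w hw]; rewrite /mask mulmxDr hw !mxE tetra_mask_int //.
Qed.

Lemma mask0 : mask 0 = 1.
Proof. by rewrite /mask mulmx0 !mxE tetra_mask0. Qed.


Hypothesis oddB : oddz p.
Hypothesis unitA : AR \in unitmx.
Hypothesis ft_rec : forall x, ft (AR *m x) = mask x * ft x.
Hypothesis ft_zero : forall x, ft x = 0 ->
  exists k y, x = AR ^+ k.+1 *m y /\ mask y = 0.

Lemma p_neq0 : (p%:~R : R) != 0.
Proof. by rewrite intr_eq0 oddz_neq0. Qed.

Lemma ft_zero_iter k y : mask y = 0 -> ft (AR ^+ k.+1 *m y) = 0.
Proof.
move=> y0; elim: k => [|k IH]; first by rewrite expr1 ft_rec y0 mul0r.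
by rewrite exprS -mulmxE -mulmxA ft_rec IH mulr0.
Qed.

(** Integral on A^-1 L for a spectrum L containing 0 (lattice_coord_int). On a
difference that is a zero of the mask they equal p v with v not even. *)
Definition lattice_coord (x : 'cV[R]_2) : 'cV[R]_2 := (2 * p%:~R) *: (BR *m x).

Lemma lattice_coordB x y : lattice_coord (x - y) = lattice_coord x - lattice_coord y.
Proof. by rewrite /lattice_coord mulmxBr scalerBr. Qed.

Lemma lattice_coord_mask y v : 2 *: (BR *m y) = int_mx R v ->
  lattice_coord y = int_mx R (p *: v).
Proof. by move=> h; rewrite int_mxZ -h scalerA mulrC. Qed.

(** Here 2 y = B^-1 v and p B^-1 = adj B, so 2 p A^k y is integral for every k. *)
Lemma lattice_coord_iter k y v : 2 *: (BR *m y) = int_mx R v ->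
  lattice_coord (AR ^+ k *m y) = int_mx R (B *m (A ^+ k *m (\adj B *m v))).
Proof.
move=> h; rewrite !int_mxM int_mxX /lattice_coord -h.
rewrite -!scalemxAr [int_mx R (\adj B) *m _]mulmxA -int_mxM mul_adj_mx.
by rewrite int_mx_scalar mul_scalar_mx -!scalemxAr scalerA.
Qed.

Definition parity (w : 'cV[int]_2) : bool * bool :=
  (oddz (w ord0 ord0), oddz (w ord_max ord0)).

Lemma parity_eq (v w : 'cV[int]_2) : parity v = parity w -> evenmx (v - w).
Proof.
move=> [h0 h1] i j; rewrite (ord1 j); have [->|->] : i = ord0 \/ i = ord_max.
  by case: i => [[|[|k]] hk] //; [left|right]; apply: val_inj.
  by rewrite !mxE oddzD oddzN h0 addbb.
by rewrite !mxE oddzD oddzN h1 addbb.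
Qed.

(** A matrix whose product with one vector of each parity class is even kills
all of (Z/2)^2, hence is even; adj B is invertible modulo 2. *)
Lemma evenmx_of_parities :
  (forall v, exists2 w, parity w = parity v & evenmx (A *m \adj B *m w)) ->
  evenmx A.
Proof.
move=> h; have eAB : evenmx (A *m \adj B).
  apply: evenmx_vectors => v; have [w pw ew] := h v.
  have -> : A *m \adj B *m v = A *m \adj B *m w + A *m \adj B *m (v - w).
    by rewrite -mulmxDr addrC subrK.
  by apply: evenmxD => //; apply: evenmx_mul; apply: parity_eq; rewrite pw.
rewrite -[A]trmxK; apply: evenmx_tr.
apply: (evenmx_cancel (N := (\adj B)^T)).
  by rewrite det_tr; exact: oddz_det_adj.
by rewrite -trmx_mul; exact: evenmx_tr.
Qed.

Definition floor_coord (x : 'cV[R]_2) : 'cV[int]_2 := map_mx Num.floor (lattice_coord x).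

Lemma floor_coordE x w : lattice_coord x = int_mx R w -> floor_coord x = w.
Proof. by move=> h; apply/matrixP => i j; rewrite /floor_coord h !mxE intrKfloor. Qed.

(** The four pieces into which a spectrum is split. *)
Definition class_set (L : set 'cV[R]_2) (r : bool * bool) : set 'cV[R]_2 :=
  [set x | L (AR *m x) /\ exists2 w, lattice_coord x = int_mx R w & parity w = r].

Section Split.
Variable L : set 'cV[R]_2.
Hypotheses (L0 : L 0) (oL : orthogonal_exponentials mu L).

(** The difference of two points of A^-1 L is a zero A^k y of the transform, with
A taken off: either k = 0 and it is a zero of the mask, or it is again a zero
of the transform. *)
Lemma difference_cases x y : L (AR *m x) -> L (AR *m y) -> x != y ->
  (exists2 v, lattice_coord (x - y) = int_mx R (p *: v) & ~ evenmx v) \/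
  (ft (x - y) = 0 /\ exists w, lattice_coord (x - y) = int_mx R w).
Proof.
move=> Lx Ly xy.
have /oL : AR *m x != AR *m y.
  by apply: contraNneq xy => /(can_inj (mulKmx unitA)) ->.
move=> /(_ Lx Ly); rewrite -mulmxBr => /ft_zero[k [z [e z0]]].
have {}e : x - y = AR ^+ k *m z.
  by apply: (can_inj (mulKmx unitA)); rewrite e exprS -mulmxE mulmxA.
have [v hv ov] := mask_eq0 z0.
case: k e => [|k] e.
  left; exists v => //; rewrite e expr0 mul1mx; exact: lattice_coord_mask.
right; rewrite e ft_zero_iter //; split => //.
by eexists; exact: lattice_coord_iter hv.
Qed.

Lemma lattice_coord_int x : L (AR *m x) -> exists w, lattice_coord x = int_mx R w.
Proof.
move=> Lx; have [->|x0] := eqVneq x 0.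
  by exists 0; rewrite /lattice_coord mulmx0 scaler0 int_mx0.
have L00 : L (AR *m 0) by rewrite mulmx0.
have [] := difference_cases Lx L00 x0; rewrite subr0.
  by move=> [v h _]; exists (p *: v).
by case.
Qed.

(** The first alternative for a difference is excluded: its coordinates would be
p v with v not even, whereas the two parities agree and p is odd. *)
Lemma class_set_orthogonal r : orthogonal_exponentials mu (class_set L r).
Proof.
move=> x y [Lx [w hw wr]] [Ly [w' hw' wr']] xy.
have [[v hv ov]|[//]] := difference_cases Lx Ly xy.
exfalso; apply: ov; apply: (evenmxZ_odd oddB).
move: hv; rewrite lattice_coordB hw hw' -int_mxB => /int_mx_inj <-.
by apply: parity_eq; rewrite wr wr'.
Qed.

Definition bit (b : bool) : R := b%:R / 2.

(** The squared mask at theta + x when the coordinates of x are h + p c modulo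
2 p: adding p to a coordinate moves an entry of B x by one half. *)
Definition coset_weight (theta : 'cV[R]_2) (h : 'cV[int]_2) (c : bool * bool) : R :=
  sqmod (tetra_mask
    ((BR *m theta) ord0 ord0 + (h ord0 ord0)%:~R / (2 * p%:~R) + bit c.1)
    ((BR *m theta) ord_max ord0 + (h ord_max ord0)%:~R / (2 * p%:~R) + bit c.2)).

Lemma coset_weight_sum theta h : \sum_c coset_weight theta h c = 1.
Proof.
have E (F : bool -> bool -> R) : \sum_a \sum_b F a b =
    F false false + F true false + (F false true + F true true).
  transitivity ((F true true + F true false) + (F false true + F false false)).
    by rewrite !big_bool.
  by ring.
rewrite /coset_weight -(pair_bigA _ (fun a b => sqmod (tetra_mask
    ((BR *m theta) ord0 ord0 + (h ord0 ord0)%:~R / (2 * p%:~R) + bit a)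
    ((BR *m theta) ord_max ord0 + (h ord_max ord0)%:~R / (2 * p%:~R) + bit b)))) /=.
by rewrite [LHS]E /bit !mul1r !mul0r !addr0 sum_tetra_mask.
Qed.

Definition coset_res (w : 'cV[int]_2) : 'cV[int]_2 := map_mx (fun z => (z %% p)%Z) w.
Definition coset_quo (w : 'cV[int]_2) : bool * bool :=
  parity (map_mx (fun z => (z %/ p)%Z) w).

(** Split each coordinate as w = (w mod p) + p q and q = (q mod 2) + 2 q'; the
last term shifts an entry of B x by an integer. *)
Lemma coset_weightE theta x w : lattice_coord x = int_mx R w ->
  sqmod (mask (theta + x)) = coset_weight theta (coset_res w) (coset_quo w).
Proof.
move=> hw; have p0 := p_neq0.
have xE i : (BR *m x) i ord0 = ((w i ord0) %% p)%Z%:~R / (2 * p%:~R) +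
    bit (oddz (w i ord0 %/ p)%Z) + ((w i ord0 %/ p)%Z %/ 2)%Z%:~R.
  have : lattice_coord x i ord0 = (w i ord0)%:~R by rewrite hw mxE.
  rewrite mxE {1}(divz_eq (w i ord0) p) {1}(divz_eq (w i ord0 %/ p)%Z 2) modz2E.
  rewrite !(intrD, intrM) => e; apply: (mulfI (x := 2 * p%:~R)).
    by rewrite mulf_neq0.
  rewrite e /bit; case: (oddz _) => /=; field; exact: p0.
rewrite /mask mulmxDr [X in tetra_mask X]mxE [X in tetra_mask _ X]mxE !xE.
by rewrite !addrA tetra_mask_int /coset_weight /coset_quo /parity /= !mxE.
Qed.

(** A zero of the mask would make 2 p B theta integral. *)
Lemma coset_weight_neq0 theta h c : ~ intv (lattice_coord theta) ->
  0 < coset_weight theta h c.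
Proof.
move=> nt; rewrite lt_neqAle sqmod_ge0 andbT eq_sym sqmod_eq0.
apply/eqP => /tetra_mask_eq0[m [k [hm hk _]]]; apply: nt.
have p0 := p_neq0.
have cE (a : R) (z m' : int) (b : bool) :
    2 * (a + z%:~R / (2 * p%:~R) + bit b) = m'%:~R ->
    2 * p%:~R * a = (p * m' - z - p * (b%:R : int))%:~R.
  move=> e; rewrite !intrB !intrM -e /bit; case: b {e} => /=; field; exact: p0.
exists (col2 (p * m - h ord0 ord0 - p * (c.1%:R : int))
             (p * k - h ord_max ord0 - p * (c.2%:R : int))).
apply: cV2P.
  by rewrite [LHS]mxE (cE _ _ _ _ hm) [RHS]mxE mxE.
by rewrite [LHS]mxE (cE _ _ _ _ hk) [RHS]mxE mxE.
Qed.

(** Only finitely many residues modulo p occur. *)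
Lemma coset_weight_bound theta : ~ intv (lattice_coord theta) ->
  exists2 d : R, 0 < d <= 1 & forall w c, d <= coset_weight theta (coset_res w) c.
Proof.
move=> nt.
pose P := `|p|%N.
pose f (t : 'I_P * 'I_P * (bool * bool)) :=
  coset_weight theta (col2 (Posz t.1.1) (Posz t.1.2)) t.2.
have [d d0 hd] : exists2 d : R, 0 < d & forall t, d <= f t.
  by apply: finite_lower_bound => t; exact: coset_weight_neq0.
have res z : exists i : 'I_P, (z %% p)%Z = Posz i.
  have z0 := modz_ge0 z (oddz_neq0 oddB).
  have zl := ltz_mod z (oddz_neq0 oddB).
  have hl : (`|(z %% p)%Z| < P)%N by rewrite -ltz_nat gez0_abs.
  by exists (Ordinal hl); rewrite /= gez0_abs.
have hd' w c : d <= coset_weight theta (coset_res w) c.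
  have [i hi] := res (w ord0 ord0); have [j hj] := res (w ord_max ord0).
  have -> : coset_res w = col2 (Posz i) (Posz j).
    by apply: cV2P; rewrite !mxE /= ?hi ?hj.
  exact: (hd (i, j, c)).
exists d; rewrite ?d0 //=.
by apply: le_trans (hd' 0 (true, true)) _; exact: tetra_mask_le1.
Qed.

(** Since p is odd, the parity of w = h + p q is that of h + q; so, once the
residue h is known, prescribing the parity of w is prescribing that of q. *)
Lemma parity_coset w r : (parity w == r) =
  (coset_quo w == (oddz ((coset_res w) ord0 ord0) (+) r.1,
                   oddz ((coset_res w) ord_max ord0) (+) r.2)).
Proof.
have pz z : oddz z = oddz (z %/ p)%Z (+) oddz (z %% p)%Z.
  by rewrite {1}(divz_eq z p) oddzD oddzM oddB andbT.
case: r => r1 r2; rewrite /coset_quo /parity !mxE /= !xpair_eqE.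
rewrite (pz (w ord0 ord0)) (pz (w ord_max ord0)).
by case: (oddz (w ord0 ord0 %/ p)%Z) (oddz (w ord0 ord0 %% p)%Z)
   (oddz (w ord_max ord0 %/ p)%Z) (oddz (w ord_max ord0 %% p)%Z) r1 r2
   => [] [] [] [] [] [].
Qed.

(** Put mass phi x = |ft (theta + x)|^2 on the points x of A^-1 L. Saturation of
L at A theta says that these masses, weighted by |mask (theta + x)|^2, add up
to 1. In each fibre of the residue modulo p the four possible weights have sum
1 and are bounded below. Taking one class c in every fibre yields an
orthogonal set, hence mass at most 1 by Bessel; selection_mass then gives full
mass to every such choice, and the parity class r is one of them. *)
Lemma class_set_saturated theta r : ~ intv (lattice_coord theta) ->
  saturated mu L (AR *m theta) -> saturated mu (class_set L r) theta.
Proof.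
move=> nt sat eps e0.
have [d /andP[d0 d1] hd] := coset_weight_bound nt.
have ed0 : 0 < eps * d by rewrite mulr_gt0.
have [s0 [us0 s0L hs0]] := sat _ ed0.
pose s := [seq invmx AR *m l | l <- s0].
have us : uniq s by rewrite map_inj_uniq //; exact: can_inj (mulKVmx unitA).
have sL x : x \in s -> L (AR *m x).
  by move=> /mapP[l ls ->]; rewrite mulKVmx //; exact: s0L.
pose W := floor_coord.
have sW x : x \in s -> lattice_coord x = int_mx R (W x).
  by move=> /sL/lattice_coord_int[w hw]; rewrite /W (floor_coordE hw).
pose phi x := sqmod (ft (theta + x)).
have tot : 1 - eps * d <= \sum_(x <- s)
    coset_weight theta (coset_res (W x)) (coset_quo (W x)) * phi x.
  apply: le_trans hs0 _; rewrite big_map le_eqVlt; apply/orP; left; apply/eqP.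
  rewrite big_seq [RHS]big_seq; apply: eq_bigr => l ls.
  have xs : invmx AR *m l \in s by exact: map_f.
  rewrite -(coset_weightE _ (sW _ xs)) -sqmodM -ft_rec mulmxDr mulKVmx //.
have bes (sigma : 'cV[int]_2 -> bool * bool) :
    \sum_(x <- s | coset_quo (W x) == sigma (coset_res (W x))) phi x <= 1.
  rewrite -big_filter; set t := (X in \sum_(_ <- X) _).
  apply: (@bessel _ _ _ [set x | x \in t]); [|exact: filter_uniq|by []].
  move=> x y /=; rewrite !mem_filter => /andP[/eqP cx xs] /andP[/eqP cy ys] xy.
  have [[v hv ov]|[//]] := difference_cases (sL _ xs) (sL _ ys) xy.
  exfalso; apply: ov.
  move: hv; rewrite lattice_coordB (sW _ xs) (sW _ ys) -int_mxB => /int_mx_inj hv.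
  have reseq : coset_res (W x) = coset_res (W y).
    apply/matrixP => i j; rewrite !mxE; have /(congr1 (fun Z : 'cV[int]_2 => Z i j)) := hv.
    rewrite !mxE => /eqP; rewrite subr_eq => /eqP ->.
    by rewrite mulrC modzMDl.
  have queq : coset_quo (W x) = coset_quo (W y) by rewrite cx cy reseq.
  have par : parity (W x) = parity (W y).
    by apply/eqP; rewrite parity_coset queq reseq -parity_coset.
  by apply: (evenmxZ_odd oddB); rewrite -hv; exact: parity_eq.
have := @selection_mass _ _ _ _ s (fun x => coset_res (W x)) (fun x => coset_quo (W x))
  phi (coset_weight theta) d (eps * d) _ _ (coset_weight_sum theta) _ bes tot
  (fun h => (oddz (h ord0 ord0) (+) r.1, oddz (h ord_max ord0) (+) r.2)).
rewrite mulfK ?gt_eqF // => /(_ _ _ _)/wrap[].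
- by move=> x; exact: sqmod_ge0.
- by rewrite d0.
- by move=> x c _; exact: hd.
move=> h; exists [seq x <- s | parity (W x) == r]; split.
- exact: filter_uniq.
- move=> x; rewrite mem_filter => /andP[/eqP pr xs]; split; first exact: sL.
  by exists (W x) => //; exact: sW.
- rewrite big_filter; apply: le_trans h _.
  by under [leRHS]eq_bigl do rewrite parity_coset.
Qed.

End Split.

Lemma saturated_nonempty L xi : saturated mu L xi -> exists l, L l.
Proof.
move=> /(_ (2^-1)) [|[|l s] [_ sL hs]]; first by rewrite invr_gt0.
  by move: hs; rewrite big_nil; lra.
by exists l; apply: sL; rewrite mem_head.
Qed.

Lemma not_intv_half y : ~ evenmx y -> ~ intv (2^-1 *: int_mx R (B *m y)).
Proof.
move=> oy [w hw]; apply: oy; apply: (evenmx_cancel oddB).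
have -> : B *m y = 2 *: w.
  by apply: int_mx_inj; rewrite [RHS]int_mxZ -hw scalerA divff // scale1r.
exact: evenmxZ2.
Qed.

(** If A is not even, choose y with A y not even and t = y / (4 p): neither t nor
A t has integral coordinates, so the splitting into parity classes can be
applied twice. It produces, for every parity r, a point g of coordinates w of
parity r such that A g lies in the even class; the coordinates of A g are
B A adj(B) w / p, so A adj(B) w is even for every parity of w. *)
Lemma spectrum_evenmx L : orthogonal_exponentials mu L ->
  (forall xi, saturated mu L xi) -> evenmx A.
Proof.
move=> oL sat; have [l0 Ll0] := saturated_nonempty (sat 0).
apply: contrapT => oddA.
have [y oAy] : exists y : 'cV[int]_2, ~ evenmx (A *m y).
  by apply: contrapT => /forallNP h; apply: oddA; apply: evenmx_vectors => v; exact: contrapT.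
have oy : ~ evenmx y by move=> h; apply: oAy; exact: evenmx_mul.
(* a translate of a spectrum is a spectrum, and it may contain 0 *)
pose L' := [set x | L (x + l0)].
have L'0 : L' 0 by rewrite /L' /= add0r.
have oL' : orthogonal_exponentials mu L'.
  move=> x z Lx Lz xz.
  have -> : x - z = (x + l0) - (z + l0) by rewrite opprD addrACA subrr addr0.
  by apply: oL => //; rewrite (inj_eq (addIr _)).
have sat' xi : saturated mu L' xi.
  move=> eps e0; have [s [us sL hs]] := sat (xi - l0) _ e0.
  exists [seq l - l0 | l <- s]; split.
  - by rewrite map_inj_uniq //; exact: addIr.
  - by move=> x /mapP[l ls ->]; rewrite /L' /= subrK; exact: sL.
  - by rewrite big_map; under eq_bigr do rewrite addrA addrAC.
pose t' : 'cV[R]_2 := (4 * p%:~R)^-1 *: int_mx R y.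
have p0 := p_neq0.
have lc (v : 'cV[int]_2) : lattice_coord ((4 * p%:~R)^-1 *: int_mx R v) = 2^-1 *: int_mx R (B *m v).
  rewrite /lattice_coord -scalemxAr scalerA int_mxM; congr (_ *: _).
  by field; exact: p0.
have At' : AR *m t' = (4 * p%:~R)^-1 *: int_mx R (A *m y).
  by rewrite /t' -scalemxAr int_mxM.
have n1 : ~ intv (lattice_coord (AR *m t')) by rewrite At' lc; exact: not_intv_half.
have n2 : ~ intv (lattice_coord t') by rewrite lc; exact: not_intv_half.
(* the even class, which contains 0 again *)
pose G := class_set L' (false, false).
have G0 : G 0.
  split; first by rewrite /= mulmx0.
  by exists 0; rewrite ?int_mx0 /lattice_coord ?mulmx0 ?scaler0 // /parity !mxE.
have oG : orthogonal_exponentials mu G by exact: class_set_orthogonal.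
have satG : saturated mu G (AR *m t') by apply: class_set_saturated.
apply: oddA; apply: evenmx_of_parities => v.
have [g [[_ [w2 hw2 p2]] [w hw pw]]] :=
  saturated_nonempty (class_set_saturated G0 oG (parity v) n2 satG).
have ew2 : evenmx w2.
  rewrite -[w2]subr0; apply: parity_eq; rewrite p2 /parity !mxE //.
have e : p *: w2 = B *m (A *m \adj B *m w).
  have hg : 2 *: (BR *m (p%:~R *: g)) = int_mx R w.
    by rewrite -hw /lattice_coord -scalemxAr scalerA.
  have := lattice_coord_iter 1 hg; rewrite !expr1 -[AR *m _]scalemxAr.
  rewrite /lattice_coord -scalemxAr scalerA mulrC -scalerA -/(lattice_coord _) hw2.
  by rewrite -int_mxZ !mulmxA => /int_mx_inj.
exists w => //; apply: (evenmx_cancel oddB).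
by rewrite -e -mul_scalar_mx; exact: evenmx_mul.
Qed.

End Necessity.

(** * Translates of the Fourier transform do not vanish *)

Section Nonvanishing.
Variables (R : realType) (mu : probability (borelRn R 2) R).
Variables (H B : 'M[int]_2).
Local Notation ft := (ft mu).
Local Notation A := (2 *: H).
Local Notation AR := (int_mx R A).
Local Notation HR := (int_mx R H).
Local Notation BR := (int_mx R B).
Local Notation p := (\det B).

(** The largest group of periods of the mask that is stable under H. *)
Definition lattice : set 'cV[R]_2 := [set x | forall i, intv (BR *m (HR ^+ i *m x))].

Lemma intvD (x y : 'cV[R]_2) : intv x -> intv y -> intv (x + y).
Proof. by move=> [v ->] [w ->]; exists (v + w); rewrite int_mxD. Qed.

Lemma intvZ (c : int) (x : 'cV[R]_2) : intv x -> intv (c%:~R *: x).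
Proof. by move=> [v ->]; exists (c *: v); rewrite int_mxZ. Qed.

Lemma intv_mul (X : 'M[int]_2) (x : 'cV[R]_2) : intv x -> intv (int_mx R X *m x).
Proof. by move=> [v ->]; exists (X *m v); rewrite int_mxM. Qed.

Lemma intvN (x : 'cV[R]_2) : intv x -> intv (- x).
Proof. by move=> /(intvZ (-1)); rewrite rmorphN1 scaleN1r. Qed.

Lemma latticeD x y : lattice x -> lattice y -> lattice (x + y).
Proof. by move=> hx hy i; rewrite !mulmxDr; exact: intvD. Qed.

Lemma latticeN x : lattice x -> lattice (- x).
Proof. by move=> hx i; rewrite !mulmxN; exact: intvN. Qed.

Lemma lattice_int v : lattice (int_mx R v).
Proof. by move=> i; rewrite -int_mxX; do 2 apply: intv_mul; exists v. Qed.

Lemma lattice_mulH x : lattice x -> lattice (HR *m x).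
Proof. by move=> hx i; rewrite [HR ^+ i *m _]mulmxA mulmxE -exprSr; exact: hx. Qed.

Lemma lattice_mulA x : lattice x -> lattice (AR *m x).
Proof.
move=> hx i; rewrite int_mxZ -scalemxAl -!scalemxAr.
by apply: intvZ; exact: lattice_mulH.
Qed.

Lemma lattice_mulAX x k : lattice x -> lattice (AR ^+ k *m x).
Proof.
move=> hx; elim: k => [|k IH]; first by rewrite mul1mx.
by rewrite exprS -mulmxE -mulmxA; exact: lattice_mulA.
Qed.

Lemma lattice_intv x : lattice x -> intv (BR *m x).
Proof. by move=> /(_ 0%N); rewrite expr0 mul1mx. Qed.

Lemma ord2P (i : 'I_2) : i = ord0 \/ i = ord_max.
Proof. by case: i => [[|[|k]] hk] //; [left|right]; apply: val_inj. Qed.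

Lemma sum_ord2 (V : nmodType) (F : 'I_2 -> V) : \sum_i F i = F ord0 + F ord_max.
Proof.
rewrite !big_ord_recl big_ord0 addr0; congr (_ + F _); exact: val_inj.
Qed.

(** Cayley-Hamilton in dimension 2. *)
Lemma square_recurrence (K : comNzRingType) (X : 'M[K]_2) : exists t d : K,
  X *m X = t *: X - d *: 1%:M.
Proof.
exists (X ord0 ord0 + X ord_max ord_max),
  (X ord0 ord0 * X ord_max ord_max - X ord0 ord_max * X ord_max ord0).
apply/matrixP => i j; rewrite !mxE sum_ord2.
by case: (ord2P i) (ord2P j) => -> [] ->; rewrite /= ?mulr1n ?mulr0n; ring.
Qed.

Lemma det_mx2 (K : comNzRingType) (X : 'M[K]_2) :
  \det X = X ord0 ord0 * X ord_max ord_max - X ord0 ord_max * X ord_max ord0.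
Proof.
rewrite (expand_det_row _ ord0) sum_ord2 /cofactor !det_mx11 !mxE /=.
have -> : lift ord0 (0 : 'I_1) = ord_max by exact: val_inj.
have -> : lift ord_max (0 : 'I_1) = ord0 :> 'I_2 by exact: val_inj.
by rewrite expr0 expr1; ring.
Qed.

Lemma adj_evenmx (X : 'M[int]_2) : evenmx (\adj X) -> evenmx X.
Proof.
have adjE : \adj X ord0 ord0 = X ord_max ord_max /\ \adj X ord_max ord_max = X ord0 ord0
  /\ \adj X ord0 ord_max = - X ord0 ord_max /\ \adj X ord_max ord0 = - X ord_max ord0.
  have l0 : lift ord0 (0 : 'I_1) = ord_max by exact: val_inj.
  have l1 : lift ord_max (0 : 'I_1) = ord0 :> 'I_2 by exact: val_inj.
  by rewrite !mxE /cofactor !det_mx11 !mxE !l0 !l1 /=; do !split; ring.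
move=> h i j; have := h ord0 ord0; have := h ord_max ord_max.
have := h ord0 ord_max; have := h ord_max ord0.
case: adjE => -> [-> [-> ->]]; rewrite !oddzN => ? ? ? ?.
by case: (ord2P i) (ord2P j) => -> [] ->.
Qed.

Hypothesis oddB : oddz p.
Hypothesis unitA : AR \in unitmx.
Hypothesis ft_rec : forall x, ft (AR *m x) = mask B x * ft x.
Hypothesis ft_zero : forall x, ft x = 0 ->
  exists k y, x = AR ^+ k.+1 *m y /\ mask B y = 0.

Let p0 : (p%:~R : R) != 0.
Proof. by rewrite intr_eq0 oddz_neq0. Qed.

Lemma unitH : HR \in unitmx.
Proof.
move: unitA; rewrite int_mxZ !unitmxE detZ unitrM => /andP[_].
by [].
Qed.

Lemma AR_exp k : AR ^+ k = 2%:~R ^+ k *: HR ^+ k.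
Proof. by rewrite int_mxZ exprZn. Qed.

(** Every zero is A^(j+1) y with 2 B y = v not even; multiply by p = B adj(B). *)
Lemma ft_zero_int x : ft x = 0 -> exists j v, ~ evenmx v /\
  p%:~R *: x = int_mx R (2 ^+ j *: (H ^+ j.+1 *m (\adj B *m v))).
Proof.
move=> /ft_zero[j [y [-> y0]]]; have [v hv ov] := mask_eq0 y0.
exists j, v; split => //.
rewrite AR_exp -scalemxAl int_mxZ !int_mxM int_mxX -hv.
rewrite -[int_mx R (\adj B) *m _]scalemxAr [int_mx R (\adj B) *m _]mulmxA.
rewrite -int_mxM mul_adj_mx int_mx_scalar mul_scalar_mx -!scalemxAr !scalerA.
congr (_ *: _); rewrite exprSr rmorphXn /=; ring.
Qed.

Lemma two_adic_unique j k (s t : 'cV[int]_2) : ~ evenmx s -> ~ evenmx t ->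
  2 ^+ j *: s = 2 ^+ k *: t -> j = k /\ s = t.
Proof.
have cancel2 (a b : 'cV[int]_2) : 2 *: a = 2 *: b -> a = b.
  move=> e; apply/matrixP => i l; apply: (mulfI (x := 2)) => //.
  by have /(congr1 (fun Z : 'cV[int]_2 => Z i l)) := e; rewrite !mxE.
elim: j k => [|j IH] [|k] os ot.
- by rewrite !expr0 !scale1r.
- rewrite expr0 scale1r exprS -scalerA => e; exfalso; apply: os; rewrite e; exact: evenmxZ2.
- rewrite expr0 scale1r exprS -scalerA => e; exfalso; apply: ot; rewrite -e; exact: evenmxZ2.
- by rewrite !exprS -!scalerA => /cancel2 /(IH _ os ot)[-> ->].
Qed.

(** A singular matrix modulo 2 is annihilated by its adjugate, or by 1 when it
vanishes. *)
Lemma even_det_kill : ~~ oddz (\det H) ->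
  exists N : 'M[int]_2, ~ evenmx N /\ evenmx (N *m H).
Proof.
move=> dH; case: (pselect (evenmx H)) => hH.
  exists 1%:M; rewrite mul1mx; split => // h.
  by have := h ord0 ord0; rewrite mxE.
exists (\adj H); split; first by move/adj_evenmx.
by rewrite mul_adj_mx => i j; rewrite mxE; case: (i == j); rewrite ?mulr1n ?mulr0n.
Qed.

(** (Z/2)^2 has three nonzero classes, so some e and e + z are both nonzero. *)
Lemma parity_avoid (t z : 'cV[int]_2) : ~ evenmx z ->
  exists u, ~ evenmx (t + p *: u) /\ ~ evenmx (t + p *: (u + z)).
Proof.
move=> oz.
have [e oe oez] : exists2 e : 'cV[int]_2, ~ evenmx e & ~ evenmx (e + z).
  case z0 : (oddz (z ord0 ord0)) => [].
    exists (col2 0 1).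
      by move=> /(_ ord_max ord0); rewrite mxE.
    by move=> /(_ ord0 ord0); rewrite !mxE /= add0r z0.
  exists (col2 1 0).
    by move=> /(_ ord0 ord0); rewrite mxE.
  by move=> /(_ ord0 ord0); rewrite !mxE /= oddzD z0.
have ev1 : evenmx ((1 - p) *: (t - e)).
  by move=> i j; rewrite mxE oddzM oddzD oddzN oddB.
have ev2 : evenmx ((p - 1) *: z).
  by move=> i j; rewrite mxE oddzM oddzD oddzN oddB.
exists (e - t); split => h.
- apply: oe; rewrite (_ : e = (t + p *: (e - t)) - (1 - p) *: (t - e)); last first.
    by apply/matrixP => i j; rewrite !mxE; ring.
  exact: evenmxB.
- apply: oez; rewrite (_ : e + z = (t + p *: (e - t + z)) - (1 - p) *: (t - e) - (p - 1) *: z).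
    by do 2 apply: evenmxB => //.
  by apply/matrixP => i j; rewrite !mxE; ring.
Qed.

Section Contradiction.
(** Assuming that the transform vanishes on x + Z^2, x is shown to be a period. *)
Variable x : 'cV[R]_2.
Hypothesis bad : forall v : 'cV[int]_2, ft (x + int_mx R v) = 0.

Lemma bad_int : exists u : 'cV[int]_2, p%:~R *: x = int_mx R u.
Proof.
have /ft_zero_int[j [v [_ e]]] := bad 0.
by rewrite int_mx0 addr0 in e; eexists; exact: e.
Qed.

Lemma bad_rep u : p%:~R *: x = int_mx R u -> forall k, exists j v, ~ evenmx v /\
  u + p *: k = 2 ^+ j *: (H ^+ j.+1 *m (\adj B *m v)).
Proof.
move=> hu k; have /ft_zero_int[j [v [ov e]]] := bad k.
exists j, v; split => //; apply: (@int_mx_inj R); rewrite -e.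
by rewrite int_mxD int_mxZ scalerDr hu.
Qed.

(** If det H is even, a matrix N that is nonzero modulo 2 kills H modulo 2, hence
every u + p k, and therefore every integer vector since p is odd. *)
Lemma bad_odd_det : oddz (\det H).
Proof.
apply: contrapT => /negP /even_det_kill[N [oN eN]]; apply: oN.
have [u hu] := bad_int.
have ev k : evenmx (N *m (u + p *: k)).
  have [j [v [_ ->]]] := bad_rep hu k.
  rewrite -scalemxAr exprS -mulmxE -[H *m _ *m _]mulmxA [N *m _]mulmxA.
  by apply: evenmxZ; exact: evenmx_mulr.
apply: evenmx_vectors => k; apply: (evenmxZ_odd oddB).
have -> : p *: (N *m k) = N *m (u + p *: k) - N *m (u + p *: 0).
  by rewrite scaler0 addr0 mulmxDr addrAC subrr add0r scalemxAr.
exact: evenmxB.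
Qed.

Lemma not_evenmx_core j (v : 'cV[int]_2) : ~ evenmx v -> ~ evenmx (H ^+ j *m (\adj B *m v)).
Proof.
move=> ov h; apply: ov.
apply: (evenmx_cancel (oddz_det_adj oddB)).
elim: j h => [|j IH]; first by rewrite mul1mx.
by rewrite exprS -mulmxE -mulmxA => /(evenmx_cancel bad_odd_det).
Qed.

(** As p is odd, u + p k can be made divisible by any power of 2. *)
Lemma bad_level u j : p%:~R *: x = int_mx R u ->
  exists k t, u + p *: k = 2 ^+ j *: t.
Proof.
move=> hu; elim: j => [|j [k [t e]]]; first by exists 0, u; rewrite scaler0 addr0 expr0 scale1r.
have [t' ht'] : exists t', t + p *: t = 2 *: t'.
  apply: evenmxP => i l; rewrite !mxE oddzD oddzM oddB /=.
  by rewrite addbb.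
exists (k + 2 ^+ j *: t), t'.
by rewrite scalerDr addrA e exprSr -scalerA -ht' scalerDr !scalerA [p * _]mulrC.
Qed.

(** Modulo p Z^2 the vector p x has representatives 2^j t with t not even. For
them the exponent in bad_rep is exactly j, because H^(j+1) adj(B) v is not
even, so H^-(j+1) can be applied to t. The difference of two representatives
gives the statement for integer vectors, and a single one gives it for x. *)
Lemma bad_integral j : (forall z : 'cV[int]_2, intv (BR *m (invmx HR ^+ j.+1 *m int_mx R z)))
  /\ intv (BR *m (invmx HR ^+ j.+1 *m x)).
Proof.
have [u hu] := bad_int; have [k0 [t0 e0]] := bad_level j hu.
have odd_rep z : ~ evenmx (t0 + p *: z) -> exists v,
    t0 + p *: z = H ^+ j.+1 *m (\adj B *m v).
  move=> o; have [j' [v [ov e]]] := bad_rep hu (k0 + 2 ^+ j *: z).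
  have e' : 2 ^+ j *: (t0 + p *: z) = 2 ^+ j' *: (H ^+ j'.+1 *m (\adj B *m v)).
    by rewrite -e scalerDr -e0 scalerDr addrA !scalerA mulrC.
  have [jj ->] := two_adic_unique o (@not_evenmx_core j'.+1 _ ov) e'.
  by exists v; rewrite jj.
have invHX : invmx HR ^+ j.+1 *m HR ^+ j.+1 = 1%:M.
  elim: j.+1 => [|i IH]; first by rewrite !expr0 mul1mx.
  by rewrite exprSr exprS -!mulmxE -mulmxA [invmx HR *m _]mulmxA mulVmx ?unitH // mul1mx.
have back (y : 'cV[R]_2) v : p%:~R *: y = int_mx R (H ^+ j.+1 *m (\adj B *m v)) ->
    BR *m (invmx HR ^+ j.+1 *m y) = int_mx R v.
  move=> e; apply: (scalerI p0); rewrite !scalemxAr e !int_mxM int_mxX.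
  rewrite [invmx HR ^+ _ *m _]mulmxA invHX mul1mx mulmxA -int_mxM mul_mx_adj.
  by rewrite int_mx_scalar mul_scalar_mx.
have zint z : intv (BR *m (invmx HR ^+ j.+1 *m int_mx R z)).
  have odd_case z' : ~ evenmx z' -> intv (BR *m (invmx HR ^+ j.+1 *m int_mx R z')).
    move=> oz; have [w [/odd_rep[v1 e1] /odd_rep[v2 e2]]] := parity_avoid t0 oz.
    exists (v2 - v1); apply: back; rewrite -int_mxZ; congr int_mx.
    by rewrite !mulmxBr -e1 -e2 scalerDr opprD addrACA addrA subrr add0r addrAC subrr add0r.
  case: (pselect (evenmx z)) => [ez|]; last exact: odd_case.
  have o1 : ~ evenmx (col2 (1 : int) 0) by move=> /(_ ord0 ord0); rewrite mxE.
  have -> : z = col2 1 0 + (z - col2 1 0) by rewrite addrC subrK.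
  rewrite int_mxD !mulmxDr; apply: intvD; apply: odd_case => //.
  by move=> h; apply: o1; rewrite -[col2 1 0](subKr z); exact: evenmxB.
split => //.
have o1 : ~ evenmx (col2 (1 : int) 0) by move=> /(_ ord0 ord0); rewrite mxE.
have [w [/odd_rep[v e] _]] := parity_avoid t0 o1.
pose k := k0 + 2 ^+ j *: w.
have -> : x = (x + int_mx R k) + (-1)%:~R *: int_mx R k.
  by rewrite rmorphN1 scaleN1r addrK.
rewrite !mulmxDr -!scalemxAr; apply: intvD; last exact: intvZ.
rewrite -!mulmxDr; exists (2 ^+ j *: v); apply: back.
rewrite scalerDr hu -int_mxZ -int_mxD; congr int_mx.
by rewrite -!scalemxAr -e scalerDr addrA e0 scalerDr !scalerA mulrC.
Qed.

(** The vectors B H^i x satisfy a recurrence of order two with integral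
coefficients, so two consecutive integral terms, here the indices -2 and -1,
propagate integrality to all i. *)
Lemma bad_lattice : lattice x.
Proof.
have [t [d HH]] := square_recurrence H.
have HHR : HR *m HR = t%:~R *: HR - d%:~R *: 1%:M.
  by rewrite -int_mxM HH int_mxB !int_mxZ int_mx_scalar.
pose y := invmx HR ^+ 2 *m x.
have Hy : HR *m y = invmx HR ^+ 1 *m x.
  by rewrite /y expr1 expr2 -mulmxE -mulmxA mulKVmx ?unitH.
have HHy : HR *m (HR *m y) = x by rewrite Hy expr1 mulKVmx ?unitH.
have c i : intv (BR *m (HR ^+ i *m y)) /\ intv (BR *m (HR ^+ i.+1 *m y)).
  elim: i => [|i [IH1 IH2]].
    rewrite expr0 mul1mx expr1 Hy.
    by split; [exact: (bad_integral 1).2 | exact: (bad_integral 0).2].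
  split => //.
  have -> : HR ^+ i.+2 *m y = t%:~R *: (HR ^+ i.+1 *m y) + (- d)%:~R *: (HR ^+ i *m y).
    rewrite !exprSr -!mulmxE -[HR ^+ i *m HR *m HR]mulmxA HHR mulmxBr -!scalemxAr mulmx1.
    by rewrite mulmxBl -!scalemxAl rmorphN scaleNr.
  by rewrite mulmxDr -!scalemxAr; apply: intvD; exact: intvZ.
move=> i; rewrite -HHy [HR ^+ i *m _]mulmxA mulmxE -exprSr.
by rewrite [HR ^+ _ *m _]mulmxA mulmxE -exprSr; exact: (c i.+2).1.
Qed.

End Contradiction.

(** If the transform vanished on x plus the periods, x would itself be a period,
and then the transform would vanish at x - x = 0, where it is 1. *)
Lemma ft_nonvanishing x : exists2 k, lattice k & ft (x + k) != 0.
Proof.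
apply: contrapT => h.
have bad k : lattice k -> ft (x + k) = 0.
  by move=> hk; apply/eqP; apply: contrapT => /negP nz; apply: h; exists k.
have lx : lattice x by apply: bad_lattice => v; apply: bad; exact: lattice_int.
have := bad _ (latticeN lx); rewrite subrr ft0 => /eqP.
by rewrite oner_eq0.
Qed.

End Nonvanishing.

(** * Zeros of the Fourier transform *)

Section NearZero.
Variables (R : realType) (mu : probability (borelRn R 2) R).
Local Notation ft := (ft mu).
Local Notation normc := ComplexField.Normc.normc.
Variable C : R.
Hypothesis C0 : 0 <= C.
Hypothesis ft_lip : forall x y, normc (ft x - ft y) <= C * `|x - y|.

Definition sq (x : 'cV[R]_2) : R := sqmod (ft x).

Lemma sq_ge0 x : 0 <= sq x. Proof. exact: sqmod_ge0. Qed.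

Lemma sq_le1 x : sq x <= 1. Proof. exact: sqmod_ft_le1. Qed.

Lemma normc_ft_lip x y : normc (ft x) <= normc (ft y) + C * `|x - y|.
Proof.
rewrite -{1}(subrK (ft y) (ft x)) addrC.
by apply: le_trans (le_normcD _ _) _; rewrite lerD2l.
Qed.

Lemma sq_near0 eps : 0 < eps -> exists2 d : R, 0 < d & forall y, `|y| <= d -> 1 - eps <= sq y.
Proof.
move=> e0; have c2 : 0 < 2 * C + 1 by rewrite ltr_wpDl // mulr_ge0.
(* |ft y| >= 1 - C |y| gives |ft y|^2 >= 1 - 2 C |y| *)
exists (eps / (2 * C + 1)); first exact: divr_gt0.
move=> y hy; have := normc_ft_lip 0 y; rewrite ft0 sub0r normrN => h.
have n1 : normc (1 : R[i]) = 1 by rewrite -[1 in LHS]expi2pi0 normc_expi2pi.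
rewrite n1 in h; rewrite /sq sqmod_normc.
have h2 : (2 * C + 1) * `|y| <= eps by rewrite mulrC -ler_pdivlMr.
have y0 : 0 <= `|y| by [].
have := normc_ge0 (ft y); move: (normc (ft y)) (`|y|) h h2 y0 => a b h h2 y0 a0.
have : 1 - 2 * (C * b) <= a ^+ 2.
  have [|] := leP (C * b) 1 => hb; last by have := sqr_ge0 a; lra.
  have h3 : 0 <= (1 - C * b) by lra.
  have : (1 - C * b) ^+ 2 <= a ^+ 2 by rewrite lerXn2r ?nnegrE //; lra.
  by have := sqr_ge0 (C * b); rewrite !expr2; lra.
by lra.
Qed.

End NearZero.

Section Contraction.
Variables (R : realType) (N : 'M[R]_2) (K rho : R).
Hypotheses (K0 : 0 <= K) (rho01 : 0 < rho < 1).
Hypothesis decay : forall k, `|N ^+ k| <= K * rho ^+ k.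

Lemma decay_mul k (x : 'cV[R]_2) : `|N ^+ k *m x| <= 2 * K * `|x| * rho ^+ k.
Proof.
apply: le_trans (mx_norm_mulmx _ _) _.
have -> : 2 * K * `|x| * rho ^+ k = 2%:R * (K * rho ^+ k) * `|x| by ring.
by rewrite ler_wpM2r // ler_wpM2l.
Qed.

Lemma eventually_small (s : seq 'cV[R]_2) d : 0 < d ->
  exists k0, forall k x, (k0 <= k)%N -> x \in s -> `|N ^+ k *m x| <= d.
Proof.
move=> d0; have /andP[r0 r1] := rho01.
have one (x : 'cV[R]_2) : exists k0, forall k, (k0 <= k)%N -> `|N ^+ k *m x| <= d.
  pose c := 2 * K * `|x| + 1.
  have c0 : 0 < c by rewrite ltr_wpDl // !mulr_ge0.
  have rn : `|rho| < 1 by rewrite gtr0_norm.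
  have /cvgrPdist_le/(_ _ (divr_gt0 d0 c0)) [k0 _ hk] := cvg_expr rn.
  exists k0 => k kk; have := hk k kk; rewrite /= sub0r normrN ger0_norm ?exprn_ge0 ?(ltW r0) //.
  rewrite ler_pdivlMr // => h; apply: le_trans (decay_mul _ _) _; apply: le_trans h.
  by rewrite mulrC ler_wpM2l ?exprn_ge0 ?(ltW r0) // lerDl.
elim: s => [|x s [k1 IH]]; first by exists 0%N.
have [k2 h2] := one x; exists (maxn k1 k2) => k y; rewrite geq_max => /andP[l1 l2].
by rewrite inE => /predU1P[->|ys]; [exact: h2 | exact: IH].
Qed.

End Contraction.

Section ZeroSet.
Variables (R : realType) (mu : probability (borelRn R 2) R) (A B : 'M[int]_2).
Local Notation ft := (ft mu).
Local Notation AR := (int_mx R A).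
Local Notation N := (invmx AR).
Local Notation normc := ComplexField.Normc.normc.
Hypothesis unitA : AR \in unitmx.
Hypothesis ft_rec : forall x, ft (AR *m x) = mask B x * ft x.
Variable C : R.
Hypothesis C0 : 0 <= C.
Hypothesis ft_lip : forall x y, normc (ft x - ft y) <= C * `|x - y|.
Variables (K rho : R).
Hypotheses (K0 : 0 <= K) (rho01 : 0 < rho < 1).
Hypothesis decay : forall k, `|N ^+ k| <= K * rho ^+ k.

(** Iterating the functional equation, a zero at which no factor vanishes
propagates to A^-k x for all k, which tend to 0 where the transform is 1. *)
Lemma ft_eq0_mask x : ft x = 0 ->
  exists k y, x = AR ^+ k.+1 *m y /\ mask B y = 0.
Proof.
move=> x0; apply: contrapT => h.
have AN k : AR ^+ k *m (N ^+ k *m x) = x.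
  elim: k => [|k IH]; first by rewrite !expr0 !mul1mx.
  by rewrite exprSr exprS -!mulmxE -!mulmxA mulKVmx.
have nz k : mask B (N ^+ k.+1 *m x) != 0.
  apply/eqP => m0; apply: h; exists k, (N ^+ k.+1 *m x).
  by split => //; rewrite AN.
have z k : ft (N ^+ k *m x) = 0.
  elim: k => [|k IH]; first by rewrite mul1mx.
  apply: (mulfI (nz k)); rewrite mulr0 -ft_rec exprS -mulmxE -mulmxA mulKVmx //.
have h2 : 0 < (2^-1 : R) by rewrite invr_gt0.
have [d d0 hd] := sq_near0 C0 ft_lip h2.
have [k hk] := eventually_small K0 rho01 decay [:: x] d0.
have := hd _ (hk k x (leqnn k) (mem_head _ _)); rewrite /sq z sqmod0.
by lra.
Qed.

End ZeroSet.

(** * Construction of a spectrum *)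

Section Sufficiency.
Variables (R : realType) (mu : probability (borelRn R 2) R).
Variables (H B : 'M[int]_2).
Local Notation ft := (ft mu).
Local Notation A := (2 *: H).
Local Notation AR := (int_mx R A).
Local Notation HR := (int_mx R H).
Local Notation BR := (int_mx R B).
Local Notation p := (\det B).
Local Notation N := (invmx AR).
Local Notation lattice := (lattice H B).
Local Notation normc := ComplexField.Normc.normc.

Hypothesis oddB : oddz p.
Hypothesis unitA : AR \in unitmx.
Hypothesis ft_rec : forall x, ft (AR *m x) = mask B x * ft x.
Hypothesis ft_zero : forall x, ft x = 0 ->
  exists k y, x = AR ^+ k.+1 *m y /\ mask B y = 0.
Variable C : R.
Hypothesis C0 : 0 <= C.
Hypothesis ft_lip : forall x y, normc (ft x - ft y) <= C * `|x - y|.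
Variables (K rho : R).
Hypotheses (K0 : 0 <= K) (rho01 : 0 < rho < 1).
Hypothesis decay : forall k, `|N ^+ k| <= K * rho ^+ k.

Local Notation sq := (sq mu).

Lemma compact_box : compact [set x : 'cV[R]_2 | `|x| <= 1].
Proof. by apply: compact_norm_ball. Qed.

(** By the Lipschitz bound a period that works at x works near x, with half the
lower bound; then use compactness of the unit box. *)
Lemma uniform_lower_bound_box : exists2 e : R, 0 < e &
  forall x : 'cV[R]_2, `|x| <= 1 -> exists2 k, lattice k & e <= normc (ft (x + k)).
Proof.
pose P (e : R) (x : 'cV[R]_2) := exists2 k, lattice k & e <= normc (ft (x + k)).
have nc : near_covering [set x : 'cV[R]_2 | `|x| <= 1].
  by apply/compact_near_coveringP; exact: compact_box.
have h : \forall e \near (0 : R)^'+, [set x : 'cV[R]_2 | `|x| <= 1] `<=` P e.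
  apply: nc => x _.
  have [k kl nz] := ft_nonvanishing oddB unitA ft_zero x.
  have a0 : 0 < normc (ft (x + k)).
    rewrite lt_neqAle normc_ge0 andbT eq_sym.
    by apply: contra nz => /eqP /ComplexField.Normc.eq0_normc ->.
  set a := normc _ in a0.
  have c1 : 0 < 2 * (C + 1) by rewrite mulr_gt0 // ltr_wpDl.
  near=> y e; exists k => //.
  have := normc_ft_lip ft_lip (x + k) (y + k); rewrite -/a opprD addrACA subrr addr0 => h.
  have ya : `|x - y| <= a / (2 * (C + 1)).
    near: y; apply: (@cvgr_dist_le _ _ _ _ (nbhs_filter x) id x); first exact: cvg_id.
    exact: divr_gt0.
  have ea : e <= a / 2 by near: e; apply: nbhs_right_le; exact: divr_gt0.
  have h2 : C * `|x - y| <= a / 2.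
    apply: le_trans (_ : (C + 1) * `|x - y| <= _).
      by rewrite ler_wpM2r // lerDl.
    by rewrite -ler_pdivlMl ?ltr_wpDl // (le_trans ya) // invfM mulrA mulrC.
  by change (e <= normc (ft (y + k))); lra.
have h2 : \forall e \near (0 : R)^'+, 0 < e by exact: nbhs_right_gt.
have [e [he e0]] : exists e : R, ([set x : 'cV[R]_2 | `|x| <= 1] `<=` P e) /\ 0 < e.
  by apply: (@filter_ex _ ((0 : R)^'+)); exact: (@filterI _ ((0 : R)^'+)).
by exists e.
Unshelve. all: by end_near. Qed.

(** Integer translations reduce to the unit box, and 0 keeps its own period 0 so
that points already chosen are not moved when the spectrum grows. *)
Lemma uniform_lower_bound : exists (c d : R) (k : 'cV[R]_2 -> 'cV[R]_2),
  [/\ 0 < c, 0 < d, k 0 = 0, forall x, lattice (k x) &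
      forall x y, `|y| <= d -> c <= sq (x + k x + y)].
Proof.
have [e1 e10 h1] := uniform_lower_bound_box.
pose e := Num.min e1 1.
have e0 : 0 < e by rewrite lt_min e10 ltr01.
have all_x x : exists2 k, lattice k & e <= normc (ft (x + k)).
  pose f : 'cV[int]_2 := map_mx Num.floor x.
  have [|k kl hk] := h1 (x - int_mx R f).
    apply: mx_norm_le => // i j; rewrite !mxE ger0_norm ?subr_ge0 ?floor_le //.
    by rewrite lerBlDl -[X in _ <= _ + X]/(1%:~R) -intrD ltW // lt_succ_floor.
  exists (k - int_mx R f).
    by apply: latticeD => //; apply: latticeN; exact: lattice_int.
  by rewrite addrA addrAC (le_trans _ hk) // ge_min lexx.
have ex x : exists k, lattice k /\ (e <= normc (ft (x + k)) /\ (x = 0 -> k = 0)).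
  have [->|x0] := eqVneq x 0.
    exists 0; split; first by rewrite -(int_mx0 R); exact: lattice_int.
    rewrite addr0 ft0 -[1]expi2pi0 normc_expi2pi; split => //.
    by rewrite ge_min lexx orbT.
  by have [k kl hk] := all_x x; exists k; split => //; split => // x00; rewrite x00 eqxx in x0.
have [k hk] := boolp.choice ex.
have c1 : 0 < 2 * (C + 1) by rewrite mulr_gt0 // ltr_wpDl.
exists ((e / 2) ^+ 2), (e / (2 * (C + 1))), k; split.
- by rewrite exprn_gt0 // divr_gt0.
- exact: divr_gt0.
- exact: (hk 0).2.2.
- by move=> x; exact: (hk x).1.
move=> x y hy; rewrite /sq sqmod_normc lerXn2r ?nnegrE ?normc_ge0 ?divr_ge0 ?(ltW e0) //.
have := normc_ft_lip ft_lip (x + k x) (x + k x + y).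
rewrite opprD addrA subrr sub0r normrN => h.
have h2 : C * `|y| <= e / 2.
  apply: le_trans (_ : (C + 1) * `|y| <= _).
    by rewrite ler_wpM2r // lerDl.
  by rewrite -ler_pdivlMl ?ltr_wpDl // (le_trans hy) // invfM mulrA mulrC.
by have := (hk x).2.1; lra.
Qed.

Definition weight (x : 'cV[R]_2) : R := sqmod (mask B x).

(** The product of the squared masks at A^-1 x, ..., A^-n x. *)
Fixpoint level_weight n (x : 'cV[R]_2) : R :=
  if n is m.+1 then weight (N *m x) * level_weight m (N *m x) else 1.

Lemma level_weight_ge0 n x : 0 <= level_weight n x.
Proof. by elim: n x => //= n IH x; rewrite mulr_ge0 // sqmod_ge0. Qed.

Lemma level_weight0 n : level_weight n 0 = 1.
Proof.
elim: n => //= n IH; rewrite mulmx0 IH mulr1 /weight /mask mulmx0 !mxE.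
by rewrite tetra_mask0 sqmod1.
Qed.

Lemma sq_level n x : sq x = level_weight n x * sq (N ^+ n *m x).
Proof.
elim: n x => [|n IH] x; first by rewrite /= mul1r mul1mx.
rewrite /= -mulrA exprSr -mulmxE -mulmxA -IH /weight /sq -sqmodM -ft_rec.
by rewrite mulKVmx.
Qed.

Lemma level_weight_add n m x :
  level_weight (n + m) x = level_weight n x * level_weight m (N ^+ n *m x).
Proof.
elim: n x => [|n IH] x; first by rewrite /= mul1r mul1mx.
by rewrite addSn /= IH mulrA exprSr -mulmxE -mulmxA.
Qed.

Lemma sq_le_level n x : sq x <= level_weight n x.
Proof. by rewrite (sq_level n) ler_piMr ?level_weight_ge0 // sq_le1. Qed.

Lemma weight_periodic x l : lattice l -> weight (x + l) = weight x.
Proof. by move=> /lattice_intv h; rewrite /weight mask_periodic. Qed.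

Lemma level_weight_periodic n x l : lattice l ->
  level_weight n (x + AR ^+ n *m l) = level_weight n x.
Proof.
move=> hl; elim: n x => [|n IH] x //=.
rewrite mulmxDr exprS -mulmxE -mulmxA mulKmx // IH weight_periodic //.
exact: lattice_mulAX.
Qed.

Definition half_digits : seq 'cV[R]_2 :=
  [seq int_mx R v | v <- [:: 0; col2 1 0; col2 0 1; col2 1 1]].

Lemma weight_half x v : weight (x + 2^-1 *: int_mx R v) = sqmod (tetra_mask
  ((BR *m x) ord0 ord0 + bit R (oddz ((B *m v) ord0 ord0)))
  ((BR *m x) ord_max ord0 + bit R (oddz ((B *m v) ord_max ord0)))).
Proof.
have hB i : (BR *m (2^-1 *: int_mx R v)) i ord0 =
    bit R (oddz ((B *m v) i ord0)) + ((B *m v) i ord0 %/ 2)%Z%:~R.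
  rewrite -scalemxAr -int_mxM [LHS]mxE [X in _ * X]mxE; set w := (B *m v) i ord0.
  rewrite {1}(divz_eq w 2) modz2E intrD intrM /bit.
  by case: (oddz _) => /=; field.
rewrite /weight /mask mulmxDr [X in tetra_mask X]mxE [X in tetra_mask _ X]mxE !hB.
by rewrite !addrA tetra_mask_int.
Qed.

(** As v runs over (Z/2)^2 so does B v, since det B is odd; this is the partition
of unity for the mask. *)
Lemma weight_half_sum x : \sum_(t <- half_digits) weight (x + 2^-1 *: t) = 1.
Proof.
rewrite /half_digits big_map !big_cons big_nil addr0 !weight_half.
have e (a b : int) i : (B *m col2 a b) i ord0 = B i ord0 * a + B i ord_max * b.
  by rewrite mxE sum_ord2 !mxE.
have dB := oddB; rewrite det_mx2 oddzD oddzN !oddzM in dB.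
have z i : (B *m (0 : 'cV_2)) i ord0 = 0 by rewrite mulmx0 mxE.
rewrite !z !e !mulr0 !mulr1 !addr0 !add0r !oddzD.
rewrite -[RHS](sum_tetra_mask ((BR *m x) ord0 ord0) ((BR *m x) ord_max ord0)).
move: ((BR *m x) ord0 ord0) ((BR *m x) ord_max ord0) => a b; move: dB.
have -> : oddz 0 = false by [].
by case: (oddz (B ord0 ord0)) (oddz (B ord_max ord_max)) (oddz (B ord0 ord_max))
  (oddz (B ord_max ord0)) => [] [] [] [] //= _;
  rewrite /bit /= ?mul0r ?mul1r ?addr0; ring.
Qed.

(** The sums of A^i H t_i for i < m with t_i in {0, 1}^2, the
frequencies dual to the first m levels of digits. *)
Fixpoint digit_sums m : seq 'cV[R]_2 :=
  if m is k.+1 then [seq HR *m t + AR *m e | t <- half_digits, e <- digit_sums k]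
  else [:: 0].

Lemma half_digits_int t : t \in half_digits -> exists v, t = int_mx R v.
Proof. by move=> /mapP[v _ ->]; exists v. Qed.

Lemma mem0_half_digits : 0 \in half_digits.
Proof. by apply/mapP; exists 0; rewrite ?mem_head ?int_mx0. Qed.

Lemma digit_sumsS m : digit_sums m.+1 =
  [seq HR *m t + AR *m e | t <- half_digits, e <- digit_sums m].
Proof. by []. Qed.

Lemma digit_sums_lattice m e : e \in digit_sums m -> lattice e.
Proof.
elim: m e => [|m IH] e.
  by rewrite inE => /eqP ->; rewrite -(int_mx0 R); exact: lattice_int.
rewrite digit_sumsS => /allpairsP[[t e'] [/= /half_digits_int[v ->] he ->]].
apply: latticeD; first by apply: lattice_mulH; exact: lattice_int.
by apply: lattice_mulA; exact: IH.
Qed.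

Lemma digit_sums0 m : 0 \in digit_sums m.
Proof.
elim: m => [|m IH]; first by rewrite mem_head.
rewrite digit_sumsS; apply/allpairsP; exists (0, 0).
by rewrite /= IH mem0_half_digits !mulmx0 addr0.
Qed.

Lemma invA_H (t : 'cV[R]_2) : N *m (HR *m t) = 2^-1 *: t.
Proof.
have -> : HR *m t = AR *m (2^-1 *: t).
  by rewrite int_mxZ -scalemxAl -scalemxAr scalerA divff ?scale1r // intr_eq0.
by rewrite mulKmx.
Qed.

Lemma digit_sums_level m x : \sum_(e <- digit_sums m) level_weight m (x + e) = 1.
Proof.
elim: m x => [|m IH] x; first by rewrite big_seq1.
rewrite digit_sumsS big_allpairs_dep /=.
rewrite -[RHS](weight_half_sum (N *m x)); apply: eq_bigr => t _.
transitivity (weight (N *m x + 2^-1 *: t) *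
    \sum_(e <- digit_sums m) level_weight m (N *m x + 2^-1 *: t + e)); last by rewrite IH mulr1.
rewrite mulr_sumr.
rewrite big_seq [RHS]big_seq; apply: eq_bigr => e he.
rewrite !mulmxDr invA_H mulKmx // !addrA; congr (_ * _).
by rewrite weight_periodic //; exact: digit_sums_lattice he.
Qed.

Definition full_level n (F : seq 'cV[R]_2) : Prop :=
  forall x, \sum_(l <- F) level_weight n (x + l) = 1.

(** Evaluate the partition of unity at x = - l: the term of l equals 1, so all
other terms vanish. In particular l does not occur twice. *)
Lemma full_level_orthogonal n F : full_level n F -> uniq F /\
  forall l m, l \in F -> m \in F -> l != m -> level_weight n (m - l) = 0.
Proof.
move=> hF.
have z l : l \in F -> forall m, m \in rem l F -> level_weight n (m - l) = 0.
  move=> lF; have := hF (- l); rewrite (perm_big _ (perm_to_rem lF)) big_cons.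
  rewrite addNr level_weight0 -[RHS]addr0 => /addrI /eqP.
  rewrite psumr_eq0; last by move=> i _; exact: level_weight_ge0.
  by move=> /allP h m /h /eqP; rewrite addrC.
split.
  have nr l : l \in F -> l \notin rem l F.
    move=> lF; apply/negP => /(z _ lF); rewrite subrr level_weight0 => /eqP.
    by rewrite oner_eq0.
  elim: F nr {hF z} => //= a F IH nr.
  have aF : a \notin F by have := nr a (mem_head _ _); rewrite eqxx.
  rewrite aF; apply: IH => l lF.
  have al : (a == l) = false by apply: contraNF aF => /eqP ->.
  by have := nr l; rewrite inE lF orbT al inE negb_or => /(_ isT) /andP[].
move=> l m lF mF lm; apply: (z l lF).
have := perm_mem (perm_to_rem lF) m.
by rewrite mF inE eq_sym (negbTE lm) => /esym.
Qed.

(** A level n and a finite set F on which the n-th weights form a partition of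
unity are enlarged to a deeper level. The digits that are added are moved by
periods so that the transform stays bounded below at A^-n l for l in F. *)
Section Chain.
Variables (c d : R) (kappa : 'cV[R]_2 -> 'cV[R]_2).
Hypotheses (c0 : 0 < c) (d0 : 0 < d) (kappa0 : kappa 0 = 0).
Hypothesis kappaL : forall x, lattice (kappa x).
Hypothesis kappa_bound : forall x y, `|y| <= d -> c <= sq (x + kappa x + y).

Definition good (P : nat * seq 'cV[R]_2) : Prop := full_level P.1 P.2 /\
  forall l y, l \in P.2 -> `|y| <= d / 2 -> c <= sq (N ^+ P.1 *m l + y).

Lemma good_start : good (0%N, [:: 0]).
Proof.
split; first by move=> x; rewrite big_seq1.
move=> l y; rewrite inE => /eqP -> hy; rewrite mulmx0 add0r.
have := @kappa_bound 0 y; rewrite kappa0 !add0r; apply.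
by rewrite (le_trans hy) // ler_pdivrMr // ler_peMr ?(ltW d0) // ler1n.
Qed.

Lemma good_step P : good P -> exists Q,
  [/\ good Q, (P.1 < Q.1)%N & {subset P.2 <= Q.2}].
Proof.
case: P => n F [/= fF bF].
have d2 : 0 < d / 2 by rewrite divr_gt0.
have [k0 hk] := eventually_small K0 rho01 decay [seq N ^+ n *m l | l <- F] d2.
pose m := k0.+1.
(* kappa moves A^-m e to a place where the transform is bounded below *)
pose tail e := e + AR ^+ m *m kappa (N ^+ m *m e).
have NA k (x : 'cV[R]_2) : N ^+ k *m (AR ^+ k *m x) = x.
  elim: k x => [|k IH] x; first by rewrite !expr0 !mul1mx.
  by rewrite exprSr exprS -!mulmxE -!mulmxA mulKmx.
have tailL e : e \in digit_sums m -> lattice (tail e).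
  move=> he; apply: latticeD; first exact: digit_sums_lattice he.
  exact: lattice_mulAX.
exists ((n + m)%N, [seq l + AR ^+ n *m tail e | l <- F, e <- digit_sums m]); split.
- split; rewrite ![(_, _).1]/= ![(_, _).2]/=.
    move=> x; rewrite big_allpairs_dep /= -[RHS](fF x); apply: eq_bigr => l _.
    rewrite -[RHS]mulr1 -(digit_sums_level m (N ^+ n *m (x + l))) mulr_sumr.
    rewrite big_seq [RHS]big_seq; apply: eq_bigr => e he.
    rewrite addrA level_weight_add level_weight_periodic; last exact: tailL.
    by rewrite mulmxDr NA /tail addrA level_weight_periodic.
  move=> _ y /allpairsP[[l e] [lF he ->]] hy.
  rewrite [(_, _).1]/= in lF *; rewrite [(_, _).2]/= in he *.
  rewrite addnC exprD -mulmxE -mulmxA [N ^+ n *m (_ + _)]mulmxDr NA mulmxDr.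
  rewrite [N ^+ m *m tail e]mulmxDr NA -addrA addrC -addrA.
  apply: kappa_bound; apply: le_trans (ler_normD _ _) _.
  have h1 : `|N ^+ m *m (N ^+ n *m l)| <= d / 2.
    by apply: hk; [rewrite /m | apply: map_f].
  by rewrite [leRHS](splitr d) lerD.
- by rewrite [X in (X < _)%N]/= [X in (_ < X)%N]/= /m addnS ltnS leq_addr.
- move=> l lF; apply/allpairsP; exists (l, 0); split => //; first exact: (digit_sums0 m).
  rewrite ![(_, _).1]/= ![(_, _).2]/=.
  by rewrite /tail mulmx0 kappa0 !mulmx0 addr0 mulmx0 addr0.
Qed.

Lemma good_chain : exists u : nat -> nat * seq 'cV[R]_2,
  forall k, [/\ good (u k), (k <= (u k).1)%N & {subset (u k).2 <= (u k.+1).2}].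
Proof.
have ex P : exists Q, good P -> [/\ good Q, (P.1 < Q.1)%N & {subset P.2 <= Q.2}].
  case: (pselect (good P)) => [/good_step[Q hQ]|nP]; first by exists Q.
  by exists P.
have [f hf] := boolp.choice ex.
pose u k := iter k f (0%N, [:: 0] : seq 'cV[R]_2).
have gu k : good (u k).
  by elim: k => [|k /hf[]] //; exact: good_start.
exists u => k; split => //; last by case: (hf _ (gu k)).
elim: k => // k IH; case: (hf _ (gu k)) => _ h _.
exact: leq_ltn_trans IH h.
Qed.

End Chain.

Lemma bounded_sup_approx (S : nat -> R) eps : (forall k, S k <= 1) -> 0 < eps ->
  exists k0, forall k, S k <= S k0 + eps.
Proof.
move=> S1 e0; have hs : has_sup (range S).
  by split; [exists (S 0%N), 0%N | exists 1 => _ [k _ <-]].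
have [_ [k0 _ <-] h] := sup_adherent e0 hs.
exists k0 => k; rewrite -lerBlDr; apply: le_trans (ltW h).
by rewrite lerD2r; apply: ub_le_sup; [case: hs | exists k].
Qed.

(** The spectrum is the union of a chain of good sets F_k. Let S_k be the sum of
|ft (xi + l)|^2 over F_k; it is bounded by 1, so beyond some j it grows by at
most e1. For large k the weights over F_k add up to 1. Over F_k \ F_j they
are at most the squared transforms divided by the lower bound c, thus at most
e1 / c; over F_j they are close to the squared transforms, because the points
A^-n (xi + l) are near 0. So S_j is close to 1. *)
Lemma exists_spectrum : exists L : set 'cV[R]_2,
  [/\ countable L, orthogonal_exponentials mu L & forall xi, saturated mu L xi].
Proof.
have [c [d [kappa [c0 d0 k0 kL kb]]]] := uniform_lower_bound.
have [u hu] := good_chain d0 k0 kL kb.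
pose F k := (u k).2; pose n k := (u k).1.
have fF k : full_level (n k) (F k) by case: (hu k) => -[].
have bF k l y : l \in F k -> `|y| <= d / 2 -> c <= sq (N ^+ n k *m l + y).
  by case: (hu k) => -[_ h] _ _; exact: h.
have mono j k : (j <= k)%N -> {subset F j <= F k}.
  move=> /subnK <-; elim: (k - j)%N => [|i IH] l lF //.
  by rewrite addSn; case: (hu (i + j)%N) => _ _; apply; exact: IH.
have uF k : uniq (F k) by case: (full_level_orthogonal (fF k)).
pose L : set 'cV[R]_2 := \bigcup_k [set` F k].
have oL : orthogonal_exponentials mu L.
  move=> x y [i _ /= xi] [j _ /= yj] xy.
  pose k := maxn i j.
  have xk : x \in F k by apply: mono xi; exact: leq_maxl.
  have yk : y \in F k by apply: mono yj; exact: leq_maxr.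
  have [_ h] := full_level_orthogonal (fF k).
  have := sq_le_level (n k) (x - y); rewrite h //; last by rewrite eq_sym.
  rewrite le_eqVlt ltNge sq_ge0 orbF sqmod_eq0 => /eqP h0.
  exact: h0.
exists L; split => //.
  apply: bigcup_countable => // k _; apply: finite_set_countable.
  exact: finite_seq.
move=> xi eps e0.
(* chosen so that e1 + e1 / c = eps *)
pose e1 := eps / (1 + c^-1).
have cV : 0 < c^-1 by rewrite invr_gt0.
have e10 : 0 < e1 by rewrite divr_gt0 // addr_gt0.
pose S k := \sum_(l <- F k) sq (xi + l).
have S1 k : S k <= 1.
  by rewrite -(fF k xi); apply: ler_sum => l _; exact: sq_le_level.
have [j hj] := bounded_sup_approx S1 e10.
have d2 : 0 < d / 2 by rewrite divr_gt0.
have [d1 d10 near0] := sq_near0 C0 ft_lip e10.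
have [k1 hk1] := eventually_small K0 rho01 decay [:: xi] d2.
have [k2 hk2] := eventually_small K0 rho01 decay [seq xi + l | l <- F j] d10.
pose k := maxn j (maxn k1 k2).
have nk : (k <= n k)%N by case: (hu k).
have jk : (j <= k)%N by rewrite leq_maxl.
have k1n : (k1 <= n k)%N by apply: leq_trans nk; rewrite /k !leq_max leqnn orbT.
have k2n : (k2 <= n k)%N by apply: leq_trans nk; rewrite /k !leq_max leqnn !orbT.
pose T := [seq l <- F k | l \notin F j].
have pFk : perm_eq (F k) (F j ++ T).
  apply: uniq_perm => //.
    rewrite cat_uniq uF filter_uniq // andbT; apply/hasPn => l.
    by rewrite mem_filter => /andP[].
  move=> l; rewrite mem_cat mem_filter.
  by case lj: (l \in F j) => //=; rewrite (mono _ _ jk _ lj).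
have splitF (f : 'cV[R]_2 -> R) : \sum_(l <- F k) f l = \sum_(l <- F j) f l + \sum_(l <- T) f l.
  by rewrite (perm_big _ pFk) big_cat.
have tail_sq : \sum_(l <- T) sq (xi + l) <= e1.
  by have := hj k; rewrite /S splitF lerD2l.
have tail_w : \sum_(l <- T) level_weight (n k) (xi + l) <= e1 / c.
  rewrite ler_pdivlMr //; apply: le_trans tail_sq; rewrite mulr_suml.
  rewrite big_seq [leRHS]big_seq; apply: ler_sum => l.
  rewrite mem_filter => /andP[_ lk].
  rewrite (sq_level (n k)) ler_wpM2l ?level_weight_ge0 // mulmxDr addrC.
  by apply: bF => //; apply: hk1; rewrite // mem_head.
have head_w : 1 - e1 / c <= \sum_(l <- F j) level_weight (n k) (xi + l).
  by have := fF k xi; rewrite splitF; lra.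
have head_sq : (1 - e1) * \sum_(l <- F j) level_weight (n k) (xi + l) <= S j.
  rewrite mulr_sumr /S big_seq [leRHS]big_seq; apply: ler_sum => l lj.
  rewrite (sq_level (n k)) mulrC ler_wpM2l ?level_weight_ge0 //.
  by apply: near0; apply: hk2 => //; exact: map_f.
exists (F j); split => //; first by move=> l lj; exists j.
rewrite -/(S j).
have ee : eps = e1 * (1 + c^-1) by rewrite /e1 divfK // gt_eqF // addr_gt0.
have w1 : \sum_(l <- F j) level_weight (n k) (xi + l) <= 1.
  rewrite -(fF k xi) splitF lerDl; apply: sumr_ge0 => l _; exact: level_weight_ge0.
move: head_sq head_w w1; set w := \sum_(l <- F j) _ => h1 h2 h3.
have h4 : e1 * w <= e1 by rewrite ler_piMr // ltW.
by rewrite ee mulrDr mulr1; lra.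
Qed.

End Sufficiency.

(** * The four digits and admissibility *)

Section Digits.
Variables (a b : 'cV[int]_2).

Definition digits : seq 'cV[int]_2 := [:: 0; a; b; - a - b].

(** The rows are the two free digits, so that B x lists their inner products
with x. *)
Definition digit_mx : 'M[int]_2 := \matrix_(i, j) (if i == ord0 then a else b) j ord0.

Hypothesis odd_ab : oddz (\det digit_mx).

(** The digits are distinct even modulo 2, because the determinant is odd. *)
Lemma uniq_digits : uniq digits.
Proof.
apply: (@map_uniq _ _ parity).
have := odd_ab; rewrite det_mx2 !mxE /= oddzD oddzN !oddzM.
rewrite /parity /= !mxE !oddzD !oddzN -[oddz 0]/false.
by case: (oddz (a ord0 ord0)) (oddz (a ord_max ord0)) (oddz (b ord0 ord0))
  (oddz (b ord_max ord0)) => [] [] [] [].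
Qed.

Lemma sum_digits (R : realType) (x : 'cV[R]_2) :
  \sum_(d <- digits) expi2pi (dot (int_mx R d) x) = 4 * mask digit_mx x.
Proof.
have row i : (int_mx R digit_mx *m x) i ord0 = dot (int_mx R (if i == ord0 then a else b)) x.
  by rewrite mxE /dot; apply: eq_bigr => k _; rewrite !mxE.
have iN : int_mx R (- a) = - int_mx R a by exact: map_mxN.
rewrite /digits !big_cons big_nil int_mx0 dot0l expi2pi0 int_mxB iN dotDl !dotNl.
rewrite /mask !row /= /tetra_mask addr0 mulrA divff ?mul1r ?addrA // pnatr_eq0.
Qed.

End Digits.

Section Admissible.
Variables (R : realType) (M : 'M[int]_2) (a b : 'cV[int]_2).
Variable D : {fset 'cV[int]_2}.
Local Notation A := M^T.
Local Notation AR := (int_mx R A).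
Local Notation N := (invmx AR).
Local Notation B := (digit_mx a b).
Local Notation BR := (int_mx R B).
Hypothesis odd_ab : oddz (\det B).
Hypothesis unitA : AR \in unitmx.
Hypothesis permD : perm_eq D (digits a b).

Lemma card_digits : #|` D| = 4%N.
Proof. by rewrite (perm_size permD). Qed.

(** Columns s and s' have inner product mask (A^-1 (s - s')); unitarity is read
here on columns instead of rows. *)
Lemma admissible_mxP (S : {fset 'cV[int]_2}) :
  admissible_mx R M D S \is unitarymx <->
  forall j k : 'I_#|` D|, mask B (N *m int_mx R (S`_j - S`_k)) = (j == k)%:R.
Proof.
rewrite -trmx_unitary.
have cj (z : R[i]) : Num.conj z = z^*%C by [].
have key (j k : 'I_#|` D|) : ((admissible_mx R M D S)^T *m
    map_mx Num.conj ((admissible_mx R M D S)^T)^T) j k =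
    mask B (N *m int_mx R (S`_j - S`_k)).
  apply: (@mulfI _ (4 : R[i])); first by rewrite pnatr_eq0.
  rewrite -(sum_digits a b) -(perm_big _ permD) /= (big_nth 0) big_mkord mxE mulr_sumr.
  have c4 : (4 : R[i]) * (((Num.sqrt (#|` D|%:R : R))^-1)%:C%C *
      (((Num.sqrt (#|` D|%:R : R))^-1)%:C%C)^*%C) = 1.
    rewrite card_digits (_ : (4%:R : R) = 2 ^+ 2); last by rewrite expr2; ring.
    rewrite sqrtr_sqr ger0_norm // /= oppr0.
    rewrite -(rmorph_nat (real_complex R)) -!rmorphM -(rmorph1 (real_complex R)).
    by congr (real_complex R _); field.
  apply: eq_bigr => i _; rewrite !mxE cj rmorphM mulrACA [LHS]mulrA.
  rewrite [X in X * _]c4 mul1r.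
  rewrite [X in _ * X](_ : _ = (expi2pi (dot (invmx (int_mx R M) *m int_mx R D`_i)
    (int_mx R S`_k)))^*%C) // -expi2piN -expi2piD; congr expi2pi.
  have NM (x y : 'cV[R]_2) : dot x (N *m y) = dot (invmx (int_mx R M) *m x) y.
    by rewrite dot_mulmxr trmx_inv /int_mx map_trmx trmxK.
  by rewrite NM int_mxB [RHS]dotC dotDl dotNl !(dotC (int_mx R S`_ _)).
split.
  by move=> /unitarymxP h j k; rewrite -key h mxE.
by move=> h; apply/unitarymxP/matrixP => j k; rewrite key h mxE.
Qed.

(** One term of the partition of unity at 0 is mask 0 = 1, so the others vanish. *)
Lemma mask_half v : ~ evenmx v -> mask B (2^-1 *: int_mx R v) = 0.
Proof.
move=> ov; apply/eqP; rewrite -sqmod_eq0; apply/eqP.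
have := weight_half (R := R) B 0 v; rewrite add0r /weight => ->.
have : (oddz ((B *m v) ord0 ord0) || oddz ((B *m v) ord_max ord0)).
  apply/negP => /negP; rewrite negb_or => /andP[h0 h1]; apply: ov.
  apply: (evenmx_cancel odd_ab) => i j; rewrite (ord1 j).
  by case: (ord2P i) => ->.
rewrite mulmx0 !mxE !add0r => o.
have := sum_tetra_mask (0 : R) 0; rewrite !add0r tetra_mask0 sqmod1.
have := sqmod_ge0 (tetra_mask (2^-1 : R) 0).
have := sqmod_ge0 (tetra_mask (0 : R) 2^-1).
have := sqmod_ge0 (tetra_mask (2^-1 : R) 2^-1).
move: o; case: (oddz _) (oddz _) => [] [] //= _; rewrite /bit /= ?mul0r ?mul1r; lra.
Qed.

(** If A = 2 H, the vectors H v with v in {0, 1}^2 are a spectrum of the digits: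
A^-1 H (v - v') is half an integer vector that is not even. *)
Lemma evenmx_admissible : evenmx A -> admissible R M D.
Proof.
move=> /evenmxP[H AH].
pose f (r : bool * bool) : 'cV[int]_2 := H *m col2 (r.1%:R) (r.2%:R).
have f_inj : injective f.
  move=> r s /(congr1 ( *:%R 2)); rewrite /f !scalemxAl -AH => e.
  have /(congr1 (mulmx N)) : AR *m int_mx R (col2 r.1%:R r.2%:R) =
      AR *m int_mx R (col2 s.1%:R s.2%:R) by rewrite -!int_mxM e.
  rewrite !mulKmx // => /int_mx_inj {}e.
  have := congr1 (fun v : 'cV[int]_2 => v ord0 ord0) e.
  have := congr1 (fun v : 'cV[int]_2 => v ord_max ord0) e.
  by rewrite !mxE /=; case: r s {e} => [[] []] [[] []].
pose S : {fset 'cV[int]_2} := [fset f r | r in {: bool * bool}]%fset.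
have cS : #|` S| = 4%N.
  by rewrite card_imfset // -cardE card_prod card_bool.
exists S; split; first by rewrite cS card_digits.
apply/admissible_mxP => j k; have [->|jk] := eqVneq j k.
  by rewrite subrr int_mx0 mulmx0 mask0.
have Sf (i : 'I_#|` D|) : exists r, S`_i = f r.
  have : S`_i \in S by apply: mem_nth; rewrite cS -card_digits.
  by move=> /imfsetP[r _ ->]; exists r.
have [[r er] [s es]] := (Sf j, Sf k).
have rs : r != s.
  have lt (i : 'I_#|` D|) : (i < #|` S|)%N by rewrite cS -card_digits.
  apply: contra jk => /eqP rs.
  by have := nth_uniq 0 (lt j) (lt k) (fset_uniq S); rewrite er es rs eqxx => /esym.
have uA : int_mx R (2 *: H) \in unitmx by rewrite -AH.
rewrite er es /f -mulmxBr int_mxM {1}AH (invA_H uA) mask_half // => ev.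
have := ev ord0 ord0; have := ev ord_max ord0; move: rs.
by rewrite !mxE /=; case: r s {ev er es} => [[] []] [[] []].
Qed.

(** Orthogonality of the columns makes w_j = 2 B A^-1 (s_j - s_0) integral with
four different parities, and A adj(B) w_j = 2 p (s_j - s_0) is even. *)
Lemma admissible_evenmx : admissible R M D -> evenmx A.
Proof.
move=> [S [cS /admissible_mxP h]].
pose i0 : 'I_#|` D| := cast_ord (esym card_digits) ord0.
pose z j := N *m int_mx R (S`_j - S`_i0).
have zB (j k : 'I_#|` D|) : z j - z k = N *m int_mx R (S`_j - S`_k).
  by rewrite /z -mulmxBr -int_mxB opprB addrA subrK.
have ex (j : 'I_#|` D|) : exists w, 2 *: (BR *m z j) = int_mx R w.
  have [->|ji] := eqVneq j i0.
    by exists 0; rewrite /z subrr !int_mx0 !mulmx0 scaler0.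
  by have := h j i0; rewrite (negbTE ji) => /mask_eq0[w hw _]; exists w.
have [w hw] := boolp.choice ex.
have winj : injective (fun j => parity (w j)).
  move=> j k e; apply/eqP; apply: contrapT => /negP jk.
  have := h j k; rewrite (negbTE jk) -zB => /mask_eq0[v].
  rewrite mulmxBr scalerBr !hw -int_mxB => /int_mx_inj <-; apply.
  exact: parity_eq.
apply: (evenmx_of_parities odd_ab) => v.
have /codomP[j ej] : parity v \in codom (fun j => parity (w j)).
  by apply: inj_card_onto; rewrite // card_prod card_bool card_ord card_digits.
exists (w j) => //.
have -> : A *m \adj B *m w j = 2 *: (\det B *: (S`_j - S`_i0)).
  apply: (@int_mx_inj R); rewrite !int_mxM -hw !int_mxZ -scalemxAr; congr (_ *: _).
  rewrite -mulmxA [int_mx R (\adj B) *m _]mulmxA -int_mxM mul_adj_mx int_mx_scalar.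
  by rewrite mul_scalar_mx -scalemxAr mulKVmx.
exact: evenmxZ2.
Qed.

End Admissible.

(** * The equivalence *)

Section SelfAffine.
Variables (R : realType) (M : 'M[int]_2) (a b : 'cV[int]_2).
Variables (D : {fset 'cV[int]_2}) (mu : probability (borelRn R 2) R).
Local Notation A := M^T.
Local Notation AR := (int_mx R A).
Local Notation B := (digit_mx a b).
Hypothesis hM : expansive (int_mx R M).
Hypothesis permD : perm_eq D (digits a b).
Hypothesis hmu : self_affine_measure (int_mx R M) [fset int_mx R d | d in D]%fset mu.

Lemma tr_unitmx : AR \in unitmx.
Proof. by rewrite /int_mx -map_trmx unitmx_tr; exact: expansive_unitmx. Qed.

Lemma tr_inv_powers : exists C rho : R,
  [/\ 0 <= C, 0 < rho < 1 & forall k, `|invmx AR ^+ k| <= C * rho ^+ k].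
Proof.
have [C [rho [C0 r01 h]]] := expansive_inv_powers hM.
exists C, rho; split => // k; apply: le_trans (h k).
have -> : invmx AR ^+ k = (invmx (int_mx R M) ^+ k)^T.
  rewrite /int_mx -map_trmx -trmx_inv; elim: k => [|k IH]; first by rewrite !expr0 trmx1.
  by rewrite exprS exprSr IH -!mulmxE trmx_mul.
by apply: mx_norm_le => // i j; rewrite mxE mx_entry_le.
Qed.

Lemma perm_int_digits :
  perm_eq [fset int_mx R d | d in D]%fset (map (int_mx R (n:=1)) (digits a b)).
Proof.
apply: uniq_perm; first exact: fset_uniq.
  by rewrite map_inj_uniq; [rewrite -(perm_uniq permD) fset_uniq | exact: int_mx_inj].
move=> x; apply/imfsetP/mapP => /= -[d dD ->]; exists d => //.
  by rewrite -(perm_mem permD).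
by move: dD; rewrite -(perm_mem permD).
Qed.

Lemma int_digits_neq0 : [fset int_mx R d | d in D]%fset != fset0.
Proof. by rewrite -cardfs_gt0 (perm_size perm_int_digits). Qed.

Lemma ft_mask x : ft mu (AR *m x) = mask B x * ft mu x.
Proof.
have := ft_self_affine (AR *m x) int_digits_neq0 hmu.
have -> : (invmx (int_mx R M))^T *m (AR *m x) = x.
  by rewrite trmx_inv /int_mx map_trmx mulKmx // tr_unitmx.
move=> -> /=; rewrite (perm_size perm_int_digits) (perm_big _ perm_int_digits).
by rewrite size_map big_map sum_digits mulrA mulVf ?mul1r // pnatr_eq0.
Qed.

Lemma self_affine_support : exists2 K : R, 0 <= K & mu (~` [set x | `|x| <= K]) = 0%E.
Proof.
have [C [rho [C0 r01 h]]] := expansive_inv_powers hM.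
exact: (self_affine_bounded_support int_digits_neq0 hmu C0 r01 h).
Qed.

Hypothesis odd_ab : oddz (\det B).

Lemma spectral_evenmx : spectral_measure mu -> evenmx A.
Proof.
move=> [_ [L [_ /orthonormal_basis_saturated[oL sat]]]].
have [Ks Ks0 hK] := self_affine_support; have [C C0 lip] := ft_lipschitz Ks0 hK.
have [K [rho [K0 r01 decay]]] := tr_inv_powers.
apply: (spectrum_evenmx odd_ab tr_unitmx ft_mask _ oL sat).
exact: (ft_eq0_mask tr_unitmx ft_mask C0 lip K0 r01 decay).
Qed.

Lemma evenmx_spectral : evenmx A -> spectral_measure mu.
Proof.
move=> /evenmxP[H AH].
have [Ks Ks0 hK] := self_affine_support; have [C C0 lip] := ft_lipschitz Ks0 hK.
have [K [rho [K0 r01 decay]]] := tr_inv_powers.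
have uA := tr_unitmx; have rec := ft_mask.
have zero := ft_eq0_mask uA rec C0 lip K0 r01 decay.
rewrite AH in uA rec zero decay.
have [L [cL oL sat]] := exists_spectrum odd_ab uA rec zero C0 lip K0 r01 decay.
split; first exact: bounded_compactly_supported hK.
by exists L; split => //; exact: saturated_orthonormal_basis.
Qed.

End SelfAffine.

Theorem theorem1p4 (R : realType) (M : 'M[int]_2)
    (alpha1 alpha2 beta1 beta2 : int) (D : {fset 'cV[int]_2})
    (mu : probability (borelRn R 2) R)
    (hM : expansive (int_mx R M))
    (hD : D = [fset col2 0 0; col2 alpha1 alpha2; col2 beta1 beta2;
                    col2 (- alpha1 - beta1) (- alpha2 - beta2)])
    (hdet : alpha1 * beta2 - alpha2 * beta1 != 0)
    (hmu : self_affine_measure (int_mx R M) [fset int_mx R d | d in D] mu)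
    (hodd : ~~ (2 %| alpha1 * beta2 - alpha2 * beta1)%Z) :
  [<-> spectral_measure mu;
       forall i j, (2 %| M i j)%Z;
       [set int_mx R M *m v | v in F22 R] `<=` range (int_mx R);
       admissible R M D].
Proof.
pose a := col2 alpha1 alpha2; pose b := col2 beta1 beta2.
have odd_ab : oddz (\det (digit_mx a b)) by rewrite det_mx2 !mxE.
have permD : perm_eq D (digits a b).
  apply: uniq_perm; [exact: fset_uniq | exact: uniq_digits | move=> v].
  have z : col2 0 0 = 0 :> 'cV[int]_2 by apply: cV2P; rewrite !mxE.
  have n : col2 (- alpha1 - beta1) (- alpha2 - beta2) = - a - b.
    by apply: cV2P; rewrite !mxE.
  by rewrite hD !inE z n -!orbA.
have uA := tr_unitmx hM.
have evenE : evenmx M^T <-> forall i j, (2 %| M i j)%Z.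
  split=> h i j; first by have := h j i; rewrite mxE /oddz negbK.
  by rewrite mxE /oddz negbK.
tfae.
- by move=> /(spectral_evenmx hM permD hmu odd_ab)/evenE.
- move=> /evenE/evenmx_tr; rewrite trmxK => /evenmxP[H MH] _ [v [[l1 hl1 [l2 hl2 <-]] _] <-].
  have bitE (l : R) : [set 0; 1] l -> exists n : int, l = n%:~R.
    by move=> [->|->]; [exists 0 | exists 1].
  have [n1 e1] := bitE _ hl1; have [n2 e2] := bitE _ hl2.
  exists (H *m col2 n1 n2) => //.
  rewrite MH int_mxZ -scalemxAl -scalemxAr scalerA divff ?scale1r ?int_mxM //.
  by congr (_ *m _); apply: cV2P; rewrite !mxE /= ?e1 ?e2.
- move=> h; apply: (evenmx_admissible odd_ab uA permD).
  have col_even (l1 l2 : bool) : l1 || l2 -> evenmx (M *m col2 l1%:R l2%:R).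
    move=> nz; have Fv : F22 R (2^-1 *: col2 l1%:R l2%:R).
      have bitR (l : bool) : [set 0; 1 : R] l%:R by case: l; [right | left].
      split; first by exists l1%:R => //; exists l2%:R.
      move=> /eqP; rewrite scaler_eq0 invr_eq0 pnatr_eq0 /= => /eqP v0.
      have := congr1 (fun v : 'cV[R]_2 => v ord0 ord0) v0.
      have := congr1 (fun v : 'cV[R]_2 => v ord_max ord0) v0.
      rewrite !mxE /= => /eqP; rewrite pnatr_eq0 => + /eqP; rewrite pnatr_eq0.
      by move: nz; case: (l1) (l2) => [] [].
    have [w _ e] := h _ (ex_intro2 _ _ _ Fv erefl).
    have -> : M *m col2 l1%:R l2%:R = 2 *: w; last exact: evenmxZ2.
    apply: (@int_mx_inj R); rewrite int_mxZ e int_mxM -scalemxAr scalerA divff //.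
    by rewrite scale1r; congr (_ *m _); apply: cV2P; rewrite !mxE /= ?rmorph_nat.
  move=> i j; rewrite mxE; case: (ord2P i) => ->.
    by have := col_even true false isT j ord0; rewrite mxE sum_ord2 !mxE /= mulr1 mulr0 addr0.
  by have := col_even false true isT j ord0; rewrite mxE sum_ord2 !mxE /= mulr1 mulr0 add0r.
- move=> adm; apply: (evenmx_spectral hM permD hmu odd_ab).
  exact: (admissible_evenmx odd_ab uA permD adm).
Qed.
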